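(* Let $(M^n,T_{10})$, $n=2m+1$, be a strictly pseudoconvex, partially integrable CR-manifold with a pseudo-Hermitian structure $\theta$ and Fefferman metric $f_\theta$ on the canonical $S^1$-bundle $F_c$. Let $f\in C^\infty(M)$ be a real function and let $\tilde\theta=e^{2f}\theta$ be a rescaled pseudo-Hermitian structure. Then the corresponding Fefferman metric rescales by $$f_{\tilde\theta}=e^{2f}\cdot f_\theta .$$
   Context: Conventions: $d\alpha(X,Y)=X\alpha(Y)-Y\alpha(X)-\alpha([X,Y])$, $\alpha\circ\beta=\frac12(\alpha\otimes\beta+\beta\otimes\alpha)$. Functions and forms on $M$ are pulled back to $F_c$. CR-structures. $M$ is a connected smooth manifold of dimension $n=2m+1$, $m\ge 1$. An almost CR-structure is a complex rank-$m$ subbundle $T_{10}\subset TM\otimes\mathbb{C}$ with $T_{10}\cap T_{01}=0$, $T_{01}:=\overline{T_{10}}$; put $H=\mathrm{Re}(T_{10}\oplus T_{01})$. It is non-degenerate if $H$ is a contact distribution, and a non-degenerate one is partially integrable if $[\Gamma(T_{10}),\Gamma(T_{10})]\subset\Gamma(T_{10}\oplus T_{01})$. A pseudo-Hermitian form is a nowhere vanishing real 1-form $\theta$ with $\theta|_H=0$; its Reeb field $T$ satisfies $\theta(T)=1$, $d\theta(T,\cdot)=0$. The Levi form is $L_\theta(U,V)=-i\,d\theta(U,\bar V)$ on $T_{10}$, extended to $TM\otimes\mathbb{C}$ by $L_\theta(U,\bar V)=0$, $L_\theta(T,\cdot)=0$, $L_\theta(\bar U,\bar V)=\overline{L_\theta(U,V)}$;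 restricted to $TM$ this gives a real symmetric bilinear form, again denoted $L_\theta$. Strictly pseudoconvex: $L_\theta$ is definite on $H$; $\theta$ is then chosen with $L_\theta$ positive definite. Tanaka–Webster connection: the unique covariant derivative $\nabla^W$ on $T_{10}$ with $\nabla^W_TU=pr_{10}[T,U]$, $\nabla^W_{\bar V}U=pr_{10}[\bar V,U]$, $X(L_\theta(U,V))=L_\theta(\nabla^W_XU,V)+L_\theta(U,\nabla^W_{\bar X}V)$ for $U,V\in\Gamma(T_{10})$, $X\in TM\otimes\mathbb C$ (projections with respect to $TM\otimes\mathbb{C}=T_{10}\oplus T_{01}\oplus\mathbb{C}T$). For a local $L_\theta$-orthonormal frame $\{Z_\alpha\}$ of $T_{10}$, with $\omega_\alpha^\beta=L_\theta(\nabla^WZ_\alpha,Z_\beta)$: $Ric^W=\sum_\alpha d\omega_\alpha^\alpha$, $scal^W=\sum_\beta Ric^W(Z_\beta,Z_{\bar\beta})$. Fefferman metric. $\Lambda^{m+1,0}M$ is the complex line bundle of complex $(m+1)$-forms annihilated by insertion of $T_{01}$; $F_c:=(\Lambda^{m+1,0}M\setminus 0)/\mathbb{R}^+$ is the canonical $S^1$-principal bundle $\pi:F_c\to M$. $\nabla^W$ induces a connection form $A^W:TF_c\to i\mathbb{R}$, with $[\tau]^*A^W=-\sum_\alpha\omega_\alpha^\alpha$ for the local section $[\tau]$, $\tau=\theta\wedge\theta^1\wedge\dots\wedge\theta^m$, $\theta^\alpha=L_\theta(\cdot,Z_\alpha)$. Set $A_\theta:=A^W-\frac{i}{2(m+1)}scal^W\theta$.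 The Fefferman metric is $f_\theta:=\pi^*L_\theta-i\frac{4}{m+2}\pi^*\theta\circ A_\theta$. *)

(* Defs.v *)
From HB Require Import structures.
From mathcomp Require Import all_boot all_order all_algebra.
From mathcomp Require Export complex.
From mathcomp Require Import all_classical all_reals all_analysis.

Set Implicit Arguments.
Unset Strict Implicit.
Unset Printing Implicit Defensive.
Import Order.TTheory GRing.Theory Num.Theory numFieldNormedType.Exports.
Local Open Scope classical_set_scope.
Local Open Scope ring_scope.
Local Open Scope complex_scope.

(* A smooth structure on a set X is given here by a family P of local
   parametrizations (V, psi), with V open in R^d and psi : V -> X.  All smooth
   objects are germs: functions, fields and forms are total functions on X, and
   only their values near the point under consideration matter.  Everything is
   complexified: functions are C-valued, tangent vectors are elements of
   TX \otimes C, and real objects are those fixed by conjugation. *)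

Section Smooth.
Context (R : realType).
Implicit Types d : nat.
Local Notation C := R[i].

Fixpoint Ck_on d (k : nat) (U : set 'rV[R]_d) (h : 'rV[R]_d -> R) : Prop :=
  (forall u, U u -> {for u, continuous h}) /\
  if k is k'.+1 then
    forall j : 'I_d, (forall u, U u -> derivable h u (delta_mx 0 j)) /\
      Ck_on k' U (fun u => 'D_(delta_mx 0 j) h u)
  else True.

Definition Cinfty_on d (U : set 'rV[R]_d) (h : 'rV[R]_d -> R) : Prop :=
  forall k, Ck_on k U h.

Definition Cinfty_near d (h : 'rV[R]_d -> C) (u : 'rV[R]_d) : Prop :=
  exists U, [/\ open U, U u, Cinfty_on U (fun w => complex.Re (h w))
    & Cinfty_on U (fun w => complex.Im (h w))].

Definition cpartial d (h : 'rV[R]_d -> C) (j : 'I_d) (u : 'rV[R]_d) : C :=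
  'D_(delta_mx 0 j) (fun w => complex.Re (h w)) u +i*
  'D_(delta_mx 0 j) (fun w => complex.Im (h w)) u.

Definition param d (X : Type) : Type :=
  (set 'rV[R]_d * ('rV[R]_d -> X))%type.

(* A tangent vector acts on C-valued functions; see tangent below. *)
Definition tvec (X : Type) : Type := (X -> C) -> C.
Definition conjv (X : Type) (v : tvec X) : tvec X :=
  fun g => (v (fun x => (g x)^*))^*.

Definition vfield (X : Type) : Type := X -> tvec X.
Definition form1 (X : Type) : Type := X -> tvec X -> C.

Section Fixed_structure.
Context (d : nat) (X : Type) (P : set (param d X)).

Definition near_point (x : X) (Q : X -> Prop) : Prop :=
  forall V psi u, P (V, psi) -> V u -> psi u = x ->
    \forall w \near u, Q (psi w).

Definition smooth_at (g : X -> C) (x : X) : Prop :=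
  forall V psi u, P (V, psi) -> V u -> psi u = x -> Cinfty_near (g \o psi) u.

(* Elements of T_xX \otimes C: the operators sum_j a_j d/du_j of a local
   parametrization, acting on the functions smooth near x.  The value 0 on all
   other functions makes equality of tangent vectors Leibniz equality. *)
Definition tangent (x : X) : set (tvec X) := [set v |
  exists V psi u (a : 'I_d -> C), [/\ P (V, psi), V u, psi u = x &
    forall g, v g = if `[< smooth_at g x >]
                    then \sum_(j < d) a j * cpartial (g \o psi) j u else 0]].

Definition real_tangent (x : X) : set (tvec X) :=
  [set v | tangent x v /\ conjv v = v].

Definition smooth_field (Y : vfield X) (x : X) : Prop :=
  near_point x (fun y => tangent y (Y y)) /\
  forall g, smooth_at g x -> smooth_at (fun y => Y y g) x.

Definition lie (Y Z : vfield X) : vfield X := fun x g =>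
  if `[< smooth_at g x >]
  then Y x (fun y => Z y g) - Z x (fun y => Y y g) else 0.

Definition linear_on (A : set (tvec X)) (l : tvec X -> C) : Prop :=
  forall a v w, A v -> A w -> l (a *: v + w) = a * l v + l w.

Definition smooth_form1 (al : form1 X) (x : X) : Prop :=
  near_point x (fun y => linear_on (tangent y) (al y)) /\
  forall Y, smooth_field Y x -> smooth_at (fun y => al y (Y y)) x.

Definition real_form1 (al : form1 X) (x : X) : Prop :=
  forall v, tangent x v -> al x (conjv v) = (al x v)^*.

(* d al (v, w) = Y (al Z) - Z (al Y) - al [Y, Z] for any local fields Y, Z
   extending v, w; it does not depend on the extensions when al is smooth. *)
Definition dform (al : form1 X) (x : X) (v w : tvec X) : C :=
  xget 0 [set c | exists Y Z : vfield X,
    [/\ smooth_field Y x, smooth_field Z x, Y x = v, Z x = w &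
     c = Y x (fun y => al y (Z y)) - Z x (fun y => al y (Y y))
         - al x (lie Y Z x)]].

End Fixed_structure.

Definition pushforward d' (X' : Type) (P' : set (param d' X')) (X : Type)
    (s : X -> X') (x : X) (v : tvec X) : tvec X' :=
  fun g => if `[< smooth_at P' g (s x) >] then v (g \o s) else 0.

Record chart d (X : topologicalType) := Chart {
  chart_dom : set X;
  chart_img : set 'rV[R]_d;
  chart_map : X -> 'rV[R]_d;
  chart_inv : 'rV[R]_d -> X }.

Definition is_chart d (X : topologicalType) (c : chart d X) : Prop :=
  [/\ open (chart_dom c) /\ open (chart_img c),
      forall x, chart_dom c x -> chart_img c (chart_map c x) /\
        chart_inv c (chart_map c x) = x,
      forall u, chart_img c u -> chart_dom c (chart_inv c u) /\
        chart_map c (chart_inv c u) = u,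
      forall x, chart_dom c x -> {for x, continuous (chart_map c)} &
      forall u, chart_img c u -> {for u, continuous (chart_inv c)}].

Definition compatible d (X : topologicalType) (c c' : chart d X) : Prop :=
  forall j : 'I_d,
    Cinfty_on (chart_img c `&` chart_inv c @^-1` chart_dom c')
              (fun u => chart_map c' (chart_inv c u) 0 j).

Record manifold (n : nat) := Manifold {
  carrier :> topologicalType;
  atlas : set (chart n carrier);
  atlas_chart : forall c, atlas c -> is_chart c;
  atlas_cover : forall x, exists2 c, atlas c & chart_dom c x;
  atlas_compatible : forall c c', atlas c -> atlas c' -> compatible c c';
  manifold_hausdorff : hausdorff_space carrier;
  manifold_second_countable : @second_countable carrier }.

Definition mparams n (M : manifold n) : set (param n M) :=
  [set p | exists2 c, atlas c & p = (chart_img c, chart_inv c)].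

End Smooth.
Arguments mparams {R n} M.

Section CR.
Context (R : realType) (m : nat) (M : manifold R (2 * m).+1).
Local Notation C := R[i].
Local Notation iC := (0 +i* 1 : C).
Local Notation tvecM := (tvec R M).
Local Notation PM := (mparams M).
Local Notation tangentM := (tangent PM).

Section Structure.
Context (T10 : M -> set tvecM).

Definition T01 (x : M) : set tvecM := [set v | T10 x (conjv v)].
Definition T10_T01 (x : M) : set tvecM :=
  [set v | exists u w, [/\ T10 x u, T01 x w & v = u + w]].
Definition Hdist (x : M) : set tvecM := [set v | T10_T01 x v /\ conjv v = v].

Definition section10 (U : vfield R M) (x : M) : Prop :=
  smooth_field PM U x /\ near_point PM x (fun y => T10 y (U y)).

Definition local_frame (Z : 'I_m -> vfield R M) (x : M) : Prop :=
  (forall a, section10 (Z a) x) /\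
  near_point PM x (fun y =>
    (forall c : 'I_m -> C, \sum_a c a *: Z a y = 0 -> forall a, c a = 0) /\
    (forall v, T10 y v -> exists c : 'I_m -> C, v = \sum_a c a *: Z a y)).

Definition almost_CR : Prop :=
  [/\ forall x a v w, T10 x v -> T10 x w -> T10 x (a *: v + w),
      forall x, exists Z, local_frame Z x &
      forall x v, T10 x v -> T01 x v -> v = 0].

Definition CR_nondegenerate : Prop := forall x, exists eta : form1 R M,
  near_point PM x (fun y =>
    [/\ smooth_form1 PM eta y, real_form1 PM eta y,
        (forall v, Hdist y v <-> real_tangent PM y v /\ eta y v = 0) &
        (forall v, Hdist y v -> (forall w, Hdist y w -> dform PM eta y v w = 0) ->
           v = 0)]).

Definition partially_integrable : Prop :=
  forall x U V, section10 U x -> section10 V x -> T10_T01 x (lie PM U V x).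

Definition pseudo_hermitian (th : form1 R M) : Prop := forall x,
  [/\ smooth_form1 PM th x, real_form1 PM th x,
      exists2 v, real_tangent PM x v & th x v != 0 &
      forall v, Hdist x v -> th x v = 0].

Section Pseudo_hermitian.
Context (th : form1 R M).

Definition reeb : vfield R M := fun x => xget 0 [set t |
  [/\ real_tangent PM x t, th x t = 1 &
      forall w, tangentM x w -> dform PM th x t w = 0]].

Definition pr10 (x : M) (v : tvecM) : tvecM := xget 0 [set u |
  T10 x u /\ exists w c, T01 x w /\ v = u + w + c *: reeb x].
Definition pr01 (x : M) (v : tvecM) : tvecM := xget 0 [set w |
  T01 x w /\ exists u c, T10 x u /\ v = u + w + c *: reeb x].

Definition levi10 (x : M) (u v : tvecM) : C :=
  - iC * dform PM th x u (conjv v).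

(* The sesquilinear extension of levi10 to TM \otimes C. *)
Definition levi (x : M) (v w : tvecM) : C :=
  levi10 x (pr10 x v) (pr10 x w) +
  (levi10 x (conjv (pr01 x v)) (conjv (pr01 x w)))^*.

Definition levi_positive : Prop :=
  forall x v, Hdist x v -> v != 0 -> 0 < levi x v v.

Definition orthonormal_frame (Z : 'I_m -> vfield R M) (x : M) : Prop :=
  local_frame Z x /\
  near_point PM x (fun y =>
    forall a b, levi y (Z a y) (Z b y) = (a == b)%:R).

(* nabla x v U is the derivative at x of the section U in the direction v. *)
Definition covd : Type := M -> tvecM -> vfield R M -> tvecM.

Definition covariant_derivative (nabla : covd) : Prop := forall x,
  [/\ forall v U, tangentM x v -> section10 U x -> T10 x (nabla x v U),
      forall a v w U, tangentM x v -> tangentM x w -> section10 U x ->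
        nabla x (a *: v + w) U = a *: nabla x v U + nabla x w U,
      forall v U V, tangentM x v -> section10 U x -> section10 V x ->
        nabla x v (fun y => U y + V y) = nabla x v U + nabla x v V,
      forall v g U, tangentM x v -> smooth_at PM g x -> section10 U x ->
        nabla x v (fun y => g y *: U y) = v g *: U x + g x *: nabla x v U &
      forall Y U, smooth_field PM Y x -> section10 U x ->
        smooth_field PM (fun y => nabla y (Y y) U) x].

Definition tanaka_webster (nabla : covd) : Prop :=
  [/\ covariant_derivative nabla,
      forall x U, section10 U x ->
        nabla x (reeb x) U = pr10 x (lie PM reeb U x),
      forall x U V, section10 U x -> section10 V x ->
        nabla x (conjv (V x)) U = pr10 x (lie PM (fun y => conjv (V y)) U x) &
      forall x v U V, tangentM x v -> section10 U x -> section10 V x ->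
        v (fun y => levi y (U y) (V y)) =
        levi x (nabla x v U) (V x) + levi x (U x) (nabla x (conjv v) V)].

Definition omega (nabla : covd) (Z : 'I_m -> vfield R M) (a b : 'I_m) :
  form1 R M := fun x v => levi x (nabla x v (Z a)) (Z b x).

Definition ricci (nabla : covd) (Z : 'I_m -> vfield R M) (x : M)
    (v w : tvecM) : C :=
  \sum_(a < m) dform PM (omega nabla Z a a) x v w.

Definition webster_scalar (nabla : covd) (s : M -> C) : Prop :=
  forall x Z, orthonormal_frame Z x ->
    s x = \sum_(b < m) ricci nabla Z x (Z b x) (conjv (Z b x)).

End Pseudo_hermitian.

(* Forms on T_xM \otimes C, extended by 0 to tuples that are not tangent. *)
Definition mform : Type := ('I_m.+1 -> tvecM) -> C.

Definition Lambda (x : M) : set mform := [set tau |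
  [/\ forall w i, ~ tangentM x (w i) -> tau w = 0,
      forall w i, (forall j, tangentM x (w j)) ->
        linear_on (tangentM x) (fun v => tau [eta w with i |-> v]),
      forall w i j, i != j -> w i = w j -> tau w = 0 &
      forall w i, T01 x (w i) -> tau w = 0]].

Definition smooth_mform (tau : M -> mform) (x : M) : Prop :=
  forall Y : 'I_m.+1 -> vfield R M, (forall i, smooth_field PM (Y i) x) ->
    smooth_at PM (fun y => tau y (fun i => Y i y)) x.

Definition ray (tau : mform) : set mform :=
  [set r%:C *: tau | r in [set r : R | 0 < r]].

(* A point of F_c is a pair (x, R^+ tau) with tau in Lambda x non-zero. *)
Definition Fpoint : Type := (M * set mform)%type.
Definition Fc : set Fpoint := [set q |
  exists tau, [/\ Lambda q.1 tau, tau <> 0 & q.2 = ray tau]].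

Definition act (q : Fpoint) (z : C) : Fpoint :=
  (q.1, [set z *: tau | tau in q.2]).

Definition cis (t : R) : C := cos t +i* sin t.

Definition tail n (w : 'rV[R]_n.+1) : 'rV[R]_n :=
  \row_(i < n) w 0 (lift ord0 i).

(* Local parametrizations (t, u) |-> [e^{it} tau_(psi u)] of F_c, for a chart
   with inverse psi and a nowhere zero local section tau of Lambda. *)
Definition Fparams : set (param R (2 * m).+2 Fpoint) := [set p |
  exists c (U : set M) tau,
  [/\ atlas c, open U,
      forall x, U x -> [/\ Lambda x (tau x), tau x <> 0 & smooth_mform tau x] &
      p = ([set w | chart_img c (tail w) /\ U (chart_inv c (tail w))],
           fun w => let x := chart_inv c (tail w) in
             act (x, ray (tau x)) (cis (w 0 0)))]].

Local Notation tvecF := (tvec R Fpoint).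

Definition Fproj (q : Fpoint) : M := q.1.
Definition dFproj (q : Fpoint) (v : tvecF) : tvecM := pushforward PM Fproj q v.

(* The value at q of the fundamental vector field of i in Lie(S^1) = iR. *)
Definition fundamental (q : Fpoint) : tvecF := fun g =>
  if `[< smooth_at Fparams g q >]
  then derive1 (fun t : R => complex.Re (g (act q (cis t)))) 0 +i*
       derive1 (fun t : R => complex.Im (g (act q (cis t)))) 0
  else 0.

(* Principal S^1-connection forms A : TF_c -> iR, extended C-linearly. *)
Definition connection_form (A : form1 R Fpoint) : Prop := forall q, Fc q ->
  [/\ smooth_form1 Fparams A q,
      forall v, tangent Fparams q v -> A q (conjv v) = - (A q v)^*,
      A q (fundamental q) = iC &
      forall t v, tangent Fparams q v ->
        A (act q (cis t))
          (pushforward Fparams (fun q' => act q' (cis t)) q v) = A q v].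

Section Fefferman.
Context (th : form1 R M).

(* theta /\ theta^1 /\ ... /\ theta^m with theta^a = L(., Z_a). *)
Definition frame_mform (Z : 'I_m -> vfield R M) (x : M) : mform := fun w =>
  if `[< forall j, tangentM x (w j) >] then
    \det (\matrix_(i < m.+1, j < m.+1)
      if unlift ord0 i is Some a then levi th x (w j) (Z a x) else th x (w j))
  else 0.

Definition webster_connection_form (nabla : covd) (A : form1 R Fpoint) : Prop :=
  connection_form A /\
  forall x Z v, orthonormal_frame th Z x -> tangentM x v ->
    let s : M -> Fpoint := fun y => (y, ray (frame_mform Z y)) in
    A (s x) (pushforward Fparams s x v) = - \sum_(a < m) omega th nabla Z a a x v.

Definition A_theta (A : form1 R Fpoint) (s : M -> C) : form1 R Fpoint :=
  fun q v => A q v -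
    iC / (2 * (m%:R + 1)) * s (Fproj q) * th (Fproj q) (dFproj q v).

Definition is_fefferman_metric (F : Fpoint -> tvecF -> tvecF -> C) : Prop :=
  exists (nabla : covd) (s : M -> C) (A : form1 R Fpoint),
    [/\ tanaka_webster th nabla, webster_scalar th nabla s,
        webster_connection_form nabla A &
    forall q v w, Fc q ->
      real_tangent Fparams q v -> real_tangent Fparams q w ->
      F q v w = levi th (Fproj q) (dFproj q v) (dFproj q w) -
        iC * (4 / (m%:R + 2)) *
        ((th (Fproj q) (dFproj q v) * A_theta A s q w +
          A_theta A s q v * th (Fproj q) (dFproj q w)) / 2)].

End Fefferman.

End Structure.

End CR.

(* Main.v *)
(* Let Z be an orthonormal frame of T_10 for L_theta with dual coframe theta^a,
   let f_a = Z_a f, let f_abar be its conjugate and N = sum_a f_a f_abar.  The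
   frame e^{-f} Z is orthonormal for theta' = e^{2f} theta, and both frames give
   the same local section of F_c.  As e^{2f} T' = T - 2i sum f_abar Z_a + 2i sum
   f_a conj(Z_a), the trace of the Tanaka-Webster connection changes by
     (m + 2) sum_a (f_a theta^a - f_abar theta^abar) + S theta
   for a function S, and the identity dd theta = 0 shows that
     e^{2f} scal' = scal + 2 (m + 1) (2 (m + 2) N + i S).
   Hence S cancels in A_theta, which changes by - (m + 2) (beta + 2i N theta),
   where beta = - i df o J.  A tangent vector of F_c is the push-forward of a
   tangent vector of M along a local section plus a multiple of the fundamental
   field, so this holds for all tangent vectors.  Finally
     L' = e^{2f} (L - 4i theta o beta + 8 N theta o theta),
   and the correction terms cancel in f_theta'. *)

From HB Require Import structures.
Require Import Defs.
From mathcomp Require Import all_boot all_order all_algebra.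
From mathcomp Require Import fingroup perm.
From mathcomp Require Import all_classical all_reals all_analysis.
From mathcomp Require Import ring lra.
Set Implicit Arguments.
Unset Strict Implicit.
Unset Printing Implicit Defensive.
Import Order.TTheory GRing.Theory Num.Theory numFieldNormedType.Exports.
Local Open Scope classical_set_scope.
Local Open Scope ring_scope.
Local Open Scope complex_scope.

(** * Calculus in coordinates and on manifolds *)

Section Calculus.
Context {R : realType}.
Implicit Types d k : nat.

Local Notation e_ j := (delta_mx 0 j).

(** The form A^W is known only along the sections given by orthonormal frames, while the claim
    concerns all points and tangent vectors of F_c. So every local section of F_c has to be realised
    near a point by an orthonormal frame: Gram-Schmidt supplies a frame, and multiplying one of its
    vectors by a phase adjusts the ray. The trace of the connection is computed from Lie brackets
    alone: two of the defining equations give its values on T and T_01, and the metric condition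
    transfers them to T_10 by conjugation. Both S and the change of the Ricci form contain second
    derivatives Z_b(conj(Z_b) f). They occur in the same sum, so the change of the scalar curvature
    involves only S and N. Matching the two sums requires trading the traces of [Z_c, Z_a] for
    components of [Z_b, conj(Z_b)]; this is what dd theta = 0 does, in the form of theta applied to
    a Jacobi identity. The constants are then forced: 1/(2(m+1)) makes the S of the curvature term
    cancel the S of the connection term, and 4/(m+2) turns the factor m+2 into the 4 of the Levi
    form. *)

Lemma is_derive_line d (h : 'rV[R]_d -> R) (w e : 'rV[R]_d) (s : R) :
  derivable h (w + s *: e) e ->
  is_derive s 1 (fun t : R => h (w + t *: e)) ('D_e h (w + s *: e)).
Proof.
move=> /derivable1P hd.
have E : (fun t : R => h (w + t *: e)) =
    (fun t => h (t *: e + (w + s *: e))) \o (fun t : R => t - s).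
  apply/funext => t /=; congr h.
  by rewrite addrCA -scalerDl subrK.
have D1 : derivable (fun t : R => h (w + t *: e)) s 1.
  rewrite E; apply/derivable1_diffP/differentiable_comp; first by [].
  by rewrite subrr; apply/derivable1_diffP.
apply: DeriveDef => //.
rewrite /derive; set g1 := (X in lim (X @ _)); set g2 := (X in _ = lim (X @ _)).
suff -> : g1 = g2 by [].
apply/funext => t; rewrite /g1 /g2 /=; congr (_ *: (h _ - h _)).
by rewrite addrCA -scalerDl [t *: 1]mulr1.
Qed.

Lemma MVT_line d (h : 'rV[R]_d -> R) (w e : 'rV[R]_d) (c : R) :
  (forall s, `|s| <= `|c| -> derivable h (w + s *: e) e) ->
  exists2 s : R, `|s| <= `|c| & h (w + c *: e) - h w = c * 'D_e h (w + s *: e).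
Proof.
move=> hd; pose f (t : R) := h (w + t *: e).
have f0 : f 0 = h w by rewrite /f scale0r addr0.
have fd (s : R) : `|s| <= `|c| -> is_derive s 1 f ('D_e h (w + s *: e)).
  by move=> sc; apply: is_derive_line; exact: hd.
have fc (a b : R) : (forall s : R, s \in `[a, b]%R -> `|s| <= `|c|) ->
    {within `[a, b], continuous f}.
  move=> ab; apply: derivable_within_continuous => s sab.
  exact/ex_derive/fd/ab.
have [c0|c0] := leP 0 c.
  have ab (s : R) : s \in `[0, c]%R -> `|s| <= `|c|.
    by rewrite in_itv/= => /andP[s0 sc]; rewrite !ger0_norm.
  have [s sc E] := @MVT_segment R f _ _ _ c0 (fun s sI => fd s (ab s
     (subset_itv_oo_cc sI))) (fc _ _ ab).
  exists s; first exact: ab.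
  by rewrite mulrC -f0; move: E; rewrite subr0.
have ab (s : R) : s \in `[c, 0]%R -> `|s| <= `|c|.
  by rewrite in_itv/= => /andP[s0 sc]; rewrite !ler0_norm ?lerN2 // ltW.
have [s sc E] := @MVT_segment R f _ _ _ (ltW c0) (fun s sI => fd s (ab s
   (subset_itv_oo_cc sI))) (fc _ _ ab).
exists s; first exact: ab.
by rewrite -f0 -[LHS]opprB; move: E; rewrite sub0r /f => ->; rewrite mulrN opprK mulrC.
Qed.

Lemma norm_coord d (v : 'rV[R]_d) j : `|v 0 j| <= `|v|.
Proof.
rewrite [leRHS]/Num.Def.normr/= mx_normrE; apply/bigmax_geP; right => /=.
by exists (0, j).
Qed.

Lemma norm_le_coord d (v : 'rV[R]_d) (M : R) : 0 <= M ->
  (forall j, `|v 0 j| <= M) -> `|v| <= M.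
Proof.
move=> M0 vM; rewrite [leLHS]/Num.Def.normr/= mx_normrE; apply/bigmax_leP; split => //=.
by move=> [i j] _ /=; rewrite ord1.
Qed.

(** It has two roles: with c the row of partial derivatives it is the candidate differential, with c
    a basis row it is a coordinate function. *)
Definition dotmap d (c v : 'rV[R]_d) : R := \sum_j v 0 j * c 0 j.

Lemma dotmap_is_linear d (c : 'rV[R]_d) : linear (dotmap c).
Proof.
move=> a u v; rewrite /dotmap scaler_sumr -big_split/=.
by apply: eq_bigr => j _; rewrite !mxE mulrDl -mulrA.
Qed.
HB.instance Definition _ d (c : 'rV[R]_d) :=
  GRing.isLinear.Build R 'rV[R]_d R _ (dotmap c) (@dotmap_is_linear d c).

Lemma continuous_dotmap d (c : 'rV[R]_d) : continuous (dotmap c).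
Proof.
move=> u; rewrite /dotmap.
apply: (@cvg_big R _ +%R 0 xpredT (@add_continuous R) _ (nbhs u) _
  (fun j (v : 'rV[R]_d) => v 0 j * c 0 j) (fun j => u 0 j * c 0 j) (nbhs_filter u)) => j _.
apply: cvgM; last exact: cvg_cst.
exact: coord_continuous.
Qed.

(** The increment of h is split along a path parallel to the axes. The mean value theorem applies on
    each leg, and by continuity each partial derivative met there is within [eta] of its value at
    u. *)
Lemma C1_differentiable d (U : set 'rV[R]_d) (h : 'rV[R]_d -> R) u :
  open U -> U u -> Ck_on 1 U h ->
  differentiable h u /\
  forall v, 'd h u v = \sum_j v 0 j * 'D_(e_ j) h u.
Proof.
move=> Uo Uu [hc hp].
pose L : {linear 'rV[R]_d -> R^o} := dotmap (\row_j 'D_(e_ j) h u).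
have LE v : L v = \sum_j v 0 j * 'D_(e_ j) h u.
  by apply: eq_bigr => j _; rewrite mxE.
suff E : (h : _ -> R^o) \o shift u = cst (h u) + L +o_ (0 : 'rV[R]_d) id.
  have dE := diff_unique (@continuous_dotmap _ _) E.
  split; last by move=> v; rewrite dE LE.
  apply/diff_locallyP; rewrite dE; split => //.
  exact: continuous_dotmap.
apply/eqaddoP => _/posnumP[eps]; rewrite /=.
(* With eps/(d+1) the d legs cost at most eps in total; d+1 instead of d covers d = 0. *)
have [eta eta0 etaE] : exists2 eta : R, 0 < eta & d%:R * eta <= eps%:num.
  exists (eps%:num / (d%:R + 1)) => //.
  rewrite mulrCA ler_piMr // ler_pdivrMr ?ltr_wpDl// mul1r.
  by rewrite lerDl.
have near_all : \forall z \near u,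
    U z /\ forall j, `|'D_(e_ j) h z - 'D_(e_ j) h u| <= eta.
  have Dn : \forall z \near u, forall j,
      `|'D_(e_ j) h z - 'D_(e_ j) h u| <= eta.
    apply: (@filter_forall _ _ (fun j z => is_true
      (`|'D_(e_ j) h z - 'D_(e_ j) h u| <= eta)) _ (nbhs_filter u)) => j.
    have [_ [/(_ u Uu) Dc _]] := hp j.
    have /cvgrPdist_le/(_ _ eta0) := Dc.
    by apply: filterS => z; rewrite distrC.
  have Un : \forall z \near u, U z by exact: open_nbhs_nbhs.
  exact: filterS2 Un Dn.
have [/= del del0 Hdel] := nbhs_norm_le_nbhs near_all.
near=> v.
have vdel : `|v| < del.
  near: v; apply: nbhs_le_nbhs_norm; exists del => //= z.
  by rewrite /ball_/= sub0r normrN.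
(* [p k] keeps the first k coordinates of v, so consecutive points differ along one axis. *)
pose p (k : nat) : 'rV[R]_d := \row_j (if (j < k)%N then v 0 j else 0).
have p0 : p 0%N = 0 by apply/rowP => j; rewrite !mxE.
have pd : p d = v by apply/rowP => j; rewrite !mxE ltn_ord.
have pS (k : 'I_d) : p k.+1 = p k + v 0 k *: e_ k.
  apply/rowP => j; rewrite !mxE eqxx/= ltnS leq_eqVlt -val_eqE/=.
  have [/val_inj->|jk] := eqVneq (j : nat) k.
    by rewrite ltnn add0r mulr1.
  by rewrite mulr0 addr0.
have step (k : 'I_d) : `|h (u + p k.+1) - h (u + p k) -
     v 0 k * 'D_(e_ k) h u| <= eta * `|v|.
  have inU s : `|s| <= `|v 0 k| -> ball_ Num.Def.normr u del (u + p k + s *: e_ k).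
    move=> sv; rewrite /ball_/= distrC addrAC [u + p k]addrC addrK.
    apply: le_lt_trans vdel; apply: norm_le_coord => // j.
    rewrite !mxE eqxx/=; have [->|jk] := eqVneq j k.
      by rewrite ltnn add0r mulr1 (le_trans sv)// norm_coord.
    by rewrite mulr0 addr0; case: ifP => _; rewrite ?normr0// norm_coord.
  have [s sv] := @MVT_line _ h (u + p k) (e_ k) (v 0 k)
     (fun s sv => (hp k).1 _ (Hdel _ (inU s sv)).1).
  rewrite pS addrA => ->; rewrite -mulrBr normrM mulrC.
  apply: ler_pM => //; last exact: norm_coord.
  exact: (Hdel _ (inU s sv)).2.
rewrite !fctE /= LE opprD addrA.
rewrite (_ : h (v + u) - h u = \sum_(k < d) (h (u + p k.+1) - h (u + p k))).
  rewrite -sumrB (le_trans (ler_norm_sum _ _ _))//.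
  apply: (@le_trans _ _ (\sum_(k < d) eta * `|v|)).
    by apply: ler_sum => k _; exact: step.
  rewrite sumr_const card_ord -mulrnAl; apply: ler_pM => //.
    by rewrite mulrn_wge0// ltW.
  by rewrite -mulr_natl.
rewrite -(big_mkord xpredT (fun k => h (u + p k.+1) - h (u + p k))).
by rewrite (telescope_sumr (fun k => h (u + p k)) (leq0n d)) pd p0 addr0 [v + u]addrC.
Unshelve. all: by end_near. Qed.

Lemma near_open d (U : set 'rV[R]_d) (u : 'rV[R]_d) (Q : 'rV[R]_d -> Prop) :
  open U -> U u -> (forall w, U w -> Q w) -> \forall w \near u, Q w.
Proof. by move=> Uo Uu UQ; apply: filterS UQ _; exact: open_nbhs_nbhs. Qed.

Lemma continuous_eq_on d (U : set 'rV[R]_d) (h h' : 'rV[R]_d -> R) u :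
  open U -> U u -> (forall w, U w -> h w = h' w) ->
  {for u, continuous h} -> {for u, continuous h'}.
Proof.
move=> Uo Uu hh' hc; rewrite /prop_for/continuous_at -(hh' u Uu).
have E : \forall w \near nbhs u, h w = h' w by exact: near_open Uo Uu hh'.
exact: cvg_trans (near_eq_cvg E) hc.
Qed.

Lemma Ck_on_continuous d k (U : set 'rV[R]_d) h : Ck_on k U h ->
  forall u, U u -> {for u, continuous h}.
Proof. by case: k => [|k] []. Qed.

Lemma Ck_on_pred d k (U : set 'rV[R]_d) h : Ck_on k.+1 U h -> Ck_on k U h.
Proof.
elim: k h => [|k IH] h [hc hp]; split => // j.
by have [hd /IH] := hp j.
Qed.

Lemma Ck_on_sub d k (U V : set 'rV[R]_d) h : V `<=` U ->
  Ck_on k U h -> Ck_on k V h.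
Proof.
move=> VU; elim: k h => [|k IH] h [hc hp]; split => //.
- by move=> u /VU; exact: hc.
- by move=> u /VU; exact: hc.
- by move=> j; have [hd /IH hk] := hp j; split => // u /VU; exact: hd.
Qed.

Lemma Ck_on_ext d k (U : set 'rV[R]_d) (h h' : 'rV[R]_d -> R) : open U ->
  (forall u, U u -> h u = h' u) -> Ck_on k U h -> Ck_on k U h'.
Proof.
move=> Uo; elim: k h h' => [|k IH] h h' hh' [hc hp].
  by split => // u Uu; apply: (continuous_eq_on Uo Uu hh' (hc u Uu)).
split=> [u Uu|j]; first exact: continuous_eq_on Uo Uu hh' (hc u Uu).
have [hd hk] := hp j; split=> [u Uu|].
  by exact: near_eq_derivable (near_open Uo Uu hh') (hd u Uu).
by apply: IH hk => u Uu; exact: near_eq_derive (near_open Uo Uu hh').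
Qed.

Lemma Ck_on_cst d k (U : set 'rV[R]_d) (c : R) : open U -> Ck_on k U (fun=> c).
Proof.
move=> Uo; elim: k c => [|k IH] c.
  by split => // u _; exact: cst_continuous.
split=> [u _|j]; first exact: cst_continuous.
split; first by move=> u _; exact: derivable_cst.
by apply: Ck_on_ext (IH 0) => // u _; rewrite derive_cst.
Qed.

Lemma Ck_onD d k (U : set 'rV[R]_d) (h h' : 'rV[R]_d -> R) : open U ->
  Ck_on k U h -> Ck_on k U h' -> Ck_on k U (fun u => h u + h' u).
Proof.
move=> Uo; elim: k h h' => [|k IH] h h' [hc hp] [hc' hp'].
  by split => // u Uu; exact: cvgD (hc u Uu) (hc' u Uu).
split=> [u Uu|j]; first by exact: cvgD (hc u Uu) (hc' u Uu).
have [hd hk] := hp j; have [hd' hk'] := hp' j.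
split=> [u Uu|]; first by exact: derivableD (hd u Uu) (hd' u Uu).
apply: Ck_on_ext (IH _ _ hk hk') => // u Uu.
by rewrite deriveD //; [exact: hd|exact: hd'].
Qed.

Lemma Ck_onM d k (U : set 'rV[R]_d) (h h' : 'rV[R]_d -> R) : open U ->
  Ck_on k U h -> Ck_on k U h' -> Ck_on k U (fun u => h u * h' u).
Proof.
move=> Uo; elim: k h h' => [|k IH] h h' hk hk'.
  by split => // u Uu; exact: cvgM (hk.1 u Uu) (hk'.1 u Uu).
have [hc hp] := hk; have [hc' hp'] := hk'.
split=> [u Uu|j]; first by exact: cvgM (hc u Uu) (hc' u Uu).
have [hd hdk] := hp j; have [hd' hdk'] := hp' j.
split=> [u Uu|]; first by exact: derivableM (hd u Uu) (hd' u Uu).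
have := Ck_onD Uo (IH _ _ (Ck_on_pred hk) hdk') (IH _ _ (Ck_on_pred hk') hdk).
apply: Ck_on_ext => // u Uu.
by rewrite deriveM //; [exact: hd|exact: hd'].
Qed.

Lemma Ck_on_proj d k (U : set 'rV[R]_d) (c : 'rV[R]_d) : open U ->
  Ck_on k U (dotmap c).
Proof.
move=> Uo; have dE u : differentiable (dotmap c) u.
  exact/linear_differentiable/continuous_dotmap.
have dC : forall u, U u -> {for u, continuous (dotmap c)}.
  by move=> u _; exact: continuous_dotmap.
case: k => [|k]; first by split; [exact: dC|].
split; first exact: dC.
move=> j; split=> [u _|]; first exact: diff_derivable.
apply: (@Ck_on_ext _ _ _ (fun=> dotmap c (e_ j))) => //; last exact: Ck_on_cst.
by move=> u _; rewrite deriveE// diff_lin//; exact: continuous_dotmap.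
Qed.

Section Composition_scalar.
Context (phi : nat -> R -> R) (D : set R).
Hypothesis phiD : forall n x, D x -> is_derive x 1 (phi n) (phi n.+1 x).

(** A derivative of [phi n] after h is [phi n.+1] after h times a derivative of h; hence the
    induction on k is made for all n at once. *)
Lemma Ck_on_phi d k n (U : set 'rV[R]_d) (h : 'rV[R]_d -> R) : open U ->
  Cinfty_on U h -> (forall u, U u -> D (h u)) -> Ck_on k U (fun u => phi n (h u)).
Proof.
move=> Uo hC hD.
have phid m u : U u -> differentiable (phi m) (h u).
  by move=> Uu; apply/derivable1_diffP; have [] := phiD m (hD u Uu).
have hd u : U u -> differentiable h u.
  by move=> Uu; have [] := C1_differentiable Uo Uu (hC 1%N).
have phih m u : U u -> {for u, continuous (fun u => phi m (h u))}.
  move=> Uu; apply: continuous_comp; apply: differentiable_continuous.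
    exact: hd.
  exact: phid.
elim: k n => [|k IH] n; first by split => // u Uu; exact: phih.
split=> [u Uu|j]; first exact: phih.
have pd u : U u -> differentiable (phi n \o h) u.
  by move=> Uu; apply: differentiable_comp; [exact: hd|exact: phid].
split=> [u Uu|]; first exact: diff_derivable (pd u Uu).
have [_ /(_ j)[hjd hjk]] := hC k.+1.
have := Ck_onM Uo (IH n.+1) hjk.
apply: Ck_on_ext => // u Uu.
rewrite [RHS](deriveE _ (pd u Uu)) (diff_comp (hd u Uu) (phid n u Uu)) /=.
rewrite -(deriveE _ (hd u Uu)).
have [dphi Dphi] := phiD n (hD u Uu).
by rewrite deriv1E// derive1E Dphi mulrC.
Qed.

End Composition_scalar.

Lemma derive_comp d d' (U : set 'rV[R]_d) (U' : set 'rV[R]_d') h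
    (T : 'rV[R]_d' -> 'rV[R]_d) : open U -> open U' ->
  Ck_on 1 U h -> (forall j, Ck_on 1 U' (fun u => T u 0 j)) ->
  (forall u, U' u -> U (T u)) ->
  forall u, U' u -> differentiable (h \o T) u /\ forall v, 'D_v (h \o T) u =
    \sum_i 'D_v (fun w => T w 0 i) u * 'D_(e_ i) h (T u).
Proof.
move=> Uo Uo' hC TC TU u Uu.
have Td : differentiable T u.
  have E : T = \sum_i (fun w => T w 0 i *: e_ i).
    apply/funext => w; rewrite [LHS]row_sum_delta.
    by rewrite fct_sumE.
  rewrite E; apply: differentiable_sum => i; apply: differentiableZl.
  by have [] := C1_differentiable Uo' Uu (TC i).
have [hd dhE] := C1_differentiable Uo (TU u Uu) hC.
have cd : differentiable (h \o T) u by exact: differentiable_comp.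
split => // v; rewrite deriveE// diff_comp//= dhE; apply: eq_bigr => i _.
congr (_ * _); rewrite -deriveE// derive_mx; last exact: diff_derivable.
by rewrite mxE.
Qed.

(** By the chain rule a partial derivative of the composite is a sum of products of derivatives of T
    with composites of the same kind, of order one less; the induction therefore generalises h. *)
Lemma Cinfty_on_comp d d' (U : set 'rV[R]_d) (U' : set 'rV[R]_d') h
    (T : 'rV[R]_d' -> 'rV[R]_d) : open U -> open U' ->
  Cinfty_on U h -> (forall j, Cinfty_on U' (fun u => T u 0 j)) ->
  (forall u, U' u -> U (T u)) -> Cinfty_on U' (h \o T).
Proof.
move=> Uo Uo' hC TC TU k; elim: k h hC => [|k IH] h hC.
  split => // u Uu; apply: differentiable_continuous.
  by have [] := derive_comp Uo Uo' (hC 1%N) (fun j => TC j 1%N) TU Uu.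
have dc := derive_comp Uo Uo' (hC 1%N) (fun j => TC j 1%N) TU.
split=> [u Uu|j].
  by apply: differentiable_continuous; have [] := dc _ Uu.
split=> [u Uu|]; first by apply: diff_derivable; have [] := dc _ Uu.
apply: (@Ck_on_ext _ _ _ (fun u => \sum_i 'D_(e_ j) (fun w => T w 0 i) u *
   'D_(e_ i) h (T u))) => //.
  by move=> u Uu; have [_ ->] := dc _ Uu.
elim: (index_enum _) => [|i s IHs].
  apply: (@Ck_on_ext _ _ _ (fun=> 0)) => //; last exact: Ck_on_cst.
  by move=> u _; rewrite big_nil.
apply: (@Ck_on_ext _ _ _ (fun u => 'D_(e_ j) (fun w => T w 0 i) u *
   'D_(e_ i) h (T u) + \sum_(i <- s) 'D_(e_ j) (fun w => T w 0 i) u *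
   'D_(e_ i) h (T u))) => //.
  by move=> u _; rewrite big_cons.
apply: Ck_onD => //; apply: Ck_onM => //.
  by have [_ /(_ j)[]] := TC i k.+1.
by apply: (IH (fun w => 'D_(e_ i) h w)) => l; have [_ /(_ i)[]] := hC l.+1.
Qed.

Lemma dist_halves (p q t e : R) : `|p - t| <= e / 2 -> `|q - t| <= e / 2 ->
  `|p - q| <= e.
Proof.
move=> pt qt; rewrite -(subrKA t) (le_trans (ler_normD _ _))//.
by rewrite [leRHS]splitr lerD// distrC.
Qed.

Lemma is_derive_translate d (h : 'rV[R]_d -> R) (w c v : 'rV[R]_d) :
  derivable h (w + c) v ->
  is_derive w v (fun u => h (u + c)) ('D_v h (w + c)).
Proof.
move=> hd.
suff E : (fun t : R => t^-1 *: (((fun u => h (u + c)) \o shift w) (t *: v) -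
    h (w + c))) = (fun t => t^-1 *: ((h \o shift (w + c)) (t *: v) - h (w + c))).
  by split; [rewrite /derivable E|rewrite /derive E].
by apply/funext => t /=; rewrite addrA.
Qed.

(** The second difference of h over a square of side s at u is s^2 times either mixed derivative,
    each taken at some point near u. By continuity the two values at u differ by at most eps. *)
Lemma derive_commute d (U : set 'rV[R]_d) (h : 'rV[R]_d -> R) (i j : 'I_d) :
  open U -> Ck_on 2 U h -> forall u, U u ->
  'D_(e_ i) (fun w => 'D_(e_ j) h w) u = 'D_(e_ j) (fun w => 'D_(e_ i) h w) u.
Proof.
move=> Uo hC u Uu.
pose H a b w := 'D_(e_ a) (fun w => 'D_(e_ b) h w) w : R.
have Hc a b : {for u, continuous (H a b)}.
  by have [_ /(_ b)[_ [_ /(_ a)[_ [/(_ u Uu)]]]]] := hC.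
have h1 a w : U w -> derivable h w (e_ a) by have [_ /(_ a)[+ _]] := hC; apply.
have h2 a b w : U w -> derivable (fun w => 'D_(e_ b) h w) w (e_ a).
  by have [_ /(_ b)[_ [_ /(_ a)[+ _]]]] := hC; apply.
apply/eqP; rewrite -subr_eq0 -normr_le0; apply/ler_addgt0Pr => eps eps0.
rewrite add0r.
have near_all : \forall w \near u, U w /\
   forall a b, `|H a b u - H a b w| <= eps / 2.
  have Un : \forall w \near u, U w by exact: open_nbhs_nbhs.
  apply: filterS2 Un _; first by move=> w Uw HH; split; [exact: Uw|exact: HH].
  apply: (@filter_forall _ _ (fun a w => forall b, is_true
    (`|H a b u - H a b w| <= eps / 2)) _ (nbhs_filter u)) => a.
  apply: (@filter_forall _ _ (fun b w => is_true
    (`|H a b u - H a b w| <= eps / 2)) _ (nbhs_filter u)) => b.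
  have /cvgrPdist_le := Hc a b; apply.
  by rewrite divr_gt0.
have [/= r r0 Hr] := nbhs_norm_le_nbhs near_all.
(* Steps of length at most r/4 in two directions stay inside the ball of radius r. *)
pose s := r / 4.
have s0 : 0 < s by rewrite divr_gt0.
have en a : `|e_ a : 'rV[R]_d| <= 1.
  apply: norm_le_coord => // b; rewrite mxE eqxx/=.
  by case: (b == a); rewrite ?normr1 ?normr0.
have inr (a b : 'I_d) (p q : R) : `|p| <= s -> `|q| <= s ->
    ball_ Num.Def.normr u r (u + p *: e_ a + q *: e_ b).
  move=> ps qs; rewrite /ball_/= distrC addrAC [u + _]addrC addrK.
  rewrite (le_lt_trans (ler_normD _ _))// !normrZ.
  have := ler_pM (normr_ge0 p) (normr_ge0 _) ps (en a).
  have := ler_pM (normr_ge0 q) (normr_ge0 _) qs (en b).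
  by rewrite /s; move: r0 {near_all Hr} => /=; lra.
have key a b : exists2 w, ball_ Num.Def.normr u r w &
   h (u + s *: e_ a + s *: e_ b) - h (u + s *: e_ a) - h (u + s *: e_ b) + h u
     = s * (s * H b a w).
  (* The mean value theorem is used twice: on the difference g along [e_ a], then on the
     [e_ a]-derivative of h along [e_ b]. *)
  pose g w := h (w + s *: e_ b) - h w.
  have ss : `|s| <= s by rewrite gtr0_norm.
  have s00 : `|0 : R| <= s by rewrite normr0 ltW.
  have gd t : `|t| <= `|s| -> is_derive (u + t *: e_ a) (e_ a) g
     ('D_(e_ a) h (u + t *: e_ a + s *: e_ b) - 'D_(e_ a) h (u + t *: e_ a)).
    rewrite (gtr0_norm s0) => ts.
    have Ut : U (u + t *: e_ a).
      by have := (Hr _ (inr a b t 0 ts s00)).1; rewrite scale0r addr0.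
    have Uts := (Hr _ (inr a b t s ts ss)).1.
    apply: is_deriveB; last exact/derivableP/h1.
    exact/is_derive_translate/h1.
  have gdd t : `|t| <= `|s| -> derivable g (u + t *: e_ a) (e_ a).
    by move=> ts; have [] := gd t ts.
  have [t ts] := MVT_line gdd.
  have [_ ->] := gd t ts.
  rewrite (gtr0_norm s0) in ts.
  have h2d q : `|q| <= `|s| ->
      derivable (fun w => 'D_(e_ a) h w) (u + t *: e_ a + q *: e_ b) (e_ b).
    rewrite (gtr0_norm s0) => qs.
    exact: h2 (Hr _ (inr a b t q ts qs)).1.
  have [q qs ->] := MVT_line h2d.
  rewrite (gtr0_norm s0) in qs.
  move=> E; exists (u + t *: e_ a + q *: e_ b); first exact: inr.
  by rewrite /H -E /g opprB addrA addrAC.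
have [w1 w1r E1] := key j i; have [w2 w2r E2] := key i j.
have EH : H i j w1 = H j i w2.
  apply/(mulfI (lt0r_neq0 s0))/(mulfI (lt0r_neq0 s0)).
  transitivity (h (u + s *: e_ j + s *: e_ i) - h (u + s *: e_ j) -
    h (u + s *: e_ i) + h u); first exact: esym E1.
  transitivity (h (u + s *: e_ i + s *: e_ j) - h (u + s *: e_ i) -
    h (u + s *: e_ j) + h u); last exact: E2.
  have -> : u + s *: e_ j + s *: e_ i = u + s *: e_ i + s *: e_ j.
    exact: addrAC.
  by congr (_ + _); exact: addrAC.
apply: (@dist_halves _ _ (H j i w2) _); last exact: (Hr _ w2r).2.
by rewrite -EH; exact: (Hr _ w1r).2.
Qed.

(** * Complex-valued smooth functions of several real variables *)

Local Notation C := R[i].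
Local Notation Re := complex.Re.
Local Notation Im := complex.Im.

Lemma dotmap_delta d (j : 'I_d) (u : 'rV[R]_d) : dotmap (e_ j) u = u 0 j.
Proof.
rewrite /dotmap (bigD1 j)//= mxE !eqxx mulr1 big1 ?addr0// => i ij.
by rewrite mxE eqxx/= (negPf ij) mulr0.
Qed.

Lemma Cinfty_on_coord d (U : set 'rV[R]_d) (j : 'I_d) : open U ->
  Cinfty_on U (fun p => p 0 j).
Proof.
move=> Uo k; have -> : (fun p : 'rV[R]_d => p 0 j) = dotmap (e_ j : 'rV[R]_d).
  by apply/funext => p; rewrite dotmap_delta.
exact: Ck_on_proj.
Qed.

Definition CCinfty_on d (U : set 'rV[R]_d) (h : 'rV[R]_d -> C) : Prop :=
  Cinfty_on U (fun w => Re (h w)) /\ Cinfty_on U (fun w => Im (h w)).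

Lemma Cinfty_nearP d (h : 'rV[R]_d -> C) u :
  Cinfty_near h u <-> exists U, [/\ open U, U u & CCinfty_on U h].
Proof.
split=> [[U [Uo Uu hr hi]]|[U [Uo Uu [hr hi]]]]; exists U; split => //.
Qed.

Lemma NumconjE (z : C) : Num.conj z = conjc z. Proof. by []. Qed.
Lemma conjcD (x y : C) : conjc (x + y) = conjc x + conjc y.
Proof. exact: rmorphD. Qed.
Lemma conjcN (x : C) : conjc (- x) = - conjc x. Proof. exact: rmorphN. Qed.
Lemma conjcB (x y : C) : conjc (x - y) = conjc x - conjc y.
Proof. exact: rmorphB. Qed.
Lemma conjcM (x y : C) : conjc (x * y) = conjc x * conjc y.
Proof. exact: rmorphM. Qed.
Lemma conjc_sum (I : Type) (r : seq I) (P : pred I) (F : I -> C) :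
  conjc (\sum_(i <- r | P i) F i) = \sum_(i <- r | P i) conjc (F i).
Proof. exact: rmorph_sum. Qed.
Lemma ReD (x y : C) : Re (x + y) = Re x + Re y. Proof. by case: x y => ? ? []. Qed.
Lemma ImD (x y : C) : Im (x + y) = Im x + Im y. Proof. by case: x y => ? ? []. Qed.
Lemma ReM (x y : C) : Re (x * y) = Re x * Re y - Im x * Im y.
Proof. by case: x y => ? ? []. Qed.
Lemma ImM (x y : C) : Im (x * y) = Re x * Im y + Im x * Re y.
Proof. by case: x y => ? ? []. Qed.
Lemma Reconj (x : C) : Re x^* = Re x. Proof. by case: x. Qed.
Lemma Imconj (x : C) : Im x^* = - Im x. Proof. by case: x. Qed.
Lemma Re_sum (I : Type) (r : seq I) (P : pred I) (F : I -> C) :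
  Re (\sum_(i <- r | P i) F i) = \sum_(i <- r | P i) Re (F i).
Proof.
elim: r => [|i r IH]; first by rewrite !big_nil.
by rewrite !big_cons; case: (P i) => //; rewrite ReD IH.
Qed.
Lemma Im_sum (I : Type) (r : seq I) (P : pred I) (F : I -> C) :
  Im (\sum_(i <- r | P i) F i) = \sum_(i <- r | P i) Im (F i).
Proof.
elim: r => [|i r IH]; first by rewrite !big_nil.
by rewrite !big_cons; case: (P i) => //; rewrite ImD IH.
Qed.
Lemma complex_eqP (x y : C) : Re x = Re y -> Im x = Im y -> x = y.
Proof. by case: x y => ? ? [? ?] /= -> ->. Qed.

Lemma CCinfty_on_sub d (U V : set 'rV[R]_d) h : V `<=` U ->
  CCinfty_on U h -> CCinfty_on V h.
Proof. by move=> VU [hr hi]; split => k; exact: Ck_on_sub VU _. Qed.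

Lemma CCinfty_on_ext d (U : set 'rV[R]_d) (h h' : 'rV[R]_d -> C) : open U ->
  (forall u, U u -> h u = h' u) -> CCinfty_on U h -> CCinfty_on U h'.
Proof.
move=> Uo E [hr hi]; split => k.
  by apply: Ck_on_ext (hr k) => // u Uu; rewrite E.
by apply: Ck_on_ext (hi k) => // u Uu; rewrite E.
Qed.

Lemma CCinfty_on_cst d (U : set 'rV[R]_d) (c : C) : open U ->
  CCinfty_on U (fun=> c).
Proof. by move=> Uo; split => k; exact: Ck_on_cst. Qed.

Lemma CCinfty_onD d (U : set 'rV[R]_d) (h h' : 'rV[R]_d -> C) : open U ->
  CCinfty_on U h -> CCinfty_on U h' -> CCinfty_on U (fun u => h u + h' u).
Proof.
move=> Uo [hr hi] [hr' hi']; split => k.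
  by apply: Ck_on_ext (Ck_onD Uo (hr k) (hr' k)) => // u Uu; rewrite ReD.
by apply: Ck_on_ext (Ck_onD Uo (hi k) (hi' k)) => // u Uu; rewrite ImD.
Qed.

Lemma CCinfty_onM d (U : set 'rV[R]_d) (h h' : 'rV[R]_d -> C) : open U ->
  CCinfty_on U h -> CCinfty_on U h' -> CCinfty_on U (fun u => h u * h' u).
Proof.
move=> Uo [hr hi] [hr' hi']; split => k.
  have m1 : Ck_on k U (fun u => -1 * (Im (h u) * Im (h' u))).
    by apply: Ck_onM => //; [exact: Ck_on_cst|exact: Ck_onM].
  apply: Ck_on_ext (Ck_onD Uo (Ck_onM Uo (hr k) (hr' k)) m1) => // u Uu.
  by rewrite ReM mulN1r.
apply: Ck_on_ext (Ck_onD Uo (Ck_onM Uo (hr k) (hi' k))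
  (Ck_onM Uo (hi k) (hr' k))) => // u Uu.
by rewrite ImM.
Qed.

Lemma CCinfty_on_conj d (U : set 'rV[R]_d) (h : 'rV[R]_d -> C) : open U ->
  CCinfty_on U h -> CCinfty_on U (fun u => (h u)^*).
Proof.
move=> Uo [hr hi]; split => k.
  by apply: Ck_on_ext (hr k) => // u Uu; rewrite Reconj.
have := Ck_onM Uo (Ck_on_cst k (-1) Uo) (hi k).
by apply: Ck_on_ext => // u Uu; rewrite Imconj mulN1r.
Qed.

Lemma CCinfty_on_partial d (U : set 'rV[R]_d) (h : 'rV[R]_d -> C) j : open U ->
  CCinfty_on U h -> CCinfty_on U (cpartial h j).
Proof.
move=> Uo [hr hi]; split => k.
  by have [_ /(_ j)[]] := hr k.+1.
by have [_ /(_ j)[]] := hi k.+1.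
Qed.

Lemma CCinfty_on_comp d d' (U : set 'rV[R]_d) (U' : set 'rV[R]_d') h
    (T : 'rV[R]_d' -> 'rV[R]_d) : open U -> open U' ->
  CCinfty_on U h -> (forall j, Cinfty_on U' (fun u => T u 0 j)) ->
  (forall u, U' u -> U (T u)) -> CCinfty_on U' (h \o T).
Proof.
move=> Uo Uo' [hr hi] TC TU; split.
  exact: (Cinfty_on_comp Uo Uo' hr).
exact: (Cinfty_on_comp Uo Uo' hi).
Qed.

Lemma open_preimage_on d d' (U : set 'rV[R]_d) (U' : set 'rV[R]_d')
    (T : 'rV[R]_d' -> 'rV[R]_d) : open U -> open U' ->
  (forall u, U' u -> {for u, continuous T}) -> open (U' `&` T @^-1` U).
Proof.
move=> Uo Uo' Tc; rewrite openE => u [U'u UTu]; apply: filterI.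
  exact: open_nbhs_nbhs.
by apply: (Tc u U'u); exact: open_nbhs_nbhs.
Qed.

Lemma coords_differentiable d d' (U' : set 'rV[R]_d')
    (T : 'rV[R]_d' -> 'rV[R]_d) : open U' ->
  (forall j, Ck_on 1 U' (fun u => T u 0 j)) ->
  forall u, U' u -> differentiable T u.
Proof.
move=> Uo TC u Uu.
have -> : T = \sum_i (fun w => T w 0 i *: e_ i).
  by apply/funext => w; rewrite [LHS]row_sum_delta fct_sumE.
apply: differentiable_sum => i; apply: differentiableZl.
by have [] := C1_differentiable Uo Uu (TC i).
Qed.

Lemma Cnear_ext d (h h' : 'rV[R]_d -> C) u :
  (\forall w \near u, h w = h' w) -> Cinfty_near h u -> Cinfty_near h' u.
Proof.
move=> E /Cinfty_nearP[U [Uo Uu hC]]; apply/Cinfty_nearP.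
exists (U `&` interior [set w | h w = h' w]).
have Oo : open (U `&` interior [set w | h w = h' w]).
  by apply: openI => //; exact: open_interior.
split => //.
apply: (@CCinfty_on_ext _ _ h) => //; first by move=> w [_ /interior_subset].
by apply: CCinfty_on_sub hC => w [].
Qed.

Lemma Cnear_near d (h : 'rV[R]_d -> C) u :
  Cinfty_near h u -> \forall w \near u, Cinfty_near h w.
Proof.
move=> /Cinfty_nearP[U [Uo Uu hC]].
have hU w : U w -> Cinfty_near h w by move=> Uw; apply/Cinfty_nearP; exists U.
exact: near_open Uo Uu hU.
Qed.

Lemma Cnear_cst d (c : C) (u : 'rV[R]_d) : Cinfty_near (fun=> c) u.
Proof.
apply/Cinfty_nearP; exists setT; split => //; first exact: openT.
by apply: CCinfty_on_cst; exact: openT.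
Qed.

Lemma Cnear_op2 (op : C -> C -> C) d (h h' : 'rV[R]_d -> C) u :
  (forall (U : set 'rV[R]_d) h h', open U -> CCinfty_on U h ->
    CCinfty_on U h' -> CCinfty_on U (fun w => op (h w) (h' w))) ->
  Cinfty_near h u -> Cinfty_near h' u ->
  Cinfty_near (fun w => op (h w) (h' w)) u.
Proof.
move=> opC /Cinfty_nearP[U [Uo Uu hC]] /Cinfty_nearP[V [Vo Vu hC']].
apply/Cinfty_nearP; exists (U `&` V); split => //; first exact: openI.
apply: opC; first exact: openI.
  by apply: CCinfty_on_sub hC => ? [].
by apply: CCinfty_on_sub hC' => ? [].
Qed.

Lemma CnearD d (h h' : 'rV[R]_d -> C) u :
  Cinfty_near h u -> Cinfty_near h' u -> Cinfty_near (fun w => h w + h' w) u.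
Proof. by apply: Cnear_op2 => U *; exact: CCinfty_onD. Qed.

Lemma CnearM d (h h' : 'rV[R]_d -> C) u :
  Cinfty_near h u -> Cinfty_near h' u -> Cinfty_near (fun w => h w * h' w) u.
Proof. by apply: Cnear_op2 => U *; exact: CCinfty_onM. Qed.

Lemma Cnear_conj d (h : 'rV[R]_d -> C) u :
  Cinfty_near h u -> Cinfty_near (fun w => (h w)^*) u.
Proof.
move=> /Cinfty_nearP[U [Uo Uu hC]]; apply/Cinfty_nearP; exists U; split => //.
exact: CCinfty_on_conj.
Qed.

Lemma Cnear_partial d (h : 'rV[R]_d -> C) j u :
  Cinfty_near h u -> Cinfty_near (cpartial h j) u.
Proof.
move=> /Cinfty_nearP[U [Uo Uu hC]]; apply/Cinfty_nearP; exists U; split => //.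
exact: CCinfty_on_partial.
Qed.

Lemma Cnear_comp d d' (U' : set 'rV[R]_d') h
    (T : 'rV[R]_d' -> 'rV[R]_d) u : open U' -> U' u ->
  (forall j, Cinfty_on U' (fun u => T u 0 j)) ->
  Cinfty_near h (T u) -> Cinfty_near (h \o T) u.
Proof.
move=> Uo' U'u TC /Cinfty_nearP[U [Uo Uu hC]]; apply/Cinfty_nearP.
have Tc w : U' w -> {for w, continuous T}.
  move=> U'w; apply: differentiable_continuous.
  exact: coords_differentiable Uo' (fun j => TC j 1%N) w U'w.
have Oo := open_preimage_on Uo Uo' Tc.
exists (U' `&` T @^-1` U); split => //.
apply: (CCinfty_on_comp Uo Oo hC); last by move=> w [].
by move=> j k; apply: Ck_on_sub (TC j k) => w [].
Qed.

Lemma Cnear_derivable d (h : 'rV[R]_d -> C) u : Cinfty_near h u ->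
  forall v, derivable (fun w => Re (h w)) u v /\
            derivable (fun w => Im (h w)) u v.
Proof.
move=> [U [Uo Uu hr hi]] v.
have [dr _] := C1_differentiable Uo Uu (hr 1%N).
have [di _] := C1_differentiable Uo Uu (hi 1%N).
by split; exact: diff_derivable.
Qed.

Lemma cpartial_ext d (h h' : 'rV[R]_d -> C) j u :
  (\forall w \near u, h w = h' w) -> cpartial h j u = cpartial h' j u.
Proof.
move=> E; rewrite /cpartial; congr (_ +i* _); apply: near_eq_derive.
  by apply: filterS E => w ->.
by apply: filterS E => w ->.
Qed.

Lemma cpartial_cst d (c : C) j (u : 'rV[R]_d) : cpartial (fun=> c) j u = 0.
Proof. by rewrite /cpartial !derive_cst. Qed.

Lemma cpartialD d (h h' : 'rV[R]_d -> C) j u :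
  Cinfty_near h u -> Cinfty_near h' u ->
  cpartial (fun w => h w + h' w) j u = cpartial h j u + cpartial h' j u.
Proof.
move=> /Cnear_derivable hd /Cnear_derivable hd'.
have [dr di] := hd (e_ j); have [dr' di'] := hd' (e_ j).
rewrite /cpartial; apply: complex_eqP => /=.
  rewrite (_ : (fun w => Re (h w + h' w)) =
     (fun w => Re (h w)) + (fun w => Re (h' w))).
    by rewrite (deriveD dr dr').
  by apply/funext => w; rewrite ReD.
rewrite (_ : (fun w => Im (h w + h' w)) =
   (fun w => Im (h w)) + (fun w => Im (h' w))).
  by rewrite (deriveD di di').
by apply/funext => w; rewrite ImD.
Qed.

Lemma cpartialM d (h h' : 'rV[R]_d -> C) j u :
  Cinfty_near h u -> Cinfty_near h' u ->
  cpartial (fun w => h w * h' w) j u =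
    cpartial h j u * h' u + h u * cpartial h' j u.
Proof.
move=> /Cnear_derivable hd /Cnear_derivable hd'.
have [dr di] := hd (e_ j); have [dr' di'] := hd' (e_ j).
rewrite /cpartial; apply: complex_eqP => /=.
  rewrite (_ : (fun w => Re (h w * h' w)) =
     (fun w => Re (h w)) * (fun w => Re (h' w)) -
     (fun w => Im (h w)) * (fun w => Im (h' w))); last first.
    by apply/funext => w; rewrite ReM.
  rewrite (deriveB (derivableM dr dr') (derivableM di di')).
  rewrite (deriveM dr dr') (deriveM di di').
  rewrite ReD !ReM /GRing.scale/=.
  by ring.
rewrite (_ : (fun w => Im (h w * h' w)) =
     (fun w => Re (h w)) * (fun w => Im (h' w)) +
     (fun w => Im (h w)) * (fun w => Re (h' w))); last first.
  by apply/funext => w; rewrite ImM.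
rewrite (deriveD (derivableM dr di') (derivableM di dr')).
rewrite (deriveM dr di') (deriveM di dr').
rewrite ImD !ImM /GRing.scale/=.
by ring.
Qed.

Lemma cpartial_conj d (h : 'rV[R]_d -> C) j u :
  Cinfty_near h u -> cpartial (fun w => (h w)^*) j u = (cpartial h j u)^*.
Proof.
move=> /Cnear_derivable /(_ (e_ j))[dr di].
rewrite /cpartial; apply: complex_eqP => /=.
  rewrite (_ : (fun w => Re (h w)^*) = (fun w => Re (h w))) //.
  by apply/funext => w; rewrite Reconj.
rewrite (_ : (fun w => Im (h w)^*) = - (fun w => Im (h w))).
  by rewrite (deriveN di).
by apply/funext => w; rewrite Imconj.
Qed.

Lemma cpartial_comp d d' (U' : set 'rV[R]_d') h
    (T : 'rV[R]_d' -> 'rV[R]_d) u j : open U' -> U' u ->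
  (forall j, Cinfty_on U' (fun u => T u 0 j)) -> Cinfty_near h (T u) ->
  cpartial (h \o T) j u =
    \sum_i ('D_(e_ j) (fun w => T w 0 i) u)%:C * cpartial h i (T u).
Proof.
move=> Uo' U'u TC /Cinfty_nearP[U [Uo Uu [hr hi]]].
have Tc w : U' w -> {for w, continuous T}.
  move=> U'w; apply: differentiable_continuous.
  exact: coords_differentiable Uo' (fun j => TC j 1%N) w U'w.
have Oo := open_preimage_on Uo Uo' Tc.
have TC' i : Ck_on 1 (U' `&` T @^-1` U) (fun u => T u 0 i).
  by apply: Ck_on_sub (TC i 1%N) => w [].
have OU w : (U' `&` T @^-1` U) w -> U (T w) by case.
have [_ Er] := derive_comp Uo Oo (hr 1%N) TC' OU (conj U'u Uu).
have [_ Ei] := derive_comp Uo Oo (hi 1%N) TC' OU (conj U'u Uu).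
apply: complex_eqP.
  rewrite [LHS]Er Re_sum.
  by apply: eq_bigr => i _; rewrite ReM/= mul0r subr0.
rewrite [LHS]Ei Im_sum.
by apply: eq_bigr => i _; rewrite ImM/= mul0r addr0.
Qed.

Lemma cpartial_commute d (h : 'rV[R]_d -> C) i j u : Cinfty_near h u ->
  cpartial (cpartial h j) i u = cpartial (cpartial h i) j u.
Proof.
move=> [U [Uo Uu hr hi]]; apply: complex_eqP => /=.
  exact: derive_commute Uo (hr 2%N) u Uu.
exact: derive_commute Uo (hi 2%N) u Uu.
Qed.

Lemma Cnear_continuous d (h : 'rV[R]_d -> C) u : Cinfty_near h u ->
  {for u, continuous (fun w => Re (h w))} /\
  {for u, continuous (fun w => Im (h w))}.
Proof. by move=> [U [Uo Uu hr hi]]; split; apply: (Ck_on_continuous (k := 0)). Qed.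

Lemma Cnear_neq0 d (h : 'rV[R]_d -> C) u : Cinfty_near h u -> h u != 0 ->
  \forall w \near u, h w != 0.
Proof.
move=> /Cnear_continuous[hr hi] hu0.
have [r0|r0] := eqVneq (Re (h u)) 0.
  have i0 : Im (h u) != 0.
    by apply: contraNneq hu0 => i0; apply/eqP/complex_eqP.
  have H := @cvgr_neq0 _ _ _ _ (nbhs_filter u) _ _ hi i0.
  by apply: filterS H => w; apply: contraNneq => ->.
have H := @cvgr_neq0 _ _ _ _ (nbhs_filter u) _ _ hr r0.
by apply: filterS H => w; apply: contraNneq => ->.
Qed.

Section Composition_scalar.
Context (phi : nat -> R -> R) (D : set R).
Hypothesis phiD : forall n x, D x -> is_derive x 1 (phi n) (phi n.+1 x).

Lemma Cnear_phi d n (h : 'rV[R]_d -> R) u :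
  Cinfty_near (fun w => (h w)%:C) u -> (\forall w \near u, D (h w)) ->
  Cinfty_near (fun w => (phi n (h w))%:C) u.
Proof.
move=> [U [Uo Uu hr _]] hD.
exists (U `&` interior [set w | D (h w)]).
have Oo : open (U `&` interior [set w | D (h w)]).
  by apply: openI => //; exact: open_interior.
split => //; last by move=> k; exact: Ck_on_cst.
move=> k; apply: (Ck_on_phi phiD) => //; last by move=> w [_ /interior_subset].
by move=> l; apply: Ck_on_sub (hr l) => w [].
Qed.

End Composition_scalar.

Lemma Cnear_expR d (h : 'rV[R]_d -> R) u :
  Cinfty_near (fun w => (h w)%:C) u -> Cinfty_near (fun w => (expR (h w))%:C) u.
Proof.
move=> hC; apply: (@Cnear_phi (fun=> expR) setT _ _ 0) => //.
by apply: filterS filterT.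
Qed.

Lemma Cnear_powR (a : R) d (h : 'rV[R]_d -> R) u :
  Cinfty_near (fun w => (h w)%:C) u -> 0 < h u ->
  Cinfty_near (fun w => (h w `^ a)%:C) u.
Proof.
move=> hC h0.
(* [c n] is the falling factorial a (a - 1) ... (a - n + 1), so [phi n] is the n-th derivative of
   x^a on x > 0. *)
pose c n := \prod_(i < n) (a - i%:R).
pose phi n x : R := c n * x `^ (a - n%:R).
have -> : (fun w => (h w `^ a)%:C) = (fun w => (phi 0%N (h w))%:C).
  by apply/funext => w; rewrite /phi /c big_ord0 mul1r subr0.
apply: (@Cnear_phi phi [set x | 0 < x]) => //.
  move=> n x /= x0; rewrite /phi.
  have := @is_deriveZ _ _ _ _ (c n) x 1 _ (is_derive1_powR (a - n%:R) x0).
  rewrite /GRing.scale/= mulrA -{1}[c n * _]/(c n * _).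
  rewrite {2}/c -(big_ord_recr _ (fun i : 'I_n.+1 => a - i%:R)).
  by rewrite -natr1 opprD addrA.
have [hr _] := Cnear_continuous hC.
exact: (@cvgr_gt _ _ _ (nbhs_filter u) _ _ hr _ h0).
Qed.

(** 1/h = conj(h) |h|^-2, and |h|^-2 is a real power of a positive smooth function. *)
Lemma CnearV d (h : 'rV[R]_d -> C) u :
  Cinfty_near h u -> h u != 0 -> Cinfty_near (fun w => (h w)^-1) u.
Proof.
move=> hC hu0; pose q w := Re (h w) ^+ 2 + Im (h w) ^+ 2.
have qE w : (q w)%:C = h w * conjc (h w).
  by apply: complex_eqP; rewrite ?ReM ?ImM Reconj Imconj /q/=; ring.
have q0 w : h w != 0 -> 0 < q w.
  move=> hw; rewrite lt_def addr_ge0 ?sqr_ge0// andbT.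
  apply: contra_neq hw => qw0.
  by move/eqP: qw0; rewrite paddr_eq0 ?sqr_ge0// !sqrf_eq0 => /andP[/eqP a /eqP b];
     apply: complex_eqP.
have qC : Cinfty_near (fun w => (q w)%:C) u.
  have -> : (fun w => (q w)%:C) = (fun w => h w * conjc (h w)) by apply/funext.
  by apply: CnearM => //; exact: Cnear_conj.
have := CnearM (Cnear_conj hC) (Cnear_powR (-1) qC (q0 _ hu0)).
apply: Cnear_ext; apply: filterS (Cnear_neq0 hC hu0) => w hw.
rewrite powR_inv1 ?ltW ?q0// fmorphV/= qE invfM mulrCA divff ?mulr1//.
by rewrite conjc_eq0.
Qed.

Lemma cpartial_expR d (h : 'rV[R]_d -> R) (j : 'I_d) u :
  Cinfty_near (fun w => (h w)%:C) u ->
  cpartial (fun w => (expR (h w))%:C) j u =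
  (expR (h u))%:C * cpartial (fun w => (h w)%:C) j u.
Proof.
move=> [U [Uo Uu hr _]].
have [hd _] := C1_differentiable Uo Uu (hr 1%N).
have ed : differentiable expR (h u) by apply/derivable1_diffP.
have cd : differentiable (expR \o h) u by exact: differentiable_comp.
apply: complex_eqP; last first.
  by rewrite ImM /cpartial/= !derive_cst mulr0 mul0r addr0.
rewrite ReM /cpartial/= mul0r subr0.
rewrite [LHS](deriveE _ cd) (diff_comp hd ed) /= -(deriveE _ hd).
have [dphi Dphi] := is_derive_expR (h u).
by rewrite deriv1E// derive1E Dphi mulrC.
Qed.

End Calculus.

(** * Smooth functions, tangent vectors and fields on a manifold *)

Section Manifold.
Context {R : realType} {n : nat} {M : manifold R n}.
Local Notation C := R[i].
Local Notation e_ j := (delta_mx 0 j).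
Local Notation PM := (mparams M).
Local Notation smooth := (smooth_at PM).
Local Notation tangentM := (tangent PM).
Local Notation field := (smooth_field PM).
Local Notation form := (smooth_form1 PM).
Local Notation lieM := (lie PM).
Local Notation dformM := (dform PM).
Implicit Types (c : chart R n M) (x y : M) (g h : M -> C) (v : tvec R M)
  (Y Z : vfield R M) (al be : form1 R M).

Lemma tvD v w g : (v + w) g = v g + w g. Proof. by []. Qed.
Lemma tvZ (a : C) v g : (a *: v) g = a * v g. Proof. by []. Qed.
Lemma tvN v g : (- v) g = - v g. Proof. by []. Qed.
Lemma tv0 g : (0 : tvec R M) g = 0. Proof. by []. Qed.
Lemma tv_sum (I : Type) (r : seq I) (P : pred I) (F : I -> tvec R M) g :
  (\sum_(i <- r | P i) F i) g = \sum_(i <- r | P i) F i g.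
Proof.
elim: r => [|i r IH]; first by rewrite !big_nil.
by rewrite !big_cons; case: (P i) => //; rewrite tvD IH.
Qed.

Lemma chart_at x : exists2 c, atlas c & chart_dom c x.
Proof. exact: (@atlas_cover R n M). Qed.

Lemma mparamsP V psi u x : PM (V, psi) -> V u -> psi u = x ->
  exists c, [/\ atlas c, chart_dom c x, V = chart_img c, psi = chart_inv c &
    u = chart_map c x].
Proof.
move=> [c ca [-> ->]] cu cx; exists c; have [_ _ ci _ _] := atlas_chart ca.
by have [cd cm] := ci _ cu; rewrite -cx.
Qed.

Lemma mparams_chart c x : atlas c -> chart_dom c x ->
  [/\ PM (chart_img c, chart_inv c), chart_img c (chart_map c x) &
    chart_inv c (chart_map c x) = x].
Proof.
move=> ca cx; have [_ cm _ _ _] := atlas_chart ca; have [cu ce] := cm _ cx.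
by split => //; exists c.
Qed.

Lemma near_dom c x : atlas c -> chart_dom c x -> \forall y \near x, chart_dom c y.
Proof. by move=> /atlas_chart[[Do _] _ _ _ _] cx; exact: open_nbhs_nbhs. Qed.

Lemma near_inv c x (Q : M -> Prop) : atlas c -> chart_dom c x ->
  (\forall y \near x, Q y) -> \forall w \near chart_map c x, Q (chart_inv c w).
Proof.
move=> ca cx Qx; have [_ cu ce] := mparams_chart ca cx.
have [_ _ _ _ /(_ _ cu) ic] := atlas_chart ca.
by apply: ic; rewrite ce.
Qed.

Lemma near_map c x (Q : 'rV[R]_n -> Prop) : atlas c -> chart_dom c x ->
  (\forall w \near chart_map c x, Q w) -> \forall y \near x, Q (chart_map c y).
Proof. by move=> ca cx Qx; have [_ _ _ /(_ _ cx) mc _] := atlas_chart ca; exact: mc. Qed.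

(** Charts are homeomorphisms, so a condition tested in all parametrizations is a condition on a
    neighbourhood of x. From here on germs are handled by the neighbourhood filter. *)
Lemma near_pointP x (Q : M -> Prop) :
  near_point PM x Q <-> \forall y \near x, Q y.
Proof.
split=> [H|H V psi u PV Vu ux].
  have [c ca cx] := chart_at x; have [Pc cu ce] := mparams_chart ca cx.
  have := near_map ca cx (H _ _ _ Pc cu ce); apply: filterS2 (near_dom ca cx).
  by move=> y cy; have [_ _ ->] := mparams_chart ca cy.
by have [c [ca cx _ -> ->]] := mparamsP PV Vu ux; exact: near_inv.
Qed.

(** The changes of charts are smooth, so a single chart decides. *)
Lemma smooth_atP c x g : atlas c -> chart_dom c x ->
  smooth g x <-> Cinfty_near (g \o chart_inv c) (chart_map c x).
Proof.
move=> ca cx; have [Pc cu ce] := mparams_chart ca cx.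
split=> [H|H V psi u PV Vu ux]; first exact: H Pc cu ce.
have [c' [ca' cx' _ -> ->]] := mparamsP PV Vu ux.
have [_ cu' ce'] := mparams_chart ca' cx'.
have [[_ Io'] _ ci' _ ic'] := atlas_chart ca'.
have [[Do _] cm _ _ _] := atlas_chart ca.
have Oo : open (chart_img c' `&` chart_inv c' @^-1` chart_dom c).
  rewrite openE => w [w1 w2]; apply: filterI; first exact: open_nbhs_nbhs.
  by apply: (ic' w w1); exact: open_nbhs_nbhs.
have Ou : (chart_img c' `&` chart_inv c' @^-1` chart_dom c) (chart_map c' x).
  by split => //=; rewrite ce'.
have TC := atlas_compatible ca' ca.
have HT : Cinfty_near (g \o chart_inv c) (chart_map c (chart_inv c' (chart_map c' x))).
  by rewrite ce'.
have := @Cnear_comp _ _ _ _ _ (fun w => chart_map c (chart_inv c' w)) _ Oo Ou TC HT.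
have E w : (chart_img c' `&` chart_inv c' @^-1` chart_dom c) w ->
    g (chart_inv c (chart_map c (chart_inv c' w))) = g (chart_inv c' w).
  by move=> [_ /= wd]; have [_ ->] := cm _ wd.
by apply: Cnear_ext; exact: near_open Oo Ou E.
Qed.

Lemma smooth_ext g h x : (\forall y \near x, g y = h y) -> smooth g x -> smooth h x.
Proof.
move=> E; have [c ca cx] := chart_at x.
move=> /(smooth_atP _ ca cx) gs; apply/(smooth_atP _ ca cx).
by apply: Cnear_ext gs; exact: near_inv E.
Qed.

Lemma smooth_near g x : smooth g x -> \forall y \near x, smooth g y.
Proof.
have [c ca cx] := chart_at x.
move=> /(smooth_atP _ ca cx)/Cnear_near gs.
have := near_map ca cx gs; apply: filterS2 (near_dom ca cx) => y cy.
by move=> /(smooth_atP _ ca cy).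
Qed.

Lemma smooth_cst (a : C) x : smooth (fun=> a) x.
Proof.
have [c ca cx] := chart_at x; apply/(smooth_atP _ ca cx); exact: Cnear_cst.
Qed.

Lemma smoothD g h x : smooth g x -> smooth h x -> smooth (fun y => g y + h y) x.
Proof.
have [c ca cx] := chart_at x.
move=> /(smooth_atP _ ca cx) gs /(smooth_atP _ ca cx) hs.
by apply/(smooth_atP _ ca cx); exact: CnearD gs hs.
Qed.

Lemma smoothM g h x : smooth g x -> smooth h x -> smooth (fun y => g y * h y) x.
Proof.
have [c ca cx] := chart_at x.
move=> /(smooth_atP _ ca cx) gs /(smooth_atP _ ca cx) hs.
by apply/(smooth_atP _ ca cx); exact: CnearM gs hs.
Qed.

Lemma smoothN g x : smooth g x -> smooth (fun y => - g y) x.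
Proof.
move=> gs; have := smoothM (@smooth_cst (-1) x) gs.
by apply: smooth_ext; apply: nearW => y; rewrite mulN1r.
Qed.

Lemma smoothB g h x : smooth g x -> smooth h x -> smooth (fun y => g y - h y) x.
Proof. by move=> gs hs; exact: smoothD gs (smoothN hs). Qed.

Lemma smooth_conj g x : smooth g x -> smooth (fun y => (g y)^*) x.
Proof.
have [c ca cx] := chart_at x.
move=> /(smooth_atP _ ca cx) gs.
by apply/(smooth_atP _ ca cx); exact: Cnear_conj gs.
Qed.

Lemma smooth_conjP g x : smooth (fun y => (g y)^*) x <-> smooth g x.
Proof.
split=> [/smooth_conj|]; last exact: smooth_conj.
by apply: smooth_ext; apply: nearW => y; rewrite conjcK.
Qed.

Lemma smooth_sum (I : Type) (r : seq I) (F : I -> M -> C) x :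
  (forall i, smooth (F i) x) -> smooth (fun y => \sum_(i <- r) F i y) x.
Proof.
move=> Fs; elim: r => [|i r IH].
  apply: smooth_ext (@smooth_cst 0 x); apply: nearW => y.
  by rewrite big_nil.
by apply: smooth_ext (smoothD (Fs i) IH); apply: nearW => y; rewrite big_cons.
Qed.

Lemma smoothV g x : smooth g x -> g x != 0 -> smooth (fun y => (g y)^-1) x.
Proof.
have [c ca cx] := chart_at x.
move=> /(smooth_atP _ ca cx) gs g0; apply/(smooth_atP _ ca cx).
apply: (CnearV gs) => /=.
by have [_ _ ->] := mparams_chart ca cx.
Qed.

Lemma smooth_expR (r : M -> R) x : smooth (fun y => (r y)%:C) x ->
  smooth (fun y => (expR (r y))%:C) x.
Proof.
have [c ca cx] := chart_at x.
move=> /(smooth_atP _ ca cx) gs; apply/(smooth_atP _ ca cx).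
exact: (@Cnear_expR _ _ (r \o chart_inv c)).
Qed.

Lemma smooth_powR (a : R) (r : M -> R) x : smooth (fun y => (r y)%:C) x ->
  0 < r x -> smooth (fun y => (r y `^ a)%:C) x.
Proof.
have [c ca cx] := chart_at x.
move=> /(smooth_atP _ ca cx) gs r0; apply/(smooth_atP _ ca cx).
apply: (@Cnear_powR _ a _ (r \o chart_inv c)) => //=.
by have [_ _ ->] := mparams_chart ca cx.
Qed.

Lemma smooth_neq0 g x : smooth g x -> g x != 0 -> \forall y \near x, g y != 0.
Proof.
have [c ca cx] := chart_at x.
move=> /(smooth_atP _ ca cx) gs g0.
have gx0 : (g \o chart_inv c) (chart_map c x) != 0.
  by rewrite /=; have [_ _ ->] := mparams_chart ca cx.
have := near_map ca cx (Cnear_neq0 gs gx0); apply: filterS2 (near_dom ca cx).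
by move=> y cy /=; have [_ _ ->] := mparams_chart ca cy.
Qed.

(** The coordinate field d/du_j. The value 0 on non-smooth functions follows the convention of
    [tangent], so that expansions in these fields are equalities of functions. *)
Definition dvec c (j : 'I_n) : vfield R M := fun y g =>
  if `[< smooth g y >] then cpartial (g \o chart_inv c) j (chart_map c y) else 0.

Definition ccoord c (j : 'I_n) : M -> C := fun y => (chart_map c y 0 j)%:C.

Lemma dvecE c j y g : smooth g y ->
  dvec c j y g = cpartial (g \o chart_inv c) j (chart_map c y).
Proof. by rewrite /dvec => gs; rewrite asboolT. Qed.

Lemma dvec_nsmooth c j y g : ~ smooth g y -> dvec c j y g = 0.
Proof. by rewrite /dvec => gs; rewrite asboolF. Qed.

Lemma coord_inv_near c j x : atlas c -> chart_dom c x ->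
  \forall w \near chart_map c x, (ccoord c j \o chart_inv c) w = (w 0 j)%:C.
Proof.
move=> ca cx; have [_ cu _] := mparams_chart ca cx.
have [[_ Io] _ ci _ _] := atlas_chart ca.
have E w : chart_img c w -> (ccoord c j \o chart_inv c) w = (w 0 j)%:C.
  by move=> cw; rewrite /ccoord/=; have [_ ->] := ci _ cw.
exact: near_open Io cu E.
Qed.

Lemma smooth_coord c j x : atlas c -> chart_dom c x -> smooth (ccoord c j) x.
Proof.
move=> ca cx; apply/(smooth_atP _ ca cx).
have H : Cinfty_near (fun w : 'rV[R]_n => (w 0 j)%:C) (chart_map c x).
  exists setT; split => //; [exact: openT| |].
    exact: Cinfty_on_coord openT.
  by move=> k; apply: Ck_on_cst; exact: openT.
apply: Cnear_ext H; have := coord_inv_near j ca cx.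
by apply: filterS => w ->.
Qed.

Lemma dvec_coord c i j x : atlas c -> chart_dom c x ->
  dvec c i x (ccoord c j) = (i == j)%:R.
Proof.
move=> ca cx; rewrite dvecE; last exact: smooth_coord.
rewrite (cpartial_ext _ (coord_inv_near j ca cx)) /cpartial/=.
rewrite derive_cst.
have -> : (fun w : 'rV[R]_n => w 0 j) = dotmap (e_ j).
  by apply/funext => w; rewrite dotmap_delta.
have dE : differentiable (dotmap (e_ j)) (chart_map c x).
  exact/linear_differentiable/continuous_dotmap.
have -> : 'D_(e_ i) (dotmap (e_ j)) (chart_map c x) = dotmap (e_ j) (e_ i).
  by rewrite deriveE// diff_lin//; exact: continuous_dotmap.
rewrite dotmap_delta mxE eqxx/= eq_sym.
by case: (i == j).
Qed.

(** A vector given in another chart is rewritten by the chain rule: its coefficients are multiplied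
    by the Jacobian matrix of the change of charts. *)
Lemma tangentP c x v : atlas c -> chart_dom c x ->
  tangentM x v <-> exists a : 'I_n -> C, v = \sum_j a j *: dvec c j x.
Proof.
move=> ca cx; have [Pc cu ce] := mparams_chart ca cx; split; last first.
  move=> [a ->]; exists (chart_img c), (chart_inv c), (chart_map c x), a.
  split => // g; rewrite tv_sum; case: asboolP => gs.
    by apply: eq_bigr => j _; rewrite tvZ dvecE.
  by rewrite big1// => j _; rewrite tvZ dvec_nsmooth// mulr0.
move=> [V [psi [u [a [PV Vu ux vE]]]]].
have [c' [ca' cx' _ psiE uE]] := mparamsP PV Vu ux; subst psi u.
have [_ cu' ce'] := mparams_chart ca' cx'.
have [[_ Io'] _ ci' _ ic'] := atlas_chart ca'.
have [[Do _] cm _ _ _] := atlas_chart ca.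
have Oo : open (chart_img c' `&` chart_inv c' @^-1` chart_dom c).
  rewrite openE => w [w1 w2]; apply: filterI; first exact: open_nbhs_nbhs.
  by apply: (ic' w w1); exact: open_nbhs_nbhs.
have Ou : (chart_img c' `&` chart_inv c' @^-1` chart_dom c) (chart_map c' x).
  by split => //=; rewrite ce'.
have TC := atlas_compatible ca' ca.
pose T w := chart_map c (chart_inv c' w).
exists (fun i => \sum_j a j * ('D_(e_ j) (fun w => T w 0 i) (chart_map c' x))%:C).
apply/funext => g; rewrite vE tv_sum; case: asboolP => gs; last first.
  by rewrite big1// => j _; rewrite tvZ dvec_nsmooth// mulr0.
have HT : Cinfty_near (g \o chart_inv c) (T (chart_map c' x)).
  by rewrite /T ce'; exact/(smooth_atP _ ca cx).
have E w : (chart_img c' `&` chart_inv c' @^-1` chart_dom c) w ->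
    (g \o chart_inv c') w = ((g \o chart_inv c) \o T) w.
  by move=> [_ /= wd]; rewrite /T/=; have [_ ->] := cm _ wd.
under eq_bigr => j _.
  rewrite (cpartial_ext _ (near_open Oo Ou E)) (cpartial_comp _ Oo Ou TC HT).
  rewrite mulr_sumr.
over.
rewrite exchange_big/=; apply: eq_bigr => i _; rewrite tvZ mulr_suml.
apply: eq_bigr => j _; rewrite mulrA dvecE//; congr (_ * cpartial _ _ _).
by rewrite /T ce'.
Qed.

Lemma tangent_dvec c j x : atlas c -> chart_dom c x -> tangentM x (dvec c j x).
Proof.
move=> ca cx; apply/(tangentP _ ca cx); exists (fun i => (i == j)%:R).
rewrite (bigD1 j)//= eqxx scale1r big1 ?addr0// => i /negPf ->.
by rewrite scale0r.
Qed.

Lemma tangent_lin x a v w : tangentM x v -> tangentM x w ->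
  tangentM x (a *: v + w).
Proof.
have [c ca cx] := chart_at x.
move=> /(tangentP _ ca cx)[b ->] /(tangentP _ ca cx)[b' ->].
apply/(tangentP _ ca cx); exists (fun j => a * b j + b' j).
rewrite scaler_sumr -big_split/=; apply: eq_bigr => j _.
by rewrite scalerDl scalerA.
Qed.

Lemma tangent0 x : tangentM x 0.
Proof.
have [c ca cx] := chart_at x; apply/(tangentP _ ca cx); exists (fun=> 0).
by rewrite big1// => j _; rewrite scale0r.
Qed.

Lemma tangentZ x a v : tangentM x v -> tangentM x (a *: v).
Proof. by move=> tv; rewrite -[_ *: _]addr0; apply: tangent_lin => //; exact: tangent0. Qed.

Lemma tangentD x v w : tangentM x v -> tangentM x w -> tangentM x (v + w).
Proof. by move=> tv tw; rewrite -[v]scale1r; exact: tangent_lin. Qed.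

Lemma tangentN x v : tangentM x v -> tangentM x (- v).
Proof. by move=> tv; rewrite -scaleN1r; exact: tangentZ. Qed.

Lemma tangent_sum (I : Type) (r : seq I) (P : pred I) (F : I -> tvec R M) x :
  (forall i, tangentM x (F i)) -> tangentM x (\sum_(i <- r | P i) F i).
Proof.
move=> Ft; elim/big_ind: _ => //; first exact: tangent0.
by move=> *; exact: tangentD.
Qed.

Lemma conjvD v w : conjv (v + w) = conjv v + conjv w.
Proof. by apply/funext => g; rewrite /conjv !tvD rmorphD. Qed.
Lemma conjvZ a v : conjv (a *: v) = conjc a *: conjv v.
Proof. by apply/funext => g; rewrite /conjv !tvZ rmorphM. Qed.
Lemma conjvN v : conjv (- v) = - conjv v.
Proof. by apply/funext => g; rewrite /conjv !tvN rmorphN. Qed.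
Lemma conjv0 : conjv (0 : tvec R M) = 0.
Proof. by apply/funext => g; rewrite /conjv !tv0 conjc0. Qed.
Lemma conjvK v : conjv (conjv v) = v.
Proof.
apply/funext => g; rewrite /conjv conjcK; congr v.
by apply/funext => y; rewrite conjcK.
Qed.
Lemma conjv_sum (I : Type) (r : seq I) (P : pred I) (F : I -> tvec R M) :
  conjv (\sum_(i <- r | P i) F i) = \sum_(i <- r | P i) conjv (F i).
Proof. exact: (big_morph _ conjvD conjv0). Qed.

Lemma conjv_dvec c j x : atlas c -> chart_dom c x ->
  conjv (dvec c j x) = dvec c j x.
Proof.
move=> ca cx; apply/funext => g; rewrite /conjv.
have [gs|gs] := pselect (smooth g x); last first.
  rewrite !dvec_nsmooth ?conjc0//.
  by move=> /smooth_conjP.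
rewrite !dvecE//; last exact: smooth_conj.
rewrite (@cpartial_conj _ _ (g \o chart_inv c)) ?conjcK//.
exact/(smooth_atP _ ca cx).
Qed.

Lemma tangent_conj x v : tangentM x v -> tangentM x (conjv v).
Proof.
have [c ca cx] := chart_at x.
move=> /(tangentP _ ca cx)[b ->]; apply/(tangentP _ ca cx).
exists (fun j => (b j)^*); rewrite conjv_sum; apply: eq_bigr => j _.
by rewrite conjvZ conjv_dvec.
Qed.

Lemma tangent_nsmooth x v g : tangentM x v -> ~ smooth g x -> v g = 0.
Proof.
by move=> [V [psi [u [a [_ _ _ ->]]]]] gs; rewrite asboolF.
Qed.

(** Partial derivatives see only germs. If g is not smooth at x, then neither is h, and both values
    are 0 by convention. *)
Lemma tangent_ext x v g h : tangentM x v -> (\forall y \near x, g y = h y) ->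
  v g = v h.
Proof.
have [c ca cx] := chart_at x.
move=> /(tangentP _ ca cx)[b ->] E; rewrite !tv_sum; apply: eq_bigr => j _.
rewrite !tvZ; congr (_ * _).
have E' : \forall y \near x, h y = g y by apply: filterS E => y ->.
have [gs|gs] := pselect (smooth g x); last first.
  rewrite !dvec_nsmooth//.
  by move=> hs; apply: gs; exact: smooth_ext E' hs.
rewrite !dvecE//; last exact: smooth_ext E gs.
exact: cpartial_ext _ (near_inv ca cx E).
Qed.

Lemma tangent_cst x v (a : C) : tangentM x v -> v (fun=> a) = 0.
Proof.
have [c ca cx] := chart_at x.
move=> /(tangentP _ ca cx)[b ->]; rewrite tv_sum big1// => j _.
rewrite tvZ dvecE; last exact: smooth_cst.
by rewrite [cpartial _ _ _](cpartial_cst a) mulr0.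
Qed.

Lemma tangent_fD x v g h : tangentM x v -> smooth g x -> smooth h x ->
  v (fun y => g y + h y) = v g + v h.
Proof.
have [c ca cx] := chart_at x.
move=> /(tangentP _ ca cx)[b ->] gs hs; rewrite !tv_sum -big_split/=.
apply: eq_bigr => j _; rewrite !tvZ -mulrDr; congr (_ * _).
rewrite !dvecE//; last exact: smoothD.
by apply: (@cpartialD _ _ (g \o chart_inv c) (h \o chart_inv c));
  exact/(smooth_atP _ ca cx).
Qed.

Lemma tangent_fM x v g h : tangentM x v -> smooth g x -> smooth h x ->
  v (fun y => g y * h y) = v g * h x + g x * v h.
Proof.
have [c ca cx] := chart_at x; have [_ _ ce] := mparams_chart ca cx.
move=> /(tangentP _ ca cx)[b ->] gs hs; rewrite !tv_sum mulr_suml mulr_sumr.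
rewrite -big_split/=.
apply: eq_bigr => j _; rewrite !tvZ -mulrA [g x * _]mulrCA -mulrDr; congr (_ * _).
rewrite !dvecE//; last exact: smoothM.
rewrite (@cpartialM _ _ (g \o chart_inv c) (h \o chart_inv c));
  try exact/(smooth_atP _ ca cx).
by rewrite /= ce.
Qed.

Lemma tangent_fZ x v (a : C) g : tangentM x v -> smooth g x ->
  v (fun y => a * g y) = a * v g.
Proof.
move=> tv gs; rewrite (tangent_fM tv (@smooth_cst a x) gs).
by rewrite (tangent_cst a tv) mul0r add0r.
Qed.

Lemma tangent_fN x v g : tangentM x v -> smooth g x ->
  v (fun y => - g y) = - v g.
Proof.
move=> tv gs; rewrite -mulN1r -(tangent_fZ _ tv gs).
by apply: (tangent_ext tv); apply: nearW => y; rewrite mulN1r.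
Qed.

Lemma tangent_f0 x v : tangentM x v -> v (fun=> 0) = 0.
Proof. exact: tangent_cst. Qed.

Lemma tangent_fsum (I : Type) (r : seq I) (F : I -> M -> C) x v :
  tangentM x v -> (forall i, smooth (F i) x) ->
  v (fun y => \sum_(i <- r) F i y) = \sum_(i <- r) v (F i).
Proof.
move=> tv Fs; elim: r => [|i r IH].
  rewrite big_nil; transitivity (v (fun=> 0)); last exact: tangent_f0 tv.
  by apply: (tangent_ext tv); apply: nearW => y; rewrite big_nil.
rewrite big_cons -IH -(tangent_fD tv (Fs i) (smooth_sum r Fs)).
by apply: (tangent_ext tv); apply: nearW => y; rewrite big_cons.
Qed.

Implicit Types w : tvec R M.

Lemma tvec_ext x v w : tangentM x v -> tangentM x w ->
  (forall g, smooth g x -> v g = w g) -> v = w.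
Proof.
move=> tv tw E; apply/funext => g; have [gs|gs] := pselect (smooth g x).
  exact: E.
by rewrite (tangent_nsmooth tv gs) (tangent_nsmooth tw gs).
Qed.

Lemma field_tangent_near Y x : field Y x -> \forall y \near x, tangentM y (Y y).
Proof. by move=> [/near_pointP]. Qed.

Lemma field_tangent Y x : field Y x -> tangentM x (Y x).
Proof. by move=> /field_tangent_near; exact: nbhs_singleton. Qed.

Lemma field_smooth Y x g : field Y x -> smooth g x -> smooth (fun y => Y y g) x.
Proof. by move=> [_]; apply. Qed.

Lemma tangent_coord c x v : atlas c -> chart_dom c x -> tangentM x v ->
  v = \sum_j v (ccoord c j) *: dvec c j x.
Proof.
move=> ca cx /(tangentP _ ca cx)[b vE]; rewrite {1}vE; apply: eq_bigr => j _.
congr (_ *: _); rewrite vE tv_sum (bigD1 j)//= big1 ?addr0.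
  by rewrite tvZ dvec_coord// eqxx mulr1.
by move=> i /negPf ij; rewrite tvZ dvec_coord// ij mulr0.
Qed.

Lemma field_coord c Y x : atlas c -> chart_dom c x -> field Y x ->
  (forall j, smooth (fun y => Y y (ccoord c j)) x) /\
  \forall y \near x, Y y = \sum_j Y y (ccoord c j) *: dvec c j y.
Proof.
move=> ca cx fY; split=> [j|].
  by apply: field_smooth => //; exact: smooth_coord.
apply: filterS2 (near_dom ca cx) (field_tangent_near fY) => y cy ty.
exact: tangent_coord.
Qed.

Lemma dvec_smooth c j x g : atlas c -> chart_dom c x -> smooth g x ->
  smooth (fun y => dvec c j y g) x.
Proof.
move=> ca cx gs; apply/(smooth_atP _ ca cx).
have gC := (smooth_atP _ ca cx).1 gs.
apply: Cnear_ext (Cnear_partial j gC).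
have [_ cu _] := mparams_chart ca cx.
have [[_ Io] _ ci _ _] := atlas_chart ca.
have N1 : \forall w \near chart_map c x, chart_img c w.
  exact: open_nbhs_nbhs.
have N2 := near_inv ca cx (smooth_near gs).
apply: filterS2 N1 N2 => w cw gw /=.
by rewrite dvecE//; have [_ ->] := ci _ cw.
Qed.

Lemma field_of_coord c Y x (a : 'I_n -> M -> C) : atlas c -> chart_dom c x ->
  (forall j, smooth (a j) x) ->
  (\forall y \near x, Y y = \sum_j a j y *: dvec c j y) -> field Y x.
Proof.
move=> ca cx as_ YE; split.
  apply/near_pointP; apply: filterS2 (near_dom ca cx) YE => y cy ->.
  by apply: tangent_sum => j; apply: tangentZ; exact: tangent_dvec.
move=> g gs.
have H : smooth (fun y => \sum_j a j y * dvec c j y g) x.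
  by apply: smooth_sum => j; apply: smoothM => //; exact: dvec_smooth.
apply: smooth_ext H; apply: filterS YE => y ->.
by rewrite tv_sum; apply: eq_bigr => j _; rewrite tvZ.
Qed.

(** Smoothness of a field at x tests all functions smooth at x, a family that changes with x. It
    spreads to nearby points because it amounts to smoothness of finitely many coefficients in a
    chart. *)
Lemma field_near Y x : field Y x -> \forall y \near x, field Y y.
Proof.
move=> fY; have [c ca cx] := chart_at x.
have [as_ YE] := field_coord ca cx fY.
have N1 : \forall y \near x, forall j, smooth (fun y => Y y (ccoord c j)) y.
  apply: (@filter_forall _ _ (fun j y => smooth (fun y => Y y (ccoord c j)) y) _
    (nbhs_filter x)) => j.
  exact: smooth_near.
have N2 := near_dom ca cx.
have N3 : \forall y \near x, \forall z \near y,
    Y z = \sum_j Y z (ccoord c j) *: dvec c j z.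
  exact: nbhs_interior YE.
apply: filterS3 N1 N2 N3 => y y1 y2 y3.
exact: field_of_coord y2 y1 y3.
Qed.

Lemma field_ext Y Z x : (\forall y \near x, Y y = Z y) -> field Y x -> field Z x.
Proof.
move=> E [/near_pointP ty sy]; split.
  by apply/near_pointP; apply: filterS2 E ty => y ->.
move=> g gs; apply: smooth_ext (sy g gs).
by apply: filterS E => y ->.
Qed.

Lemma fieldD Y Z x : field Y x -> field Z x -> field (fun y => Y y + Z y) x.
Proof.
move=> fY fZ; split.
  apply/near_pointP.
  apply: filterS2 (field_tangent_near fY) (field_tangent_near fZ) => y.
  exact: tangentD.
move=> g gs; exact: smoothD (field_smooth fY gs) (field_smooth fZ gs).
Qed.

Lemma fieldZ h Y x : smooth h x -> field Y x -> field (fun y => h y *: Y y) x.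
Proof.
move=> hs fY; split.
  apply/near_pointP; apply: filterS (field_tangent_near fY) => y.
  exact: tangentZ.
move=> g gs; exact: smoothM hs (field_smooth fY gs).
Qed.

Lemma fieldN Y x : field Y x -> field (fun y => - Y y) x.
Proof.
move=> fY; apply: field_ext (fieldZ (@smooth_cst (-1) x) fY).
by apply: nearW => y; rewrite scaleN1r.
Qed.

Lemma fieldB Y Z x : field Y x -> field Z x -> field (fun y => Y y - Z y) x.
Proof. by move=> fY fZ; exact: fieldD fY (fieldN fZ). Qed.

Lemma field0 x : field (fun=> 0) x.
Proof.
split; first by apply/near_pointP; apply: nearW => y; exact: tangent0.
by move=> g gs; exact: smooth_cst.
Qed.

Lemma field_sum (I : Type) (r : seq I) (F : I -> vfield R M) x :
  (forall i, field (F i) x) -> field (fun y => \sum_(i <- r) F i y) x.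
Proof.
move=> Ff; elim: r => [|i r IH].
  by apply: field_ext (field0 x); apply: nearW => y; rewrite big_nil.
by apply: field_ext (fieldD (Ff i) IH); apply: nearW => y; rewrite big_cons.
Qed.

Lemma field_conj Y x : field Y x -> field (fun y => conjv (Y y)) x.
Proof.
move=> fY; split.
  apply/near_pointP; apply: filterS (field_tangent_near fY) => y.
  exact: tangent_conj.
move=> g gs; exact/smooth_conj/(field_smooth fY)/smooth_conj.
Qed.

Lemma field_extend x v : tangentM x v -> exists2 Y, field Y x & Y x = v.
Proof.
have [c ca cx] := chart_at x.
move=> /(tangentP _ ca cx)[b ->]; exists (fun y => \sum_j b j *: dvec c j y) => //.
apply: (field_of_coord (a := fun j _ => b j) ca cx); last exact: nearW.
by move=> j; exact: smooth_cst.
Qed.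

(** * The Lie bracket *)

Lemma lieE Y Z x g : smooth g x ->
  lieM Y Z x g = Y x (fun y => Z y g) - Z x (fun y => Y y g).
Proof. by move=> gs; rewrite /lie asboolT. Qed.

(** The second derivatives of g form a sum that is symmetric in Y and Z, because partial derivatives
    commute; what remains is an operator of first order, hence a tangent vector. *)
Lemma lie_coord c Y Z x : atlas c -> chart_dom c x -> field Y x -> field Z x ->
  lieM Y Z x = \sum_k (Y x (fun y => Z y (ccoord c k)) -
                       Z x (fun y => Y y (ccoord c k))) *: dvec c k x.
Proof.
move=> ca cx fY fZ; apply/funext => g; rewrite tv_sum.
have [gs|gs] := pselect (smooth g x); last first.
  rewrite /lie asboolF// big1// => k _.
  by rewrite tvZ dvec_nsmooth// mulr0.
rewrite lieE//.
have [Ys YE] := field_coord ca cx fY; have [Zs ZE] := field_coord ca cx fZ.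
have Ds k : smooth (fun y => dvec c k y g) x by exact: dvec_smooth.
have apply2 W W' : field W x -> field W' x ->
    W x (fun y => W' y g) =
    \sum_k (W x (fun y => W' y (ccoord c k)) * dvec c k x g +
            W' x (ccoord c k) * W x (fun y => dvec c k y g)).
  move=> fW fW'; have [Ws' WE'] := field_coord ca cx fW'.
  have tW := field_tangent fW.
  have -> : W x (fun y => W' y g) =
      W x (fun y => \sum_k W' y (ccoord c k) * dvec c k y g).
    apply: (tangent_ext tW); apply: filterS WE' => y {1}->.
    by rewrite tv_sum; apply: eq_bigr => k _; rewrite tvZ.
  rewrite (tangent_fsum _ tW); last by move=> k; exact: smoothM.
  by apply: eq_bigr => k _; rewrite (tangent_fM tW (Ws' k) (Ds k)).
rewrite (apply2 _ _ fY fZ) (apply2 _ _ fZ fY) !big_split/= opprD addrACA.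
rewrite [X in _ + X](_ : _ = 0); last first.
  apply/eqP; rewrite subr_eq0; apply/eqP.
  have E W W' : field W x -> field W' x ->
      \sum_k W' x (ccoord c k) * W x (fun y => dvec c k y g) =
      \sum_k \sum_j W' x (ccoord c k) * W x (ccoord c j) *
        cpartial (cpartial (g \o chart_inv c) k) j (chart_map c x).
    move=> fW fW'; apply: eq_bigr => k _.
    rewrite {1}(tangent_coord ca cx (field_tangent fW)) tv_sum mulr_sumr.
    apply: eq_bigr => j _; rewrite tvZ mulrA dvecE//; congr (_ * _).
    apply: cpartial_ext.
    have [_ cu _] := mparams_chart ca cx.
    have [[_ Io] _ ci _ _] := atlas_chart ca.
    have N1 : \forall w \near chart_map c x, chart_img c w.
      exact: open_nbhs_nbhs.
    have N2 := near_inv ca cx (smooth_near gs).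
    apply: filterS2 N1 N2 => w cw gw /=.
    by rewrite dvecE//; have [_ ->] := ci _ cw.
  rewrite (E _ _ fY fZ) (E _ _ fZ fY) exchange_big/=.
  apply: eq_bigr => k _; apply: eq_bigr => j _.
  rewrite cpartial_commute; last exact/(smooth_atP _ ca cx).
  by congr (_ * _); rewrite mulrC.
rewrite addr0 -sumrB; apply: eq_bigr => k _.
by rewrite tvZ mulrBl.
Qed.

Lemma field_lie Y Z x : field Y x -> field Z x -> field (lieM Y Z) x.
Proof.
move=> fY fZ; have [c ca cx] := chart_at x.
apply: (field_of_coord (a := fun k y => Y y (fun y => Z y (ccoord c k)) -
                       Z y (fun y => Y y (ccoord c k))) ca cx).
  move=> k; have ks := smooth_coord k ca cx.
  apply: smoothB; first exact/(field_smooth fY)/(field_smooth fZ).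
  exact/(field_smooth fZ)/(field_smooth fY).
apply: filterS3 (near_dom ca cx) (field_near fY) (field_near fZ) => y cy fYy fZy.
exact: lie_coord.
Qed.

Lemma lie_tangent Y Z x : field Y x -> field Z x -> tangentM x (lieM Y Z x).
Proof. by move=> fY fZ; exact: field_tangent (field_lie fY fZ). Qed.

Lemma lie_ext Y Y' Z Z' x : field Y x -> field Z x ->
  (\forall y \near x, Y y = Y' y) -> (\forall y \near x, Z y = Z' y) ->
  lieM Y Z x = lieM Y' Z' x.
Proof.
move=> fY fZ EY EZ; have fY' := field_ext EY fY; have fZ' := field_ext EZ fZ.
apply: tvec_ext; [exact: lie_tangent|exact: lie_tangent|move=> g gs].
rewrite !lieE// -(nbhs_singleton EY) -(nbhs_singleton EZ); congr (_ - _).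
  apply: (tangent_ext (field_tangent fY)).
  by apply: filterS EZ => y ->.
apply: (tangent_ext (field_tangent fZ)).
by apply: filterS EY => y ->.
Qed.

Lemma lieC Y Z x : lieM Y Z x = - lieM Z Y x.
Proof.
apply/funext => g; rewrite tvN /lie; case: asboolP => gs; last by rewrite oppr0.
by rewrite opprB.
Qed.

Lemma lieDr Y Z Z' x : field Y x -> field Z x -> field Z' x ->
  lieM Y (fun y => Z y + Z' y) x = lieM Y Z x + lieM Y Z' x.
Proof.
move=> fY fZ fZ'; have tY := field_tangent fY.
apply: tvec_ext; first by apply: lie_tangent => //; exact: fieldD.
  by apply: tangentD; exact: lie_tangent.
move=> g gs; rewrite tvD !lieE// !tvD.
rewrite (_ : Y x (fun y => (Z y + Z' y) g) =
   Y x (fun y => Z y g) + Y x (fun y => Z' y g)); first by ring.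
exact: tangent_fD tY (field_smooth fZ gs) (field_smooth fZ' gs).
Qed.

Lemma lieZr h Y Z x : smooth h x -> field Y x -> field Z x ->
  lieM Y (fun y => h y *: Z y) x = Y x h *: Z x + h x *: lieM Y Z x.
Proof.
move=> hs fY fZ; have tY := field_tangent fY; have tZ := field_tangent fZ.
apply: tvec_ext; first by apply: lie_tangent => //; exact: fieldZ.
  by apply: tangentD; apply: tangentZ => //; exact: lie_tangent.
move=> g gs; rewrite tvD !tvZ !lieE// tvZ.
rewrite (_ : Y x (fun y => (h y *: Z y) g) =
   Y x h * Z x g + h x * Y x (fun y => Z y g)); first by ring.
exact: tangent_fM tY hs (field_smooth fZ gs).
Qed.

Lemma lieDl Y Y' Z x : field Y x -> field Y' x -> field Z x ->
  lieM (fun y => Y y + Y' y) Z x = lieM Y Z x + lieM Y' Z x.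
Proof.
by move=> fY fY' fZ; rewrite lieC lieDr// opprD -!(lieC _ Z).
Qed.

Lemma lieZl h Y Z x : smooth h x -> field Y x -> field Z x ->
  lieM (fun y => h y *: Y y) Z x = h x *: lieM Y Z x - Z x h *: Y x.
Proof.
move=> hs fY fZ; rewrite lieC lieZr// opprD (lieC Z) scalerN opprK.
by rewrite addrC.
Qed.

Lemma lie0r Y x : field Y x -> lieM Y (fun=> 0) x = 0.
Proof.
move=> fY; apply: tvec_ext; [|exact: tangent0|move=> g gs].
  by apply: lie_tangent => //; exact: field0.
by rewrite lieE// [X in X - _](tangent_f0 (field_tangent fY)) !tv0 subrr.
Qed.

Lemma lie_sumr (I : Type) (r : seq I) Y (F : I -> vfield R M) x :
  field Y x -> (forall i, field (F i) x) ->
  lieM Y (fun y => \sum_(i <- r) F i y) x = \sum_(i <- r) lieM Y (F i) x.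
Proof.
move=> fY Ff; elim: r => [|i r IH].
  rewrite big_nil; transitivity (lieM Y (fun=> 0) x); last exact: lie0r.
  by congr (lie _ _ _ _); apply/funext => y; rewrite big_nil.
rewrite big_cons -IH -lieDr//; last exact: field_sum.
apply: lie_ext => //; first by exact: field_sum.
  exact: nearW.
by apply: nearW => y; rewrite big_cons.
Qed.

Lemma lie_conj Y Z x : field Y x -> field Z x ->
  conjv (lieM Y Z x) = lieM (fun y => conjv (Y y)) (fun y => conjv (Z y)) x.
Proof.
move=> fY fZ.
apply: tvec_ext; first exact/tangent_conj/lie_tangent.
  by apply: lie_tangent; exact: field_conj.
move=> g gs; rewrite {1}/conjv !lieE//; last exact: smooth_conj.
rewrite rmorphB; congr (_ - _); rewrite /conjv; congr ((_ _)^*).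
  by apply/funext => y; rewrite conjcK.
by apply/funext => y; rewrite conjcK.
Qed.

(** On a smooth function every double bracket expands into threefold derivatives, and these cancel
    algebraically. *)
Lemma jacobi X Y Z x : field X x -> field Y x -> field Z x ->
  lieM X (lieM Y Z) x = lieM (lieM X Y) Z x + lieM Y (lieM X Z) x.
Proof.
move=> fX fY fZ.
have fXY := field_lie fX fY; have fXZ := field_lie fX fZ.
have fYZ := field_lie fY fZ.
apply: tvec_ext; first exact: lie_tangent.
  by apply: tangentD; exact: lie_tangent.
move=> g gs; rewrite tvD !lieE//; try by apply: field_smooth.
have push A B D : field A x -> field B x -> field D x ->
    D x (fun y => lieM A B y g) = D x (fun y => A y (fun y => B y g)) -
      D x (fun y => B y (fun y => A y g)).
  move=> fA fB fD; have tD := field_tangent fD.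
  have sAB : smooth (fun y => A y (fun y => B y g)) x.
    exact/(field_smooth fA)/(field_smooth fB).
  have sBA : smooth (fun y => B y (fun y => A y g)) x.
    exact/(field_smooth fB)/(field_smooth fA).
  rewrite -(tangent_fN tD sBA) -(tangent_fD tD sAB (smoothN sBA)).
  apply: (tangent_ext tD); apply: filterS (smooth_near gs) => y gy.
  exact: lieE.
rewrite (push _ _ _ fY fZ fX) (push _ _ _ fX fY fZ) (push _ _ _ fX fZ fY).
ring.
Qed.

(** * One-forms and the exterior derivative *)

Lemma form_lin_near al x : form al x -> \forall y \near x, linear_on (tangentM y) (al y).
Proof. by move=> [/near_pointP]. Qed.

Lemma form_lin al x : form al x -> linear_on (tangentM x) (al x).
Proof. by move=> /form_lin_near; exact: nbhs_singleton. Qed.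

Lemma lin_on0 x (l : tvec R M -> C) : linear_on (tangentM x) l -> l 0 = 0.
Proof.
move=> L; have := L (-1) 0 0 (tangent0 x) (tangent0 x).
by rewrite scaler0 addr0 mulN1r addNr.
Qed.

Lemma lin_onD x (l : tvec R M -> C) v w : linear_on (tangentM x) l ->
  tangentM x v -> tangentM x w -> l (v + w) = l v + l w.
Proof. by move=> L tv tw; rewrite -[v]scale1r L// mul1r scale1r. Qed.

Lemma lin_onZ x (l : tvec R M -> C) a v : linear_on (tangentM x) l ->
  tangentM x v -> l (a *: v) = a * l v.
Proof.
by move=> L tv; rewrite -[_ *: _]addr0 L ?(lin_on0 L) ?addr0//; exact: tangent0.
Qed.

Lemma lin_onN x (l : tvec R M -> C) v : linear_on (tangentM x) l ->
  tangentM x v -> l (- v) = - l v.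
Proof. by move=> L tv; rewrite -scaleN1r (lin_onZ _ L tv) mulN1r. Qed.

Lemma lin_onB x (l : tvec R M -> C) v w : linear_on (tangentM x) l ->
  tangentM x v -> tangentM x w -> l (v - w) = l v - l w.
Proof.
by move=> L tv tw; rewrite (lin_onD L tv (tangentN tw)) (lin_onN L tw).
Qed.

Lemma lin_on_sum (I : Type) (r : seq I) (P : pred I) (F : I -> tvec R M) x
    (l : tvec R M -> C) : linear_on (tangentM x) l ->
  (forall i, tangentM x (F i)) ->
  l (\sum_(i <- r | P i) F i) = \sum_(i <- r | P i) l (F i).
Proof.
move=> L tF; elim: r => [|i r IH]; first by rewrite !big_nil (lin_on0 L).
rewrite !big_cons; case: (P i) => //.
by rewrite (lin_onD L) ?IH//; exact: tangent_sum.
Qed.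

Lemma form_field al Y x : form al x -> field Y x -> smooth (fun y => al y (Y y)) x.
Proof. by move=> [_]; apply. Qed.

Lemma field_dvec c k x : atlas c -> chart_dom c x -> field (dvec c k) x.
Proof.
move=> ca cx; split; last by move=> g; exact: dvec_smooth.
by apply/near_pointP; apply: filterS (near_dom ca cx) => y; exact: tangent_dvec.
Qed.

Lemma form_coord al Y x c : atlas c -> chart_dom c x -> form al x -> field Y x ->
  \forall y \near x, al y (Y y) =
    \sum_j Y y (ccoord c j) * al y (dvec c j y).
Proof.
move=> ca cx fal fY; have [_ YE] := field_coord ca cx fY.
apply: filterS3 (near_dom ca cx) YE (form_lin_near fal) => y cy {1}-> L.
rewrite (lin_on_sum _ _ L); last first.
  by move=> j; exact/tangentZ/tangent_dvec.
by apply: eq_bigr => j _; rewrite (lin_onZ _ L)//; exact: tangent_dvec.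
Qed.

Lemma form_of_coord al x c : atlas c -> chart_dom c x ->
  (\forall y \near x, linear_on (tangentM y) (al y)) ->
  (forall j, smooth (fun y => al y (dvec c j y)) x) -> form al x.
Proof.
move=> ca cx L as_; split; first exact/near_pointP.
move=> Y fY; have [Ys YE] := field_coord ca cx fY.
have H : smooth (fun y => \sum_j Y y (ccoord c j) * al y (dvec c j y)) x.
  by apply: smooth_sum => j; apply: smoothM; [exact: Ys|exact: as_].
apply: smooth_ext H.
apply: filterS3 (near_dom ca cx) YE L => y cy -> L.
rewrite (lin_on_sum _ _ L); last by move=> j; exact/tangentZ/tangent_dvec.
apply: eq_bigr => j _; rewrite (lin_onZ _ L); last exact: tangent_dvec.
congr (_ * _); rewrite tv_sum (bigD1 j)//= big1 ?addr0.
  by rewrite tvZ dvec_coord// eqxx mulr1.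
by move=> i /negPf ij; rewrite tvZ dvec_coord// ij mulr0.
Qed.

Lemma form_near al x : form al x -> \forall y \near x, form al y.
Proof.
move=> fal; have [c ca cx] := chart_at x.
have N1 : \forall y \near x, forall j, smooth (fun y => al y (dvec c j y)) y.
  apply: (@filter_forall _ _ (fun j y => smooth (fun y => al y (dvec c j y)) y) _
    (nbhs_filter x)) => j.
  exact/smooth_near/(form_field fal)/field_dvec.
have N2 := near_dom ca cx.
have N3 := nbhs_interior (form_lin_near fal).
apply: filterS3 N1 N2 N3 => y y1 y2 y3.
exact: form_of_coord y2 y3 y1.
Qed.

Lemma form_ext al be x : (\forall y \near x, forall v, tangentM y v -> al y v = be y v) ->
  form al x -> form be x.
Proof.
move=> E [/near_pointP L S]; split.
  apply/near_pointP; apply: filterS2 E L => y E L a v w tv tw.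
  by rewrite -!E ?L//; exact: tangent_lin.
move=> Y fY; apply: smooth_ext (S Y fY).
by apply: filterS2 E (field_tangent_near fY) => y E tY; exact: E.
Qed.

Lemma formD al be x : form al x -> form be x -> form (fun y v => al y v + be y v) x.
Proof.
move=> fal fbe; split.
  apply/near_pointP.
  apply: filterS2 (form_lin_near fal) (form_lin_near fbe) => y L L' a v w tv tw.
  by rewrite L// L'// mulrDr addrACA.
by move=> Y fY; exact: smoothD (form_field fal fY) (form_field fbe fY).
Qed.

Lemma formZ h al x : smooth h x -> form al x -> form (fun y v => h y * al y v) x.
Proof.
move=> hs fal; split.
  apply/near_pointP; apply: filterS (form_lin_near fal) => y L a v w tv tw.
  by rewrite L// mulrDr mulrCA.
by move=> Y fY; exact: smoothM hs (form_field fal fY).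
Qed.

Lemma form_zero x : form (fun _ _ => 0) x.
Proof.
split; last by move=> Y fY; exact: smooth_cst.
by apply/near_pointP; apply: nearW => y a v w _ _; rewrite mulr0 addr0.
Qed.

Lemma form_sum (I : Type) (r : seq I) (F : I -> form1 R M) x :
  (forall i, form (F i) x) -> form (fun y v => \sum_(i <- r) F i y v) x.
Proof.
move=> Ff; elim: r => [|i r IH].
  by apply: form_ext (form_zero x); apply: nearW => y v _; rewrite big_nil.
by apply: form_ext (formD (Ff i) IH); apply: nearW => y v _; rewrite big_cons.
Qed.

(* The value of d al on (v, w) in the coordinates of the chart c. *)
Definition dcoord c al x v w : C := \sum_k
  (w (ccoord c k) * v (fun y => al y (dvec c k y)) -
   v (ccoord c k) * w (fun y => al y (dvec c k y))).

(** The derivatives of the components of Y and Z cancel against those in the bracket, so only the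
    values of the fields at x survive. *)
Lemma dcoord_fields c al Y Z x : atlas c -> chart_dom c x -> form al x ->
  field Y x -> field Z x ->
  Y x (fun y => al y (Z y)) - Z x (fun y => al y (Y y)) - al x (lieM Y Z x) =
  dcoord c al x (Y x) (Z x).
Proof.
move=> ca cx fal fY fZ.
have as_ k : smooth (fun y => al y (dvec c k y)) x.
  exact/(form_field fal)/field_dvec.
have apply2 W W' : field W x -> field W' x ->
    W x (fun y => al y (W' y)) =
    \sum_k (W x (fun y => W' y (ccoord c k)) * al x (dvec c k x) +
            W' x (ccoord c k) * W x (fun y => al y (dvec c k y))).
  move=> fW fW'; have [Ws' _] := field_coord ca cx fW'.
  have tW := field_tangent fW.
  have -> : W x (fun y => al y (W' y)) =
      W x (fun y => \sum_k W' y (ccoord c k) * al y (dvec c k y)).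
    apply: (tangent_ext tW); exact: form_coord.
  rewrite (tangent_fsum _ tW); last by move=> k; exact: smoothM.
  by apply: eq_bigr => k _; rewrite (tangent_fM tW (Ws' k) (as_ k)).
rewrite (apply2 _ _ fY fZ) (apply2 _ _ fZ fY) (lie_coord ca cx fY fZ).
have L := form_lin fal.
rewrite (lin_on_sum _ _ L); last by move=> j; exact/tangentZ/tangent_dvec.
rewrite -!sumrB; apply: eq_bigr => k _.
rewrite (lin_onZ _ L); last exact: tangent_dvec.
ring.
Qed.

(** The choice made in [dform] is harmless: extensions of v and w exist, and all of them give this
    number. *)
Lemma dform_coord c al x v w : atlas c -> chart_dom c x -> form al x ->
  tangentM x v -> tangentM x w -> dformM al x v w = dcoord c al x v w.
Proof.
move=> ca cx fal tv tw; rewrite /dform; case: xgetP => [z _ [Y [Z]]|].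
  by move=> [fY fZ <- <- ->]; exact: dcoord_fields.
have [Y fY Yv] := field_extend tv; have [Z fZ Zw] := field_extend tw.
move=> /(_ (Y x (fun y => al y (Z y)) - Z x (fun y => al y (Y y)) -
  al x (lieM Y Z x)))[].
by exists Y, Z.
Qed.

Lemma dformE al Y Z x : form al x -> field Y x -> field Z x ->
  dformM al x (Y x) (Z x) =
  Y x (fun y => al y (Z y)) - Z x (fun y => al y (Y y)) - al x (lieM Y Z x).
Proof.
move=> fal fY fZ; have [c ca cx] := chart_at x.
rewrite (dform_coord ca cx fal (field_tangent fY) (field_tangent fZ)).
by rewrite -dcoord_fields.
Qed.

Lemma form_lie al Y Z x : form al x -> field Y x -> field Z x ->
  al x (lieM Y Z x) = Y x (fun y => al y (Z y)) - Z x (fun y => al y (Y y))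
    - dformM al x (Y x) (Z x).
Proof. by move=> fal fY fZ; rewrite (dformE fal fY fZ); ring. Qed.

Lemma dform_smooth al Y Z x : form al x -> field Y x -> field Z x ->
  smooth (fun y => dformM al y (Y y) (Z y)) x.
Proof.
move=> fal fY fZ.
have H : smooth (fun x => Y x (fun y => al y (Z y)) - Z x (fun y => al y (Y y))
    - al x (lieM Y Z x)) x.
  apply: smoothB; first apply: smoothB.
  - exact/(field_smooth fY)/(form_field fal).
  - exact/(field_smooth fZ)/(form_field fal).
  - exact/(form_field fal)/field_lie.
apply: smooth_ext H.
apply: filterS3 (form_near fal) (field_near fY) (field_near fZ) => y *.
by rewrite dformE.
Qed.

Lemma dformC al x v w : form al x -> tangentM x v -> tangentM x w ->
  dformM al x v w = - dformM al x w v.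
Proof.
move=> fal tv tw; have [c ca cx] := chart_at x.
rewrite !(dform_coord ca cx)// /dcoord -sumrN; apply: eq_bigr => k _.
by rewrite opprB.
Qed.

Lemma dform_linl al x w : form al x -> tangentM x w ->
  linear_on (tangentM x) (fun v => dformM al x v w).
Proof.
move=> fal tw a v v' tv tv'; have [c ca cx] := chart_at x.
rewrite !(dform_coord ca cx)//; last exact: tangent_lin.
rewrite /dcoord mulr_sumr -big_split/=; apply: eq_bigr => k _.
by rewrite !tvD !tvZ; ring.
Qed.

Lemma dform_linr al x v : form al x -> tangentM x v ->
  linear_on (tangentM x) (dformM al x v).
Proof.
move=> fal tv a w w' tw tw'.
rewrite dformC//; last exact: tangent_lin.
rewrite (dform_linl fal tv)// opprD -mulrN -!dformC//.
Qed.

(** Coordinate functions and coordinate fields are real, so conjugation acts on each factor of the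
    coordinate expression. *)
Lemma dform_conj al x v w : form al x ->
  (\forall y \near x, real_form1 PM al y) -> tangentM x v -> tangentM x w ->
  dformM al x (conjv v) (conjv w) = (dformM al x v w)^*.
Proof.
move=> fal ral tv tw; have [c ca cx] := chart_at x.
rewrite !(dform_coord ca cx)//; try exact: tangent_conj.
rewrite /dcoord rmorph_sum; apply: eq_bigr => k _.
have cc (u : tvec R M) : conjv u (ccoord c k) = (u (ccoord c k))^*.
  rewrite /conjv; congr ((u _)^*); apply/funext => y.
  by rewrite /ccoord conjc_real.
have cf (u : tvec R M) : tangentM x u -> conjv u (fun y => al y (dvec c k y)) =
    (u (fun y => al y (dvec c k y)))^*.
  move=> tu; rewrite /conjv; congr (_^*).
  apply: (tangent_ext tu); apply: filterS2 (near_dom ca cx) ral => y cy ry.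
  by rewrite -ry ?conjv_dvec//; exact: tangent_dvec.
by rewrite !cc !cf// rmorphB !rmorphM.
Qed.

Lemma dformZ h al x v w : smooth h x -> form al x -> tangentM x v -> tangentM x w ->
  dformM (fun y u => h y * al y u) x v w =
  h x * dformM al x v w + v h * al x w - w h * al x v.
Proof.
move=> hs fal tv tw.
have [Y fY Yv] := field_extend tv; have [Z fZ Zw] := field_extend tw.
rewrite -Yv -Zw (dformE (formZ hs fal) fY fZ) (dformE fal fY fZ).
rewrite (tangent_fM (field_tangent fY) hs (form_field fal fZ)).
rewrite (tangent_fM (field_tangent fZ) hs (form_field fal fY)).
ring.
Qed.

Lemma dformD al be x v w : form al x -> form be x -> tangentM x v -> tangentM x w ->
  dformM (fun y u => al y u + be y u) x v w = dformM al x v w + dformM be x v w.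
Proof.
move=> fal fbe tv tw.
have [Y fY Yv] := field_extend tv; have [Z fZ Zw] := field_extend tw.
rewrite -Yv -Zw (dformE (formD fal fbe) fY fZ) (dformE fal fY fZ) (dformE fbe fY fZ).
rewrite (tangent_fD (field_tangent fY) (form_field fal fZ) (form_field fbe fZ)).
rewrite (tangent_fD (field_tangent fZ) (form_field fal fY) (form_field fbe fY)).
ring.
Qed.

Lemma dform_sum (I : Type) (r : seq I) (F : I -> form1 R M) x v w :
  (forall i, form (F i) x) -> tangentM x v -> tangentM x w ->
  dformM (fun y u => \sum_(i <- r) F i y u) x v w =
    \sum_(i <- r) dformM (F i) x v w.
Proof.
move=> Ff tv tw; elim: r => [|i r IH].
  have [c ca cx] := chart_at x.
  rewrite big_nil (dform_coord ca cx)//; last exact: form_sum.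
  rewrite /dcoord big1// => k _.
  rewrite (_ : (fun y => _) = (fun=> 0)).
    by rewrite (tangent_f0 tv) (tangent_f0 tw) !mulr0 subrr.
  by apply/funext => y; rewrite big_nil.
rewrite big_cons -IH -(dformD _ (form_sum r Ff))//.
congr (dform _ _ _ _ _); apply/funext => y; apply/funext => u.
by rewrite big_cons.
Qed.

Lemma tangent_expR (r : M -> R) x v : tangentM x v ->
  smooth (fun y => (r y)%:C) x ->
  v (fun y => (expR (r y))%:C) = (expR (r x))%:C * v (fun y => (r y)%:C).
Proof.
have [c ca cx] := chart_at x; have [_ _ ce] := mparams_chart ca cx.
move=> /(tangentP _ ca cx)[b ->] rs; have es := smooth_expR rs.
rewrite !tv_sum mulr_sumr; apply: eq_bigr => j _.
rewrite !tvZ mulrCA !dvecE//; congr (_ * _).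
have H := (smooth_atP _ ca cx).1 rs.
by have := @cpartial_expR _ _ (r \o chart_inv c) j _ H; rewrite /= ce.
Qed.

(** Dimension count: the square matrix of the components of F in a chart has independent rows, hence
    is invertible. *)
Lemma free_spans (J : finType) (x : M) (F : J -> tvec R M) : #|J| = n ->
  (forall j, tangentM x (F j)) ->
  (forall b : J -> C, \sum_j b j *: F j = 0 -> forall j, b j = 0) ->
  forall v, tangentM x v -> exists b : J -> C, v = \sum_j b j *: F j.
Proof.
move=> Jn tF fF v tv; have [c ca cx] := chart_at x.
pose rk (j : J) : 'I_n := cast_ord Jn (enum_rank j).
pose vl (i : 'I_n) : J := enum_val (cast_ord (esym Jn) i).
have rkK : cancel rk vl by move=> j; rewrite /rk /vl cast_ordK enum_rankK.
have vlK : cancel vl rk by move=> j; rewrite /rk /vl enum_valK cast_ordKV.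
have reidx (G : J -> tvec R M) : \sum_j G j = \sum_i G (vl i).
  by rewrite (reindex vl)//; exists rk => i _; rewrite ?rkK ?vlK.
pose A : 'M[C]_n := \matrix_(i, k) F (vl i) (ccoord c k).
have comb (u : 'rV[C]_n) : \sum_i u 0 i *: F (vl i) =
    \sum_k (u *m A) 0 k *: dvec c k x.
  under eq_bigr => i _ do
    rewrite (tangent_coord ca cx (tF (vl i))) scaler_sumr.
  rewrite exchange_big/=; apply: eq_bigr => k _.
  rewrite mxE scaler_suml; apply: eq_bigr => i _.
  by rewrite scalerA mxE.
have Au : A \in unitmx.
  rewrite -row_free_unit; apply/inj_row_free => u uA.
  have /fF uF : \sum_j u 0 (rk j) *: F j = 0.
    rewrite reidx; under eq_bigr => i _ do rewrite vlK.
    by rewrite comb uA big1// => k _; rewrite mxE scale0r.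
  by apply/rowP => i; rewrite mxE -(vlK i) uF.
pose r : 'rV[C]_n := \row_k v (ccoord c k).
exists (fun j => (r *m invmx A) 0 (rk j)).
rewrite reidx; under eq_bigr => i _ do rewrite vlK.
rewrite comb mulmxKV// {1}(tangent_coord ca cx tv).
by apply: eq_bigr => k _; rewrite mxE.
Qed.

End Manifold.

Section Complex_unit.
Context {R : realType}.
Local Notation C := R[i].
Local Notation iC := (0 +i* 1 : C).

Lemma mulii : iC * iC = -1. Proof. by apply: complex_eqP => /=; ring. Qed.
Lemma conj_iC : iC^* = - iC. Proof. by apply: complex_eqP => /=; rewrite ?oppr0. Qed.
Lemma iC_neq0 : iC != 0.
Proof. by apply/eqP => /(congr1 (@complex.Im R))/= /eqP; rewrite oner_eq0. Qed.

End Complex_unit.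

(** * Orthonormal frames and the trace of the Webster connection *)

Section Pseudo_hermitian.
Context {R : realType} {m : nat} {M : manifold R (2 * m).+1}.
Local Notation C := R[i].
Local Notation iC := (0 +i* 1 : C).
Local Notation PM := (mparams M).
Local Notation smooth := (smooth_at PM).
Local Notation tangentM := (tangent PM).
Local Notation field := (smooth_field PM).
Local Notation form := (smooth_form1 PM).
Local Notation dformM := (dform PM).
Local Notation lieM := (lie PM).
Context {T10 : M -> set (tvec R M)}.
Hypotheses (m_gt0 : (0 < m)%N) (aCR : almost_CR T10)
  (pint : partially_integrable T10).
Implicit Types (x y : M) (u v w : tvec R M) (Z : 'I_m -> vfield R M).

Lemma T10_lin x (a : C) v w : T10 x v -> T10 x w -> T10 x (a *: v + w).
Proof. by case: aCR => L _ _; exact: L. Qed.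

(** Closure under a v + w yields 0 only once some element is at hand; a frame vector, available
    since m > 0, gives 0 as -Z + Z. *)
Lemma T10_0 x : T10 x 0.
Proof.
case: aCR => _ /(_ x)[Z [sZ _]] _.
have [_ /near_pointP/nbhs_singleton tZ] := sZ (Ordinal m_gt0).
by have := T10_lin (-1) tZ tZ; rewrite scaleN1r addNr.
Qed.

Lemma T10Z x (a : C) v : T10 x v -> T10 x (a *: v).
Proof. by move=> tv; rewrite -[_ *: _]addr0; apply: T10_lin => //; exact: T10_0. Qed.

Lemma T10D x v w : T10 x v -> T10 x w -> T10 x (v + w).
Proof. by move=> tv; rewrite -[v]scale1r; exact: T10_lin. Qed.

Lemma T10_sum (I : Type) (r : seq I) (P : pred I) (F : I -> tvec R M) x :
  (forall i, T10 x (F i)) -> T10 x (\sum_(i <- r | P i) F i).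
Proof.
move=> tF; elim/big_ind: _ => //; first exact: T10_0.
by move=> *; exact: T10D.
Qed.

Lemma T10_tangent x v : T10 x v -> tangentM x v.
Proof.
case: aCR => _ /(_ x)[Z [sZ /near_pointP/nbhs_singleton[_ sp]]] _.
move=> /sp[c ->]; apply: tangent_sum => a; apply: tangentZ.
by have [fZ _] := sZ a; exact: field_tangent.
Qed.

Lemma T01_conj x v : T10 x v -> T01 T10 x (conjv v).
Proof. by rewrite /T01/= conjvK. Qed.

Lemma T01_tangent x v : T01 T10 x v -> tangentM x v.
Proof. by move=> /T10_tangent/tangent_conj; rewrite conjvK. Qed.

Lemma T10_T01_eq0 x v : T10 x v -> T01 T10 x v -> v = 0.
Proof. by case: aCR => _ _; apply. Qed.

Context {th : form1 R M}.
Hypothesis ph : pseudo_hermitian T10 th.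

Lemma ph_form x : form th x. Proof. by have [] := ph x. Qed.

Lemma ph_lin x : linear_on (tangentM x) (th x).
Proof. exact/form_lin/ph_form. Qed.

Lemma ph_real x : real_form1 PM th x. Proof. by have [] := ph x. Qed.

(** The hypothesis concerns real vectors. Applied to v + conj(v) and to iv + conj(iv), it gives
    theta(conj v) = - theta(v) and theta(conj v) = theta(v). *)
Lemma th_T10 x v : T10 x v -> th x v = 0.
Proof.
move=> tv; have Tv := T10_tangent tv.
have H0 u : T10 x u -> th x u + th x (conjv u) = 0.
  move=> tu; have Tu := T10_tangent tu.
  have [_ _ _ H] := ph x.
  rewrite -(lin_onD (ph_lin (x := x)) Tu (tangent_conj Tu)); apply: H; split.
    by exists u, (conjv u); split => //; exact: T01_conj.
  by rewrite conjvD conjvK addrC.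
have := H0 _ (T10Z iC tv); rewrite conjvZ conj_iC.
rewrite (lin_onZ _ (ph_lin (x := x)) Tv) (lin_onZ _ (ph_lin (x := x)) (tangent_conj Tv)).
have := H0 _ tv; move=> /eqP; rewrite addrC addr_eq0 => /eqP ->.
rewrite mulrNN -mulrDr => /eqP; rewrite mulf_eq0 (negPf iC_neq0)/=.
by rewrite -mulr2n mulrn_eq0/= => /eqP.
Qed.

Lemma th_T01 x v : T01 T10 x v -> th x v = 0.
Proof.
move=> tv; have := th_T10 tv; rewrite ph_real//; last exact: T01_tangent.
by move=> /eqP; rewrite conjc_eq0 => /eqP.
Qed.

(** Until existence is proved [reeb] may be the default 0. Uniqueness of the decomposition is proved
    in both cases, so the projections can be used before the Reeb field is known to exist. *)
Lemma reeb_alt x : reeb th x = 0 \/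
  [/\ real_tangent PM x (reeb th x), th x (reeb th x) = 1 &
      forall w, tangentM x w -> dformM th x (reeb th x) w = 0].
Proof. by rewrite /reeb; case: xgetP => [t _ ?|_]; [right|left]. Qed.

Lemma decomp_uniq x u w c u' w' c' : T10 x u -> T01 T10 x w -> T10 x u' ->
  T01 T10 x w' -> u + w + c *: reeb th x = u' + w' + c' *: reeb th x ->
  u = u' /\ w = w'.
Proof.
move=> tu tw tu' tw' E.
have {}E : u + w = u' + w'.
  have [r0|[[tr _] r1 _]] := reeb_alt x.
    by move: E; rewrite r0 !scaler0 !addr0.
  suff cc : c = c' by move: E; rewrite cc; exact: addIr.
  have := congr1 (th x) E.
  rewrite !(lin_onD (ph_lin (x := x))) ?(lin_onZ _ (ph_lin (x := x)))//;
    do ?[exact: tangentZ|exact: tangentD|exact: T10_tangent|exact: T01_tangent];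
    try by apply: tangentD; [exact: T10_tangent|exact: T01_tangent].
  by rewrite (th_T10 tu) (th_T10 tu') (th_T01 tw) (th_T01 tw') r1 !add0r !mulr1.
have D : u - u' = w' - w by apply/eqP; rewrite subr_eq addrAC [w' + _]addrC -E addrK.
have : u - u' = 0.
  apply: (@T10_T01_eq0 x).
    by rewrite addrC -scaleN1r; exact: T10_lin.
  by rewrite D /T01/= conjvD conjvN addrC -scaleN1r; exact: T10_lin.
move=> /eqP; rewrite subr_eq0 => /eqP uu; split => //.
by move: E; rewrite uu => /addrI.
Qed.

Lemma T01_0 x : T01 T10 x 0.
Proof. by rewrite /T01/= conjv0; exact: T10_0. Qed.

Lemma pr10E x u w c : T10 x u -> T01 T10 x w ->
  pr10 T10 th x (u + w + c *: reeb th x) = u.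
Proof.
move=> tu tw; rewrite /pr10; case: xgetP => [u' _ [tu' [w' [c' [tw' E]]]]|].
  by have [] := decomp_uniq tu tw tu' tw' E.
by move=> /(_ u)[]; split => //; exists w, c.
Qed.

Lemma pr01E x u w c : T10 x u -> T01 T10 x w ->
  pr01 T10 th x (u + w + c *: reeb th x) = w.
Proof.
move=> tu tw; rewrite /pr01; case: xgetP => [w' _ [tw' [u' [c' [tu' E]]]]|].
  by have [] := decomp_uniq tu tw tu' tw' E.
by move=> /(_ w)[]; split => //; exists u, c.
Qed.

Lemma pr_T10_T01 x u w : T10 x u -> T01 T10 x w ->
  pr10 T10 th x (u + w) = u /\ pr01 T10 th x (u + w) = w.
Proof.
by move=> tu tw; rewrite -[u + w]addr0 -(scale0r (reeb th x)) pr10E ?pr01E.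
Qed.

Lemma levi10_0 x v : tangentM x v -> levi10 th x 0 v = 0.
Proof.
move=> tv; rewrite /levi10.
by rewrite (lin_on0 (dform_linl (ph_form x) (tangent_conj tv))) mulr0.
Qed.

Lemma levi_T10 x u v : T10 x u -> T10 x v -> levi T10 th x u v = levi10 th x u v.
Proof.
move=> tu tv; rewrite /levi.
have [+ +] := pr_T10_T01 tu (T01_0 x); rewrite addr0 => -> ->.
have [+ +] := pr_T10_T01 tv (T01_0 x); rewrite addr0 => -> ->.
by rewrite !conjv0 NumconjE levi10_0 ?conjc0 ?addr0//; exact: tangent0.
Qed.

Lemma levi10_herm x u v : tangentM x u -> tangentM x v ->
  (levi10 th x u v)^* = levi10 th x v u.
Proof.
move=> tu tv; rewrite /levi10 conjcM conjcN conj_iC opprK.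
rewrite -dform_conj//; [|exact: ph_form|by apply: nearW => y; exact: ph_real|
  exact: tangent_conj].
rewrite conjvK (dformC (ph_form x))//; last exact: tangent_conj.
by rewrite mulrN mulNr.
Qed.

Lemma levi10_linl x w : tangentM x w -> linear_on (tangentM x) (fun v => levi10 th x v w).
Proof.
move=> tw a u v tu tv; rewrite /levi10.
rewrite (dform_linl (ph_form x) (tangent_conj tw))//.
by rewrite mulrDr mulrCA.
Qed.

(** The value of the Levi form on the real vector v + conj(v) is twice its value on v; this vector
    is non-zero because T_10 and T_01 meet only in 0. *)
Lemma levi10_pos x v : levi_positive T10 th -> T10 x v -> v != 0 ->
  0 < levi10 th x v v.
Proof.
move=> pos tv v0; have Tv := T10_tangent tv.
have [p1 p2] := pr_T10_T01 tv (T01_conj tv).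
have /pos : Hdist T10 x (v + conjv v).
  split; first by exists v, (conjv v); split => //; exact: T01_conj.
  by rewrite conjvD conjvK addrC.
rewrite /levi p1 p2 conjvK NumconjE levi10_herm// => H.
have /H : v + conjv v != 0.
  apply: contra_neq v0 => v0; apply: (T10_T01_eq0 tv).
  have -> : v = - conjv v by apply/eqP; rewrite -addr_eq0 v0.
  by rewrite /T01/= conjvN conjvK; have := T10Z (-1) tv; rewrite scaleN1r.
by rewrite -mulr2n pmulrn_lgt0.
Qed.

(** * Orthonormal frames, their coframes and the Reeb field *)

Local Notation OF := (orthonormal_frame T10 th).
Local Notation dth := (dform PM th).
Local Notation T := (reeb th).

Lemma section10_near (U : vfield R M) x : section10 T10 U x ->
  \forall y \near x, section10 T10 U y.
Proof.
move=> [fU /near_pointP tU].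
apply: filterS2 (field_near fU) (nbhs_interior tU) => y fy ty.
by split => //; apply/near_pointP.
Qed.

Lemma local_frame_near Z x : local_frame T10 Z x ->
  \forall y \near x, local_frame T10 Z y.
Proof.
move=> [sZ /near_pointP iZ].
have N1 : \forall y \near x, forall a, section10 T10 (Z a) y.
  apply: (@filter_forall _ _ (fun a y => section10 T10 (Z a) y) _
    (nbhs_filter x)) => a.
  exact: section10_near.
apply: filterS2 N1 (nbhs_interior iZ) => y sy iy.
by split => //; apply/near_pointP.
Qed.

Lemma local_frame_scale (k : 'I_m -> M -> C) Z x : (forall a, smooth (k a) x) ->
  (\forall y \near x, forall a, k a y != 0) -> local_frame T10 Z x ->
  local_frame T10 (fun a y => k a y *: Z a y) x.
Proof.
move=> ks k0 lZ; have N := local_frame_near lZ; split.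
  move=> a; have [/(_ a)[fZ _] _] := lZ; split; first exact: fieldZ.
  apply/near_pointP; apply: filterS N => y [sZ _].
  have [_ /near_pointP/nbhs_singleton ta] := sZ a.
  exact: T10Z.
apply/near_pointP; apply: filterS2 N k0 => y ly k0.
have [_ /near_pointP/nbhs_singleton[iZ sp]] := ly.
split=> [c E a|v /sp[c ->]].
  have : \sum_a (c a * k a y) *: Z a y = 0.
    by rewrite -[RHS]E; apply: eq_bigr => b _; rewrite scalerA.
  by move=> /iZ/(_ a)/eqP; rewrite mulf_eq0 (negPf (k0 a)) orbF => /eqP.
exists (fun a => c a / k a y); apply: eq_bigr => a _.
by rewrite scalerA divfK.
Qed.

Lemma OF_near Z x : OF Z x -> \forall y \near x, OF Z y.
Proof.
move=> [lZ /near_pointP oZ].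
apply: filterS2 (local_frame_near lZ) (nbhs_interior oZ) => y ly oy.
by split => //; apply/near_pointP.
Qed.

Lemma OF_section Z x a : OF Z x -> section10 T10 (Z a) x.
Proof. by move=> [[]]. Qed.

Lemma OF_field Z x a : OF Z x -> field (Z a) x.
Proof. by move=> /(OF_section a)[]. Qed.

Lemma OF_fieldc Z x a : OF Z x -> field (fun y => conjv (Z a y)) x.
Proof. by move=> oZ; exact: field_conj (OF_field a oZ). Qed.

Lemma OF_T10 Z x a : OF Z x -> T10 x (Z a x).
Proof. by move=> /(OF_section a)[_ /near_pointP]; exact: nbhs_singleton. Qed.

Lemma OF_tangent Z x a : OF Z x -> tangentM x (Z a x).
Proof. by move=> oZ; exact: field_tangent (OF_field a oZ). Qed.

Lemma OF_tangentc Z x a : OF Z x -> tangentM x (conjv (Z a x)).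
Proof. by move=> oZ; exact: tangent_conj (OF_tangent a oZ). Qed.

Lemma OF_levi Z x a b : OF Z x -> levi10 th x (Z a x) (Z b x) = (a == b)%:R.
Proof.
move=> oZ; rewrite -(levi_T10)//; try exact: OF_T10.
by case: oZ => _ /near_pointP/nbhs_singleton.
Qed.

Lemma OF_dth Z x a b : OF Z x -> dth x (Z a x) (conjv (Z b x)) = iC * (a == b)%:R.
Proof.
move=> oZ; rewrite -(OF_levi _ _ oZ) /levi10.
by rewrite mulrA mulrN mulii opprK mul1r.
Qed.

Lemma OF_dthC Z x a b : OF Z x -> dth x (conjv (Z b x)) (Z a x) = - iC * (a == b)%:R.
Proof.
move=> oZ; rewrite (dformC (ph_form x)) ?(OF_dth _ _ oZ) ?mulNr//.
  exact: OF_tangentc.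
exact: OF_tangent.
Qed.

Lemma section_lie U V x : section10 T10 U x -> section10 T10 V x ->
  th x (lieM U V x) = 0.
Proof.
move=> sU sV; have [u [w [tu tw ->]]] := pint sU sV.
rewrite (lin_onD (ph_lin (x := x))); last 2 first.
- exact: T10_tangent.
- exact: T01_tangent.
by rewrite (th_T10 tu) (th_T01 tw) addr0.
Qed.

Lemma th_section0 (U : vfield R M) x : section10 T10 U x ->
  \forall y \near x, th y (U y) = 0.
Proof.
by move=> [_ /near_pointP tU]; apply: filterS tU => y; exact: th_T10.
Qed.

Lemma tangent_th0 (U : vfield R M) x v : section10 T10 U x -> tangentM x v ->
  v (fun y => th y (U y)) = 0.
Proof.
move=> sU tv; rewrite -(tangent_f0 tv); apply: (tangent_ext tv).
exact: th_section0.
Qed.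

(** Since theta(U) and theta(V) vanish near x, d theta(U, V) = - theta([U, V]), which is 0 by
    partial integrability. *)
Lemma dth_section U V x : section10 T10 U x -> section10 T10 V x ->
  dth x (U x) (V x) = 0.
Proof.
move=> sU sV; have [fU _] := sU; have [fV _] := sV.
rewrite (dformE (ph_form x) fU fV) (section_lie sU sV).
rewrite (tangent_th0 sV (field_tangent fU)) (tangent_th0 sU (field_tangent fV)).
by rewrite !subr0.
Qed.

Lemma OF_dth10 Z x a b : OF Z x -> dth x (Z a x) (Z b x) = 0.
Proof. by move=> oZ; apply: dth_section; exact: OF_section. Qed.

Lemma dth_conj x v w : tangentM x v -> tangentM x w ->
  dth x (conjv v) (conjv w) = conjc (dth x v w).
Proof.
move=> tv tw; apply: dform_conj => //; first exact: ph_form.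
by apply: nearW => y; exact: ph_real.
Qed.

Lemma OF_dth01 Z x a b : OF Z x -> dth x (conjv (Z a x)) (conjv (Z b x)) = 0.
Proof.
move=> oZ; rewrite dth_conj ?OF_dth10 ?conjc0//; exact: OF_tangent.
Qed.

Lemma OF_th Z x a : OF Z x -> th x (Z a x) = 0.
Proof. by move=> oZ; apply: th_T10; exact: OF_T10. Qed.

Lemma OF_thc Z x a : OF Z x -> th x (conjv (Z a x)) = 0.
Proof.
by move=> oZ; rewrite ph_real ?OF_th ?conjc0//; exact: OF_tangent.
Qed.

Lemma dth_linr x v : tangentM x v -> linear_on (tangentM x) (dth x v).
Proof. exact: dform_linr (ph_form x). Qed.

Lemma dth_linl x w : tangentM x w -> linear_on (tangentM x) (fun v => dth x v w).
Proof. exact: dform_linl (ph_form x). Qed.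

Lemma tangent_comb Z x (b d : 'I_m -> C) : OF Z x ->
  tangentM x (\sum_a b a *: Z a x) /\ tangentM x (\sum_a d a *: conjv (Z a x)).
Proof.
move=> oZ; split; apply: tangent_sum => a; apply: tangentZ.
  exact: OF_tangent.
exact: OF_tangentc.
Qed.

Lemma th_comb Z x (b d : 'I_m -> C) : OF Z x ->
  th x (\sum_a b a *: Z a x) = 0 /\ th x (\sum_a d a *: conjv (Z a x)) = 0.
Proof.
move=> oZ; have L := ph_lin (x := x).
have t1 a : tangentM x (Z a x) by exact: OF_tangent.
have t2 a : tangentM x (conjv (Z a x)) by exact: OF_tangentc.
rewrite !(lin_on_sum _ _ L); [|by move=> a; exact: tangentZ..].
by split; rewrite big1// => a _; rewrite (lin_onZ _ L)// ?OF_th ?OF_thc ?mulr0.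
Qed.

Lemma dth_comb Z x (b d : 'I_m -> C) a0 : OF Z x ->
  let v := \sum_a b a *: Z a x + \sum_a d a *: conjv (Z a x) in
  dth x v (conjv (Z a0 x)) = iC * b a0 /\ dth x v (Z a0 x) = - iC * d a0.
Proof.
move=> oZ v; have [tb td] := tangent_comb b d oZ.
have t1 a : tangentM x (Z a x) by exact: OF_tangent.
have t2 a : tangentM x (conjv (Z a x)) by exact: OF_tangentc.
have sumD w : tangentM x w -> dth x v w = \sum_a b a * dth x (Z a x) w +
    \sum_a d a * dth x (conjv (Z a x)) w.
  move=> tw; have L := dth_linl tw.
  rewrite (lin_onD L tb td) !(lin_on_sum _ _ L); [|by move=> a; exact: tangentZ..].
  by congr (_ + _); apply: eq_bigr => a _; rewrite (lin_onZ _ L).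
split; rewrite sumD// [X in X + _](bigD1 a0)//= [X in _ + X](bigD1 a0)//=.
  rewrite (OF_dth _ _ oZ) eqxx mulr1 (OF_dth01 _ _ oZ) mulr0 add0r !big1 ?addr0.
  - by rewrite mulrC.
  - by move=> a _; rewrite OF_dth01// mulr0.
  - by move=> a /negPf aa; rewrite OF_dth// aa !mulr0.
rewrite (OF_dth10 _ _ oZ) (OF_dthC _ _ oZ) eqxx mulr1 mulr0 add0r !big1 ?addr0 ?add0r.
- by rewrite mulrC.
- by move=> a /negPf aa; rewrite OF_dthC// eq_sym aa !mulr0.
- by move=> a _; rewrite OF_dth10// mulr0.
Qed.

(** The 2m + 1 vectors are independent: theta detects N, and pairing by d theta detects the others.
    N is an arbitrary transverse vector because the Reeb field is constructed only afterwards. *)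
Lemma OF_spans Z x N : OF Z x -> tangentM x N -> th x N != 0 ->
  forall v, tangentM x v -> exists b d e,
    v = \sum_a b a *: Z a x + \sum_a d a *: conjv (Z a x) + e *: N.
Proof.
move=> oZ tN N0.
pose J : finType := (('I_m + 'I_m) + 'I_1)%type.
pose F (j : J) : tvec R M := match j with
  | inl (inl a) => Z a x | inl (inr a) => conjv (Z a x) | inr _ => N end.
have sumE (e : J -> C) : \sum_j e j *: F j =
    \sum_a e (inl (inl a)) *: Z a x + \sum_a e (inl (inr a)) *: conjv (Z a x)
      + e (inr ord0) *: N.
  by rewrite !big_sumType/= big_ord1.
have cJ : #|J| = (2 * m).+1.
  by rewrite !card_sum !card_ord mul2n addnn addn1.
have tF j : tangentM x (F j).
  by case: j => [[a|a]|_] //=; [exact: OF_tangent|exact: OF_tangentc].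
move=> v tv; have [|b ->] := free_spans cJ tF _ tv; last first.
  by rewrite sumE; eexists _, _, _.
move=> e; rewrite sumE => E.
have [tb td] := tangent_comb (fun a => e (inl (inl a))) (fun a => e (inl (inr a))) oZ.
have [hb hd] := th_comb (fun a => e (inl (inl a))) (fun a => e (inl (inr a))) oZ.
have L := ph_lin (x := x).
have e0 : e (inr ord0) = 0.
  have := congr1 (th x) E.
  rewrite (lin_onD L); [|exact: tangentD|exact: tangentZ].
  rewrite (lin_onD L)// hb hd (lin_onZ _ L)// (lin_on0 L) !add0r => /eqP.
  by rewrite mulf_eq0 (negPf N0) orbF => /eqP.
move: E; rewrite e0 scale0r addr0 => E.
move=> [[a|a]|j]; last by rewrite ord1.
  have [+ _] := dth_comb (fun a => e (inl (inl a))) (fun a => e (inl (inr a))) a oZ.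
  rewrite E (lin_on0 (dth_linl (OF_tangentc a oZ))) => /esym/eqP.
  by rewrite mulf_eq0 (negPf iC_neq0)/= => /eqP.
have [_ +] := dth_comb (fun a => e (inl (inl a))) (fun a => e (inl (inr a))) a oZ.
rewrite E (lin_on0 (dth_linl (OF_tangent a oZ))) => /esym/eqP.
by rewrite mulf_eq0 oppr_eq0 (negPf iC_neq0)/= => /eqP.
Qed.

(** The coframe theta^a and its conjugate, read off from d theta = i sum theta^a /\ conj(theta^a).
    This form is smooth and kills the Reeb field by construction, without reference to the
    projections. *)
Definition theta10 Z (a : 'I_m) x v : C := - iC * dth x v (conjv (Z a x)).
Definition theta01 Z (a : 'I_m) x v : C := iC * dth x v (Z a x).

(* The Reeb field computed from any field N with theta(N) = 1. *)
Definition reeb_of Z (N : vfield R M) : vfield R M := fun x =>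
  N x - \sum_a theta10 Z a x (N x) *: Z a x - \sum_a theta01 Z a x (N x) *: conjv (Z a x).

(** Reality is left out: the conjugate of a solution is a solution, so uniqueness implies it. *)
Definition is_reeb x t := [/\ tangentM x t, th x t = 1 &
  forall w, tangentM x w -> dth x t w = 0].

Lemma is_reeb_uniq Z x t t' : OF Z x -> is_reeb x t -> is_reeb x t' -> t = t'.
Proof.
move=> oZ [t1 e1 d1] [t2 e2 d2].
have n0 : th x t != 0 by rewrite e1 oner_eq0.
have [b [d [e E]]] := OF_spans oZ t1 n0 (tangentD t2 (tangentN t1)).
have [tb td] := tangent_comb b d oZ; have [hb hd] := th_comb b d oZ.
have L := ph_lin (x := x).
have e0 : e = 0.
  have := congr1 (th x) E.
  rewrite (lin_onB L t2 t1) e1 e2 subrr.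
  rewrite (lin_onD L); [|exact: tangentD|exact: tangentZ].
  by rewrite (lin_onD L)// hb hd (lin_onZ _ L)// e1 !add0r mulr1.
move: E; rewrite e0 scale0r addr0 => E.
have dD w : tangentM x w -> dth x (t' - t) w = 0.
  by move=> tw; rewrite (lin_onB (dth_linl tw) t2 t1) d1// d2// subrr.
have b0 a : b a = 0.
  have [+ _] := dth_comb b d a oZ.
  rewrite -E dD; last exact: OF_tangentc.
  by move=> /esym/eqP; rewrite mulf_eq0 (negPf iC_neq0)/= => /eqP.
have d0 a : d a = 0.
  have [_ +] := dth_comb b d a oZ.
  rewrite -E dD; last exact: OF_tangent.
  by move=> /esym/eqP; rewrite mulf_eq0 oppr_eq0 (negPf iC_neq0)/= => /eqP.
apply/esym/eqP; rewrite -subr_eq0 E !big1 ?addr0// => a _.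
  by rewrite d0 scale0r.
by rewrite b0 scale0r.
Qed.

(** Removing the components of N along the frame makes d theta vanish against every Z_a and
    conj(Z_a); against the vector itself it vanishes by antisymmetry. *)
Lemma reeb_of_is_reeb Z N x : OF Z x -> tangentM x (N x) -> th x (N x) = 1 ->
  is_reeb x (reeb_of Z N x).
Proof.
move=> oZ tN N1.
pose b a := theta10 Z a x (N x); pose d a := theta01 Z a x (N x).
have [tb td] := tangent_comb b d oZ; have [hb hd] := th_comb b d oZ.
have tbd := tangentD tb td.
have L := ph_lin (x := x).
have E : reeb_of Z N x = N x - (\sum_a b a *: Z a x + \sum_a d a *: conjv (Z a x)).
  by rewrite /reeb_of opprD addrA.
have tT : tangentM x (reeb_of Z N x).
  by rewrite E; apply: tangentD => //; exact: tangentN.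
have T1 : th x (reeb_of Z N x) = 1.
  by rewrite E (lin_onB L tN tbd) (lin_onD L tb td) hb hd addr0 subr0.
have dZ a : dth x (reeb_of Z N x) (Z a x) = 0.
  rewrite E (lin_onB (dth_linl (OF_tangent a oZ)) tN tbd).
  have [_ ->] := dth_comb b d a oZ.
  by rewrite /d /theta01 mulrA mulNr mulii opprK mul1r subrr.
have dZc a : dth x (reeb_of Z N x) (conjv (Z a x)) = 0.
  rewrite E (lin_onB (dth_linl (OF_tangentc a oZ)) tN tbd).
  have [-> _] := dth_comb b d a oZ.
  by rewrite /b /theta10 mulrA mulrN mulii opprK mul1r subrr.
split => // w tw.
have n0 : th x (reeb_of Z N x) != 0 by rewrite T1 oner_eq0.
have [b' [d' [e' ->]]] := OF_spans oZ tT n0 tw.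
have [tb' td'] := tangent_comb b' d' oZ.
have LT := dth_linr tT.
have t1 a : tangentM x (Z a x) by exact: OF_tangent.
have t2 a : tangentM x (conjv (Z a x)) by exact: OF_tangentc.
rewrite (lin_onD LT); [|exact: tangentD|exact: tangentZ].
rewrite (lin_onD LT)// !(lin_on_sum _ _ LT); [|by move=> a; exact: tangentZ..].
rewrite (lin_onZ _ LT)// [X in _ + _ * X](_ : _ = 0); last first.
  have /eqP := dformC (ph_form x) tT tT.
  by rewrite -addr_eq0 -mulr2n mulrn_eq0/= => /eqP.
rewrite mulr0 addr0 !big1 ?addr0// => a _; rewrite (lin_onZ _ LT)//.
  by rewrite dZc mulr0.
by rewrite dZ mulr0.
Qed.

Lemma reeb_is_reeb Z x : OF Z x -> is_reeb x (T x).
Proof.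
move=> oZ; have [_ _ [v [tv _] v0] _] := ph x.
have L := ph_lin (x := x).
(* Only the value of this field at x enters, so a constant assignment is enough. *)
pose N : vfield R M := fun y => (th x v)^-1 *: v.
have tN : tangentM x (N x) by exact: tangentZ.
have N1 : th x (N x) = 1 by rewrite /N (lin_onZ _ L)// mulVf.
have rN := reeb_of_is_reeb oZ tN N1.
suff rr : real_tangent PM x (reeb_of Z N x).
  rewrite /reeb; case: xgetP => [t _ [[]]//|/(_ (reeb_of Z N x))[]].
  by case: rN.
have [tT T1 dT] := rN; split => //; apply: (is_reeb_uniq oZ _ rN).
split; first exact: tangent_conj.
  by rewrite ph_real// T1 conjc1.
move=> w tw; rewrite -[w]conjvK dth_conj//; last exact: tangent_conj.
by rewrite dT ?conjc0//; exact: tangent_conj.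
Qed.

(** [reeb] is defined by a pointwise choice. Near x uniqueness identifies it with [reeb_of Z N] for
    a normalised smooth N, which is visibly smooth. *)
Lemma reeb_field Z x : OF Z x -> field T x.
Proof.
move=> oZ; have [_ _ [v [tv _] v0] _] := ph x.
have [N0 fN0 N0v] := field_extend tv; subst v.
have sth := form_field (ph_form x) fN0.
pose N : vfield R M := fun y => (th y (N0 y))^-1 *: N0 y.
have fN : field N x by apply: fieldZ => //; exact: smoothV.
have fR : field (reeb_of Z N) x.
  apply: fieldB; first apply: fieldB => //.
    apply: field_sum => a; apply: fieldZ; last exact: OF_field.
    apply: smoothM; first exact: smooth_cst.
    apply: dform_smooth => //; [exact: ph_form|exact: OF_fieldc].
  apply: field_sum => a; apply: fieldZ; last exact: OF_fieldc.
  apply: smoothM; first exact: smooth_cst.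
  by apply: dform_smooth => //; [exact: ph_form|exact: OF_field].
apply: field_ext fR.
apply: filterS3 (OF_near oZ) (field_tangent_near fN0) (smooth_neq0 sth v0).
move=> y oy ty n0; apply: (is_reeb_uniq oy) (reeb_is_reeb oy).
apply: reeb_of_is_reeb => //; first exact: tangentZ.
by rewrite /N (lin_onZ _ (ph_lin (x := y)))// mulVf.
Qed.

Lemma OF_decomp Z x v : OF Z x -> tangentM x v ->
  v = \sum_a theta10 Z a x v *: Z a x + \sum_a theta01 Z a x v *: conjv (Z a x)
    + th x v *: T x.
Proof.
move=> oZ tv; have [tT T1 dT] := reeb_is_reeb oZ.
have n0 : th x (T x) != 0 by rewrite T1 oner_eq0.
have [b [d [e E]]] := OF_spans oZ tT n0 tv.
have [tb td] := tangent_comb b d oZ; have [hb hd] := th_comb b d oZ.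
have tbd := tangentD tb td; have tE := tangentZ e tT.
have L := ph_lin (x := x).
have eE : th x v = e.
  by rewrite E (lin_onD L tbd tE) (lin_onD L tb td) hb hd (lin_onZ _ L)// T1 !add0r mulr1.
have bE a : theta10 Z a x v = b a.
  rewrite /theta10 E (lin_onD (dth_linl (OF_tangentc a oZ)) tbd tE).
  have [-> _] := dth_comb b d a oZ.
  rewrite (lin_onZ _ (dth_linl (OF_tangentc a oZ)) tT) dT ?mulr0 ?addr0; last exact: OF_tangentc.
  by rewrite mulrA mulNr mulii opprK mul1r.
have dE a : theta01 Z a x v = d a.
  rewrite /theta01 E (lin_onD (dth_linl (OF_tangent a oZ)) tbd tE).
  have [_ ->] := dth_comb b d a oZ.
  rewrite (lin_onZ _ (dth_linl (OF_tangent a oZ)) tT) dT ?mulr0 ?addr0; last exact: OF_tangent.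
  by rewrite mulrA mulrN mulii opprK mul1r.
rewrite {1}E eE; congr (_ + _ + _).
  by apply: eq_bigr => a _; rewrite bE.
by apply: eq_bigr => a _; rewrite dE.
Qed.

Lemma T10_comb Z x (b : 'I_m -> C) : OF Z x -> T10 x (\sum_a b a *: Z a x).
Proof.
move=> oZ; apply: T10_sum => a; apply: T10Z.
exact: OF_T10.
Qed.

Lemma T01_comb Z x (b : 'I_m -> C) : OF Z x ->
  T01 T10 x (\sum_a b a *: conjv (Z a x)).
Proof.
move=> oZ; rewrite /T01/= conjv_sum; apply: T10_sum => a.
by rewrite conjvZ conjvK; apply: T10Z; exact: OF_T10.
Qed.

Lemma OF_pr10 Z x v : OF Z x -> tangentM x v ->
  pr10 T10 th x v = \sum_a theta10 Z a x v *: Z a x.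
Proof.
move=> oZ tv; rewrite {1}(OF_decomp oZ tv) pr10E//.
  exact: T10_comb.
exact: T01_comb.
Qed.

Lemma OF_pr01 Z x v : OF Z x -> tangentM x v ->
  pr01 T10 th x v = \sum_a theta01 Z a x v *: conjv (Z a x).
Proof.
move=> oZ tv; rewrite {1}(OF_decomp oZ tv) pr01E//.
  exact: T10_comb.
exact: T01_comb.
Qed.

Lemma levi10_comb Z x (b b' : 'I_m -> C) : OF Z x ->
  levi10 th x (\sum_a b a *: Z a x) (\sum_a b' a *: Z a x) =
  \sum_a b a * conjc (b' a).
Proof.
move=> oZ; rewrite /levi10 conjv_sum.
under [X in dform _ _ _ _ X]eq_bigr => a _ do rewrite conjvZ.
have [tb td] := tangent_comb b (fun a => conjc (b' a)) oZ.
have t1 a : tangentM x (Z a x) by exact: OF_tangent.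
have t2 a : tangentM x (conjv (Z a x)) by exact: OF_tangentc.
rewrite (lin_on_sum _ _ (dth_linr tb)); last by move=> a; exact: tangentZ.
rewrite mulr_sumr; apply: eq_bigr => a _.
rewrite (lin_onZ _ (dth_linr tb))//.
have := (dth_comb b (fun=> 0) a oZ).1.
rewrite [X in _ + X]big1 ?addr0 => [->|i _]; last by rewrite scale0r.
rewrite [conjc _ * _]mulrC !mulrA mulNr mulii opprK mul1r.
by [].
Qed.

Lemma conj_th01 Z x a v : OF Z x -> tangentM x v ->
  theta01 Z a x (conjv v) = conjc (theta10 Z a x v).
Proof.
move=> oZ tv; rewrite /theta01 /theta10 conjcM conjcN conj_iC opprK -dth_conj//.
  by rewrite conjvK.
exact: OF_tangentc.
Qed.

Lemma OF_levi_th Z x v w : OF Z x -> tangentM x v -> tangentM x w ->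
  levi T10 th x v w = \sum_a (theta10 Z a x v * conjc (theta10 Z a x w) +
                              theta01 Z a x v * conjc (theta01 Z a x w)).
Proof.
move=> oZ tv tw; rewrite /levi NumconjE !(OF_pr10 oZ)// !(OF_pr01 oZ)//.
rewrite levi10_comb// big_split/=; congr (_ + _).
have cc u : conjv (\sum_a theta01 Z a x u *: conjv (Z a x)) =
    \sum_a conjc (theta01 Z a x u) *: Z a x.
  by rewrite conjv_sum; apply: eq_bigr => a _; rewrite conjvZ conjvK.
rewrite !cc levi10_comb// conjc_sum; apply: eq_bigr => a _.
by rewrite conjcM !conjcK.
Qed.

Lemma OF_th10Z Z x a b : OF Z x -> theta10 Z a x (Z b x) = (b == a)%:R.
Proof.
by move=> oZ; rewrite /theta10 OF_dth// mulrA mulNr mulii opprK mul1r.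
Qed.

Lemma OF_th01Z Z x a b : OF Z x -> theta01 Z a x (Z b x) = 0.
Proof. by move=> oZ; rewrite /theta01 OF_dth10// mulr0. Qed.

Lemma OF_levi_Z Z x v b : OF Z x -> tangentM x v ->
  levi T10 th x v (Z b x) = theta10 Z b x v.
Proof.
move=> oZ tv; rewrite (OF_levi_th oZ tv (OF_tangent b oZ)) (bigD1 b)//=.
rewrite OF_th10Z// OF_th01Z// eqxx conjc1 conjc0 mulr1 mulr0 addr0.
rewrite big1 ?addr0// => a ab.
by rewrite OF_th10Z// OF_th01Z// eq_sym (negPf ab) conjc0 !mulr0 addr0.
Qed.

Lemma th10_pr10 Z x v a : OF Z x -> tangentM x v ->
  theta10 Z a x (pr10 T10 th x v) = theta10 Z a x v.
Proof.
move=> oZ tv; rewrite (OF_pr10 oZ tv)// {1}[theta10 Z a x (\sum_i _)]/theta10.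
have := (dth_comb (fun a => theta10 Z a x v) (fun=> 0) a oZ).1.
rewrite [X in _ + X]big1 ?addr0 => [->|i _]; last by rewrite scale0r.
by rewrite mulrA mulNr mulii opprK mul1r.
Qed.

Lemma th10_lin Z a x : OF Z x -> linear_on (tangentM x) (theta10 Z a x).
Proof.
move=> oZ k v w tv tw; rewrite /theta10 (dth_linl (OF_tangentc a oZ))//.
by rewrite mulrDr mulrCA.
Qed.

Lemma th10_smooth Z a x (Y : vfield R M) : OF Z x -> field Y x ->
  smooth (fun y => theta10 Z a y (Y y)) x.
Proof.
move=> oZ fY; apply: smoothM; first exact: smooth_cst.
by apply: dform_smooth => //; [exact: ph_form|exact: OF_fieldc].
Qed.

(** * Gram-Schmidt orthonormalisation for the Levi form *)

Hypothesis (pos : levi_positive T10 th).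

Lemma smooth_Re g x : smooth g x -> smooth (fun y => (complex.Re (g y))%:C) x.
Proof.
move=> gs; have := smoothM (@smooth_cst _ _ _ (2%:R^-1) x) (smoothD gs (smooth_conj gs)).
by apply: smooth_ext; apply: nearW => y; rewrite ReJ_add mulrC.
Qed.

Lemma levi10_smooth (U V : vfield R M) x : field U x -> field V x ->
  smooth (fun y => levi10 th y (U y) (V y)) x.
Proof.
move=> fU fV; apply: smoothM; first exact: smooth_cst.
by apply: dform_smooth => //; [exact: ph_form|exact: field_conj].
Qed.

Lemma smooth_if (b : bool) (g h : M -> C) x : smooth g x -> smooth h x ->
  smooth (fun y => if b then g y else h y) x.
Proof. by case: b. Qed.

Definition orthonormal_upto (k : nat) Z y := forall a b : 'I_m,
  (a < k)%N -> (b < k)%N -> levi10 th y (Z a y) (Z b y) = (a == b)%:R.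

(** Only the k-th vector changes: its projections on the earlier ones are subtracted and the rest is
    normalised, all with smooth coefficients. *)
Lemma gram_schmidt_step (k : 'I_m) Z x : local_frame T10 Z x ->
  (\forall y \near x, orthonormal_upto k Z y) ->
  exists2 Z', local_frame T10 Z' x & \forall y \near x, orthonormal_upto k.+1 Z' y.
Proof.
move=> lZ oZ.
(* The coefficients are cut off at a < k, so W subtracts earlier vectors only and Z_k occurs in W
   with coefficient 1. *)
pose l (a : 'I_m) y : C := if (a < k)%N then levi10 th y (Z k y) (Z a y) else 0.
have lk y : l k y = 0 by rewrite /l ltnn.
pose W y := Z k y - \sum_a l a y *: Z a y.
(* The real part is taken so that [powR] applies; by positivity it equals the Levi form of W. *)
pose r y := complex.Re (levi10 th y (W y) (W y)).
pose s y : R := r y `^ (- 2^-1).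
pose Z' (a : 'I_m) y := if a == k then (s y)%:C *: W y else Z a y.
have fZ a : field (Z a) x by have [/(_ a)[]] := lZ.
have ls a : smooth (l a) x.
  by apply: smooth_if; [exact: levi10_smooth|exact: smooth_cst].
have fW : field W x.
  by apply: fieldB => //; apply: field_sum => a; exact: fieldZ.
have rs : smooth (fun y => (r y)%:C) x by apply: smooth_Re; exact: levi10_smooth.
have good y : local_frame T10 Z y ->
    [/\ T10 y (W y), 0 < r y & (r y)%:C = levi10 th y (W y) (W y)].
  move=> [sZ /near_pointP/nbhs_singleton[iZ _]].
  have tZ a : T10 y (Z a y) by have [_ /near_pointP/nbhs_singleton] := sZ a.
  have tW : T10 y (W y).
    rewrite /W addrC -scaleN1r; apply: T10_lin => //.
    by apply: T10_sum => a; exact: T10Z.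
  have W0 : W y != 0.
    apply/eqP => W0.
    have : \sum_a ((a == k)%:R - l a y) *: Z a y = 0.
      under eq_bigr => a _ do rewrite scalerBl.
      rewrite sumrB; transitivity (W y) => //; congr (_ - _).
      rewrite (bigD1 k)//= eqxx scale1r big1 ?addr0// => a /negPf ->.
      by rewrite scale0r.
    move=> /iZ/(_ k); rewrite eqxx lk subr0 => /eqP.
    by rewrite oner_eq0.
  have := levi10_pos pos tW W0; rewrite ltcE/= => /andP[/eqP i0 r0].
  by split => //; apply: complex_eqP => //=; rewrite i0.
have [_ rx0 _] := good x lZ.
have ss : smooth (fun y => (s y)%:C) x by exact: smooth_powR.
have fZ' a : field (Z' a) x.
  rewrite /Z'; case: (a == k) => //; exact: fieldZ.
have s0 y : 0 < r y -> (s y)%:C != 0.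
  by move=> r0; rewrite (inj_eq (@complexI R)) gt_eqF// powR_gt0.
(* Triangular change of basis: freeness and spanning pass from Z to Z' by solving for the k-th
   coefficient. *)
have comb y (b : 'I_m -> C) : \sum_a b a *: Z' a y =
    \sum_a (if a == k then b k * (s y)%:C else b a - b k * (s y)%:C * l a y) *: Z a y.
  rewrite (bigD1 k)//= [RHS](bigD1 k)//= /Z' eqxx /W scalerA scalerBr.
  rewrite -addrA; congr (_ + _).
  rewrite [\sum_a l a y *: _](bigD1 k)//= lk scale0r add0r scaler_sumr -sumrN.
  rewrite -big_split/=; apply: eq_bigr => a /negPf ->.
  by rewrite scalerBl scalerA addrC.
have lZ' : local_frame T10 Z' x.
  split.
    move=> a; split; first exact: fZ'.
    apply/near_pointP; apply: filterS (local_frame_near lZ) => y ly.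
    have [tW _ _] := good y ly; rewrite /Z'; case: (a == k).
      exact: T10Z.
    by have [/(_ a)[_ /near_pointP/nbhs_singleton]] := ly.
  apply/near_pointP; apply: filterS (local_frame_near lZ) => y ly.
  have [tW r0 _] := good y ly; have sn0 := s0 y r0.
  have [_ /near_pointP/nbhs_singleton[iZ sp]] := ly.
  split=> [c|v /sp[c ->]].
    rewrite comb => /iZ H.
    have ck : c k = 0.
      have := H k; rewrite eqxx => /eqP; rewrite mulf_eq0 (negPf sn0) orbF.
      by move=> /eqP.
    move=> a; have := H a; have [->//|_] := eqVneq a k.
    by rewrite ck !mul0r subr0.
  exists (fun a => if a == k then c k / (s y)%:C else c a + c k * l a y).
  rewrite comb; apply: eq_bigr => a _; rewrite eqxx divfK//.
  by have [->//|_] := eqVneq a k; rewrite addrK.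
exists Z' => //.
apply: filterS2 (local_frame_near lZ) oZ => y ly oy.
have [tW r0 rE] := good y ly.
have [sZ _] := ly.
have tZ a : tangentM y (Z a y) by have [/field_tangent] := sZ a.
have TW := T10_tangent tW.
have W_orth (b : 'I_m) : (b < k)%N -> levi10 th y (W y) (Z b y) = 0.
  move=> bk; have L := levi10_linl (tZ b).
  rewrite (lin_onB L) ?(lin_on_sum _ _ L)//; last 2 first.
  - by move=> a; exact: tangentZ.
  - by apply: tangent_sum => a; exact: tangentZ.
  rewrite (bigD1 b)//= (lin_onZ _ L)// /l bk (oy b b bk bk) eqxx mulr1 big1 ?addr0 ?subrr//.
  move=> a ab; rewrite (lin_onZ _ L)//; case: ifP => ak; last by rewrite mul0r.
  by rewrite (oy a b ak bk) (negPf ab) mulr0.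
have Z'_orth (b : 'I_m) : (b < k)%N -> levi10 th y ((s y)%:C *: W y) (Z b y) = 0.
  by move=> bk; rewrite (lin_onZ _ (levi10_linl (tZ b)))// W_orth// mulr0.
have ltE (a : 'I_m) : (a < k.+1)%N -> a != k -> (a < k)%N.
  by rewrite ltnS leq_eqVlt => /orP[/eqP/val_inj ->|//]; rewrite eqxx.
have TsW : tangentM y ((s y)%:C *: W y) by exact: tangentZ.
move=> a b ak bk; rewrite /Z'.
have [/eqP ->|nak] := boolP (a == k); have [/eqP ->|nbk] := boolP (b == k).
- rewrite eqxx (lin_onZ _ (levi10_linl TsW))//.
  rewrite -(levi10_herm TsW TW) (lin_onZ _ (levi10_linl TW))// -rE.
  rewrite conjcM !conjc_real -!rmorphM /s.
  rewrite mulrA -powRD; last by apply/implyP => _; rewrite gt_eqF.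
  rewrite (_ : - 2^-1 + - 2^-1 = -1); last by field.
  by rewrite powR_inv1 ?ltW// mulVf// gt_eqF.
- by rewrite eq_sym (negPf nbk) Z'_orth// ltE.
- by rewrite (negPf nak) -(levi10_herm TsW (tZ a)) Z'_orth ?conjc0// ltE.
- by rewrite (oy a b) ?ltE.
Qed.

Lemma exists_orthonormal_frame x : exists Z, orthonormal_frame T10 th Z x.
Proof.
have H k : (k <= m)%N -> exists2 Z, local_frame T10 Z x &
    \forall y \near x, orthonormal_upto k Z y.
  elim: k => [_|k IH km].
    by have [_ /(_ x)[Z lZ] _] := aCR; exists Z => //; apply: nearW.
  have [Z lZ oZ] := IH (ltnW km).
  exact: (@gram_schmidt_step (Ordinal km) Z).
have [Z lZ oZ] := H m (leqnn m); exists Z; split => //.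
apply/near_pointP; apply: filterS2 (local_frame_near lZ) oZ => y ly oy a b.
have tZ c : T10 y (Z c y).
  by have [/(_ c)[_ /near_pointP/nbhs_singleton]] := ly.
by rewrite levi_T10// oy.
Qed.

(** * The trace of the Tanaka-Webster connection in terms of Lie brackets *)

Context {nabla : covd M}.
Hypothesis tw : tanaka_webster T10 th nabla.

Local Notation th10 := theta10.
Local Notation th01 := theta01.

Lemma nabla_T10 Z x v a : OF Z x -> tangentM x v -> T10 x (nabla x v (Z a)).
Proof.
by move=> oZ tv; case: tw => /(_ x)[H _ _ _ _] _ _ _; exact: H (OF_section a oZ).
Qed.

Lemma omegaE Z x v a b : OF Z x -> tangentM x v ->
  omega T10 th nabla Z a b x v = th10 Z b x (nabla x v (Z a)).
Proof.
move=> oZ tv; rewrite /omega OF_levi_Z//.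
exact/T10_tangent/nabla_T10.
Qed.

Lemma omega_form Z x a b : OF Z x -> form (omega T10 th nabla Z a b) x.
Proof.
move=> oZ.
have E : \forall y \near x, forall v, tangentM y v ->
    th10 Z b y (nabla y v (Z a)) = omega T10 th nabla Z a b y v.
  by apply: filterS (OF_near oZ) => y oy v tv; rewrite (omegaE a b oy tv).
have := tw => -[cov _ _ _].
apply: (form_ext E); split.
  apply/near_pointP; apply: filterS (OF_near oZ) => y oy k v w tv tw'.
  have [_ L _ _ _] := cov y.
  rewrite (L _ _ _ _ tv tw' (OF_section a oy)).
  by rewrite (th10_lin b oy)//; apply: T10_tangent; exact: nabla_T10.
move=> Y fY; apply: (th10_smooth b oZ (Y := fun y => nabla y (Y y) (Z a))).
by have [_ _ _ _ H] := cov x; exact: (H Y (Z a) fY (OF_section a oZ)).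
Qed.

(** The one quantity needed from the connection: the Ricci form is its exterior derivative, and A^W
    along the frame section is its negative. *)
Definition sigma Z x v : C := \sum_a omega T10 th nabla Z a a x v.

Lemma sigma_form Z x : OF Z x -> form (sigma Z) x.
Proof. by move=> oZ; apply: form_sum => a; exact: omega_form. Qed.

Lemma sigma_bar Z x b : OF Z x -> sigma Z x (conjv (Z b x)) =
  \sum_a th10 Z a x (lieM (fun y => conjv (Z b y)) (Z a) x).
Proof.
move=> oZ; apply: eq_bigr => a _; rewrite (omegaE a a oZ (OF_tangentc b oZ)).
have [_ _ H _] := tw.
rewrite (H x (Z a) (Z b) (OF_section a oZ) (OF_section b oZ)).
rewrite (th10_pr10 a oZ)//.
exact: lie_tangent (OF_fieldc b oZ) (OF_field a oZ).
Qed.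

Lemma sigma_reeb Z x : OF Z x -> sigma Z x (T x) =
  \sum_a th10 Z a x (lieM T (Z a) x).
Proof.
move=> oZ; have fT := reeb_field oZ.
apply: eq_bigr => a _; rewrite (omegaE a a oZ (field_tangent fT)).
have [_ H _ _] := tw; rewrite (H x (Z a) (OF_section a oZ)).
rewrite (th10_pr10 a oZ)//.
exact: lie_tangent fT (OF_field a oZ).
Qed.

(** Differentiating the constant L(Z_a, Z_a) = 1 along v gives it for each a. Thus the values on
    T_01 determine those on T_10. *)
Lemma sigma_conj Z x v : OF Z x -> tangentM x v ->
  sigma Z x v = - conjc (sigma Z x (conjv v)).
Proof.
move=> oZ tv; rewrite /sigma conjc_sum -sumrN; apply: eq_bigr => a _.
have [_ _ _ H] := tw; have sa := OF_section a oZ.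
have := H x v (Z a) (Z a) tv sa sa.
have tv' := tangent_conj tv.
have t1 : T10 x (nabla x v (Z a)) by exact: nabla_T10.
have t2 : T10 x (nabla x (conjv v) (Z a)) by exact: nabla_T10.
have tZ := OF_T10 a oZ.
rewrite (_ : v _ = 0).
  rewrite [levi _ _ _ (Z a x) _](levi_T10 tZ t2).
  rewrite -(levi10_herm (T10_tangent t2) (T10_tangent tZ)).
  by rewrite -(levi_T10 t2 tZ) => /esym/eqP; rewrite addr_eq0 => /eqP.
rewrite -(tangent_cst 1 tv); apply: (tangent_ext tv).
apply: filterS (OF_near oZ) => y oy.
by rewrite (levi_T10 (OF_T10 a oy) (OF_T10 a oy))
  (OF_levi a a oy) eqxx.
Qed.

Lemma sigma_Z Z x b : OF Z x -> sigma Z x (Z b x) =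
  - \sum_a th01 Z a x (lieM (Z b) (fun y => conjv (Z a y)) x).
Proof.
move=> oZ; rewrite (sigma_conj oZ (OF_tangent b oZ)).
congr (- _); rewrite (sigma_bar b oZ) conjc_sum; apply: eq_bigr => a _.
have fb := OF_fieldc b oZ; have fa := OF_field a oZ.
rewrite -(conj_th01 a oZ (lie_tangent fb fa)).
rewrite (lie_conj fb fa); congr (theta01 _ _ _ _); congr (lie _ _ _ _).
by apply/funext => y; rewrite conjvK.
Qed.

Lemma sigma_dform Z x v w : OF Z x -> tangentM x v -> tangentM x w ->
  ricci T10 th nabla Z x v w = dform PM (sigma Z) x v w.
Proof.
move=> oZ tv tw'; rewrite /ricci -(dform_sum _ (fun a => omega_form a a oZ) tv tw').
by [].
Qed.

(* d(d theta) = 0 on (Z_c, Z_b, conj Z_b). *)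
Lemma bracket_trace Z x b c : OF Z x ->
  th01 Z c x (lieM (Z b) (fun y => conjv (Z b y)) x) =
  th10 Z b x (lieM (Z c) (Z b) x) + th01 Z b x (lieM (Z c) (fun y => conjv (Z b y)) x).
Proof.
move=> oZ.
have fb := OF_field b oZ; have fc := OF_field c oZ; have fB := OF_fieldc b oZ.
have fth := ph_form x.
have key (Y W : vfield R M) k : field Y x -> field W x ->
    (\forall y \near x, th y (Y y) = k) -> (\forall y \near x, th y (W y) = 0) ->
    th x (lieM Y W x) = - dth x (Y x) (W x).
  move=> fY fW hY hW; rewrite (form_lie fth fY fW).
  have tY := field_tangent fY; have tW := field_tangent fW.
  rewrite (tangent_ext tY hW) (tangent_ext tW hY).
  by rewrite (tangent_f0 tY) (tangent_cst k tW) subrr sub0r.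
have thZ a : \forall y \near x, th y (Z a y) = 0.
  by apply: filterS (OF_near oZ) => y oy; exact: OF_th.
have thZc a : \forall y \near x, th y (conjv (Z a y)) = 0.
  by apply: filterS (OF_near oZ) => y oy; exact: OF_thc.
have nearlie (Y W : vfield R M) k : field Y x -> field W x ->
   (\forall y \near x, th y (Y y) = 0) -> (\forall y \near x, th y (W y) = 0) ->
   (\forall y \near x, dth y (Y y) (W y) = k) ->
   \forall y \near x, th y (lieM Y W y) = - k.
  move=> fY fW hY hW hk.
  apply: filterS3 (filterI (field_near fY) (field_near fW))
    (filterI (nbhs_interior hY) (nbhs_interior hW)) hk => y [fYy fWy] [hYy hWy] <-.
  have tY := field_tangent fYy; have tW := field_tangent fWy.
  rewrite (form_lie (ph_form y) fYy fWy).
  rewrite (tangent_ext tY hWy) (tangent_ext tW hYy).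
  by rewrite (tangent_f0 tY) (tangent_f0 tW) subrr sub0r.
(* Near x theta is constant on each inner bracket and 0 on each frame field, so theta of a double
   bracket is minus d theta of its two entries. *)
have J := jacobi fc fb fB; have := congr1 (th x) J.
have L := ph_lin (x := x).
have fbB := field_lie fb fB; have fcb := field_lie fc fb; have fcB := field_lie fc fB.
rewrite (lin_onD L); [|exact: lie_tangent|exact: lie_tangent].
have dthk : \forall y \near x, dth y (Z b y) (conjv (Z b y)) = iC.
  by apply: filterS (OF_near oZ) => y oy; rewrite (OF_dth b b oy) eqxx mulr1.
have dthcB : \forall y \near x, dth y (Z c y) (conjv (Z b y)) = iC * (c == b)%:R.
  by apply: filterS (OF_near oZ) => y oy; rewrite (OF_dth c b oy).
have dthcb : \forall y \near x, dth y (Z c y) (Z b y) = 0.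
  by apply: filterS (OF_near oZ) => y oy; rewrite (OF_dth10 c b oy).
have tbB := field_tangent fbB; have tcb := field_tangent fcb; have tcB := field_tangent fcB.
have tb := field_tangent fb; have tc := field_tangent fc; have tB := field_tangent fB.
rewrite (lieC (Z c)) (lin_onN L); last exact: lie_tangent.
rewrite (key _ _ _ fbB fc (nearlie _ _ _ fb fB (thZ b) (thZc b) dthk) (thZ c)).
rewrite (key _ _ _ fcb fB (nearlie _ _ _ fc fb (thZ c) (thZ b) dthcb) (thZc b)).
rewrite [lieM (Z b) (lieM _ _) x]lieC (lin_onN L); last exact: lie_tangent.
rewrite (key _ _ _ fcB fb (nearlie _ _ _ fc fB (thZ c) (thZc b) dthcB) (thZ b)).
rewrite !opprK => E.
rewrite /theta01 /theta10 E; ring.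
Qed.

End Pseudo_hermitian.

(** * The canonical circle bundle *)

Section Top_forms.
Context {R : realType} {m : nat} {M : manifold R (2 * m).+1}.
Local Notation C := R[i].
Local Notation PM := (mparams M).
Local Notation tangentM := (tangent PM).
Context {T10 : M -> set (tvec R M)}.
Hypotheses (m_gt0 : (0 < m)%N) (aCR : almost_CR T10)
  (pint : partially_integrable T10).
Implicit Types (x y : M) (u v : tvec R M) (Z : 'I_m -> vfield R M).
Implicit Types (tau G : mform M) (w : 'I_m.+1 -> tvec R M).

Local Notation upd w i v := (fun j => if j == i then v else w j).

Definition alternating_form x G : Prop :=
  [/\ forall w i, (forall j, tangentM x (w j)) ->
        linear_on (tangentM x) (fun v => G (upd w i v)),
      forall w i j, i != j -> w i = w j -> G w = 0 &
      forall w i, T01 T10 x (w i) -> G w = 0].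

Lemma Lambda_alternating x tau : Lambda T10 x tau -> alternating_form x tau.
Proof. by move=> [_ L A V]; split. Qed.

Lemma alternating_sub x G G' (c : C) : alternating_form x G -> alternating_form x G' ->
  alternating_form x (fun w => G w - c * G' w).
Proof.
move=> [L A V] [L' A' V']; split.
- move=> w i tw k u v tu tv; rewrite (L w i tw k u v tu tv) (L' w i tw k u v tu tv).
  by ring.
- by move=> w i j ij wij; rewrite (A _ _ _ ij wij) (A' _ _ _ ij wij) mulr0 subrr.
- by move=> w i wi; rewrite (V _ _ wi) (V' _ _ wi) mulr0 subrr.
Qed.

(** Polarization: expand the vanishing value of G with w_i + w_j in both places. *)
Lemma alternating_tperm x G w (i j : 'I_m.+1) : alternating_form x G ->
  (forall k, tangentM x (w k)) -> i != j ->
  G (fun k => w (tperm i j k)) = - G w.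
Proof.
move=> [L A _] tw ij.
pose W u v : 'I_m.+1 -> tvec R M := upd (upd w i u) j v.
have tW u : tangentM x u -> forall k, tangentM x (upd w i u k).
  by move=> tu k; case: ifP.
have Wr u v v' : tangentM x u -> tangentM x v -> tangentM x v' ->
    G (W u (v + v')) = G (W u v) + G (W u v').
  by move=> tu tv tv'; exact: (lin_onD (L _ j (tW u tu)) tv tv').
have Wl u u' v : tangentM x u -> tangentM x u' -> tangentM x v ->
    G (W (u + u') v) = G (W u v) + G (W u' v).
  move=> tu tu' tv.
  have sw a : W a v = upd (upd w j v) i a.
    apply/funext => k; rewrite /W; have [->|//] := eqVneq k j.
    by rewrite eq_sym (negPf ij).
  rewrite !sw; apply: (lin_onD (L _ i _) tu tu').
  by move=> k; case: ifP.
have W0 u : G (W u u) = 0.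
  by apply: (A _ i j ij); rewrite /W eqxx (negPf ij) eqxx.
have H : G (W (w j) (w i)) + G (W (w i) (w j)) = 0.
  have tt := tangentD (tw i) (tw j).
  have := W0 (w i + w j); rewrite Wl// !Wr// !W0 add0r addr0 => <-.
  by rewrite addrC.
have -> : (fun k => w (tperm i j k)) = W (w j) (w i).
  apply/funext => k; rewrite /W; have [->|kj] := eqVneq k j.
    by rewrite tpermR.
  have [->|ki] := eqVneq k i; first by rewrite tpermL.
  by rewrite tpermD// eq_sym.
have E : w = W (w i) (w j).
  apply/funext => k; rewrite /W; have [->//|_] := eqVneq k j.
  by have [->|] := eqVneq k i.
by rewrite [in RHS]E; apply/eqP; rewrite -addr_eq0 H.
Qed.

(** Only vanishing is followed through a product of transpositions, so signs need no bookkeeping. *)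
Lemma alternating_perm x G w (s : {perm 'I_m.+1}) : alternating_form x G ->
  (forall k, tangentM x (w k)) -> G w = 0 -> G (fun k => w (s k)) = 0.
Proof.
move=> aG tw Gw; have [ts -> dts] := prod_tpermP s.
elim: ts dts => [_|[i j] ts IH /= /andP[ij dts]].
  by rewrite big_nil -[RHS]Gw; congr G; apply/funext => k; rewrite perm1.
rewrite big_cons/=.
have -> : (fun k => w ((tperm i j * \prod_(t <- ts) tperm t.1 t.2)%g k)) =
    (fun k => (fun l => w ((\prod_(t <- ts) tperm t.1 t.2)%g l)) (tperm i j k)).
  by apply/funext => k; rewrite permM.
have := alternating_tperm
  (w := fun l => w ((\prod_(t <- ts) tperm t.1 t.2)%g l)) aG (fun k => tw _) ij.
by rewrite IH// oppr0.
Qed.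

Section Frame.
Context {th : form1 R M}.
Hypothesis ph : pseudo_hermitian T10 th.
Context {x : M} {Z : 'I_m -> vfield R M}.
Hypothesis oZ : orthonormal_frame T10 th Z x.
Local Notation T := (reeb th).
Local Notation th10 := (@theta10 R m M th).
Local Notation th01 := (@theta01 R m M th).

Definition frame_vec (i : 'I_m.+1) : tvec R M :=
  if unlift ord0 i is Some a then Z a x else T x.

Lemma frame_vec_tangent i : tangentM x (frame_vec i).
Proof.
rewrite /frame_vec; case: unliftP => [a _|_]; first exact: (OF_tangent a oZ).
by have [] := reeb_is_reeb m_gt0 aCR pint ph oZ.
Qed.

Lemma frame_vec0 : frame_vec ord0 = T x.
Proof. by rewrite /frame_vec unlift_none. Qed.

Lemma frame_vecS a : frame_vec (lift ord0 a) = Z a x.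
Proof. by rewrite /frame_vec liftK. Qed.

(** Insertion of T_01 vectors gives 0, so each entry counts only through its components on T and the
    Z_a. These are m + 1 vectors, and up to order they fill the m + 1 places in one way without
    repetition. *)
Lemma alternating_eq0 G : alternating_form x G -> G frame_vec = 0 ->
  forall w, (forall j, tangentM x (w j)) -> G w = 0.
Proof.
move=> aG G0; have [L A V] := aG.
have basis w : (forall j, exists k, w j = frame_vec k) -> G w = 0.
  move=> /fin_all_exists[k wk].
  have [/injectiveP kinj|/injectivePn[i [j ij kij]]] := boolP (injectiveb k).
    have := alternating_perm (perm kinj) aG frame_vec_tangent G0.
    rewrite -[X in _ -> X]/(G w = 0) => <-; congr G; apply/funext => j.
    by rewrite permE wk.
  by apply: (A _ _ _ ij); rewrite !wk kij.
(* Induction on r: the entries from position r on are already frame vectors, and the step expands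
   the entry at position r. *)
have H (r : nat) w : (forall j, tangentM x (w j)) ->
    (forall j : 'I_m.+1, (r <= j)%N -> exists k, w j = frame_vec k) -> G w = 0.
  elim: r w => [|r IH] w tw bw; first by apply: basis => j; exact: bw.
  have [rm|rm] := ltnP r m.+1; last first.
    by apply: IH => // j rj; have := ltn_ord j; rewrite ltnNge (leq_trans rm rj).
  pose i := Ordinal rm.
  have wE : w = upd w i (w i).
    by apply/funext => j; have [->|] := eqVneq j i.
  have Gi u : tangentM x u -> (exists k, u = frame_vec k) -> G (upd w i u) = 0.
    move=> tu uk; apply: IH => [j|j rj]; first by case: ifP.
    have [//|ji] := eqVneq j i; apply: bw.
    by rewrite ltn_neqAle rj andbT eq_sym; apply: contra_neq ji => jr; exact: val_inj.
  have Li := L w i tw.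
  have [t1 t2] := tangent_comb (fun a => th10 Z a x (w i)) (fun a => th01 Z a x (w i)) oZ.
  have tT : tangentM x (T x) by rewrite -frame_vec0; exact: frame_vec_tangent.
  have tZ a : tangentM x (Z a x) by exact: (OF_tangent a oZ).
  rewrite wE (OF_decomp m_gt0 aCR pint ph oZ (tw i)).
  rewrite (lin_onD Li (tangentD t1 t2) (tangentZ _ tT)) (lin_onD Li t1 t2).
  rewrite (lin_onZ _ Li tT) (Gi (T x) tT) ?mulr0 ?addr0; last first.
    by exists ord0; rewrite frame_vec0.
  have G01 : G (upd w i (\sum_a th01 Z a x (w i) *: conjv (Z a x))) = 0.
    by apply: (V _ i); rewrite eqxx; exact: (T01_comb m_gt0 aCR _ oZ).
  rewrite G01 addr0 (lin_on_sum _ _ Li); last by move=> a; exact: tangentZ.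
  rewrite big1// => a _; rewrite (lin_onZ _ Li (tZ a)) (Gi (Z a x)) ?mulr0//.
  by exists (lift ord0 a); rewrite frame_vecS.
by move=> w tw; apply: (H m.+1) => // j; rewrite leqNgt ltn_ord.
Qed.

Definition coef (i : 'I_m.+1) v : C :=
  if unlift ord0 i is Some a then th10 Z a x v else th x v.

Lemma coef_lin i : linear_on (tangentM x) (coef i).
Proof.
rewrite /coef; case: unliftP => [a _|_]; first exact: (th10_lin ph a oZ).
exact: (ph_lin ph).
Qed.

Lemma frame_mformE w : (forall j, tangentM x (w j)) ->
  frame_mform T10 th Z x w = \det (\matrix_(i, j) coef i (w j)).
Proof.
move=> tw; rewrite /frame_mform asboolT//; congr (\det _).
apply/matrixP => i j; rewrite !mxE /coef; case: unliftP => // a _.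
exact: (OF_levi_Z m_gt0 aCR pint ph a oZ).
Qed.

Lemma th10_T01 a v : T01 T10 x v -> th10 Z a x v = 0.
Proof.
move=> tv; have [[_ /near_pointP/nbhs_singleton[_ sp]] _] := oZ.
have [c E] := sp _ tv.
have -> : v = \sum_a conjc (c a) *: conjv (Z a x).
  rewrite -[LHS]conjvK E conjv_sum; apply: eq_bigr => b _.
  by rewrite conjvZ.
have := (dth_comb m_gt0 aCR pint ph (fun=> 0) (fun a => conjc (c a)) a oZ).1.
rewrite [X in X + _]big1 ?add0r => [|b _]; last by rewrite scale0r.
by rewrite /theta10 => ->; rewrite !mulr0.
Qed.

Lemma frame_mform_Lambda : Lambda T10 x (frame_mform T10 th Z x).
Proof.
split.
- move=> w i nt; rewrite /frame_mform asboolF// => tw; exact: nt.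
- move=> w i tw.
  suff H : linear_on (tangentM x) (fun v => frame_mform T10 th Z x (upd w i v)).
    exact: H.
  move=> k u v tu tv.
  have tupd u' : tangentM x u' -> forall j, tangentM x (upd w i u' j).
    by move=> tu' j; case: ifP.
  rewrite (frame_mformE (tupd _ (tangent_lin k tu tv))).
  rewrite (frame_mformE (tupd _ tu)) (frame_mformE (tupd _ tv)).
  rewrite -!(det_tr (\matrix_(_, _) _)) -[X in _ = _ + X]mul1r.
  apply: (determinant_multilinear (i0 := i)).
  + apply/rowP => j; rewrite !mxE eqxx mul1r.
    by rewrite (coef_lin j)// -/(coef j _).
  + apply/matrixP => a b; rewrite !mxE; case: eqP => // /esym/eqP.
    by rewrite (negPf (neq_lift _ _)).
  + apply/matrixP => a b; rewrite !mxE; case: eqP => // /esym/eqP.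
    by rewrite (negPf (neq_lift _ _)).
- move=> w i j ij wij; have [tw|tw] := pselect (forall j, tangentM x (w j)).
    rewrite frame_mformE// -det_tr; apply: (determinant_alternate ij) => k.
    by rewrite !mxE wij.
  by rewrite /frame_mform asboolF.
- move=> w i wi; have [tw|tw] := pselect (forall j, tangentM x (w j)).
    rewrite frame_mformE// (expand_det_col _ i) big1// => k _.
    rewrite mxE /coef; case: unliftP => [a _|_].
      by rewrite th10_T01// mul0r.
    by rewrite (th_T01 m_gt0 aCR ph wi) mul0r.
  by rewrite /frame_mform asboolF.
Qed.

Lemma frame_mform1 : frame_mform T10 th Z x frame_vec = 1.
Proof.
rewrite (frame_mformE frame_vec_tangent) -(det1 _ m.+1); congr (\det _).
have [tT T1 dT] := reeb_is_reeb m_gt0 aCR pint ph oZ.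
apply/matrixP => i j; rewrite !mxE /coef /frame_vec.
case: (unliftP ord0 i) => [a ->|->]; case: (unliftP ord0 j) => [b ->|->].
- by rewrite (OF_th10Z m_gt0 aCR ph a b oZ) (inj_eq lift_inj) eq_sym.
- rewrite /theta10 dT ?mulr0; last exact: (OF_tangentc a oZ).
  by rewrite eq_sym (negPf (neq_lift _ _)).
- by rewrite (OF_th m_gt0 aCR ph b oZ) (negPf (neq_lift _ _)).
- by rewrite T1 eqxx.
Qed.

(** Lambda is a complex line: the difference of the two sides vanishes on the frame, hence on all
    tangent tuples; on other tuples both are 0 by convention. *)
Lemma LambdaE tau : Lambda T10 x tau ->
  tau = tau frame_vec *: frame_mform T10 th Z x.
Proof.
move=> lt; apply/funext => w; have [tw|tw] := pselect (forall j, tangentM x (w j)).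
  have aG := alternating_sub (tau frame_vec) (Lambda_alternating lt)
    (Lambda_alternating frame_mform_Lambda).
  have := alternating_eq0 aG _ tw; rewrite frame_mform1 mulr1 subrr => /(_ erefl)/eqP.
  by rewrite subr_eq0 => /eqP.
have [H _ _ _] := lt; have /existsNP[j nj] := tw.
rewrite (H w j nj) -[_ w]/(_ * frame_mform T10 th Z x w).
by rewrite /frame_mform asboolF// mulr0.
Qed.

End Frame.
End Top_forms.

(** * Local sections of F_c given by orthonormal frames *)

Section Rays.
Context {R : realType} {m : nat} {M : manifold R (2 * m).+1}.
Local Notation C := R[i].
Local Notation PM := (mparams M).
Local Notation smooth := (smooth_at PM).
Context {T10 : M -> set (tvec R M)}.
Hypotheses (m_gt0 : (0 < m)%N) (aCR : almost_CR T10)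
  (pint : partially_integrable T10).
Context {th : form1 R M}.
Hypothesis ph : pseudo_hermitian T10 th.
Implicit Types (x y : M) (u v : tvec R M) (Z : 'I_m -> vfield R M).
Implicit Types (tau : mform M).
Local Notation OF := (orthonormal_frame T10 th).
Local Notation T := (reeb th).

Lemma ray_scale tau (r : R) : 0 < r -> ray (r%:C *: tau) = ray tau.
Proof.
move=> r0; apply/seteqP; split => [_ [k /= k0 <-]|_ [k /= k0 <-]].
  exists (k * r); first exact: mulr_gt0.
  by rewrite scalerA rmorphM.
exists (k / r); first exact: divr_gt0.
by rewrite scalerA -rmorphM/= divfK// gt_eqF.
Qed.

Lemma act_ray x tau (z : C) : act (x, ray tau) z = (x, ray (z *: tau)).
Proof.
congr pair; apply/seteqP; split => [_ [_ [k /= k0 <-] <-]|_ [k /= k0 <-]].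
  by exists k => //; rewrite !scalerA mulrC.
by exists (k%:C *: tau); [exists k|rewrite !scalerA mulrC].
Qed.

Lemma cisD (s t : R) : cis (s + t) = cis s * cis t.
Proof.
apply: complex_eqP; rewrite ?ReM ?ImM /cis/=; first by rewrite cosD.
by rewrite sinD addrC.
Qed.

Lemma cis_neq0 (t : R) : cis t != 0.
Proof.
apply/eqP => /(congr1 (fun z => z * cis (- t))); rewrite mul0r -cisD subrr.
by rewrite /cis cos0 sin0 => -[/eqP]; rewrite oner_eq0.
Qed.

Lemma act_act (q : Fpoint M) (z z' : C) : act (act q z) z' = act q (z' * z).
Proof.
congr pair; apply/seteqP; split => [_ [_ [k kq <-] <-]|_ [k kq <-]].
  by exists k => //; rewrite scalerA.
by exists (z *: k); [exists k|rewrite scalerA].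
Qed.

(** The factor is the value of the new form on the old frame, a determinant. The new coframe may be
    non-zero on T, which fills the first column below the diagonal; the matrix is still triangular.
    This covers both a rotation of the frame and a change of theta. *)
Lemma frame_mform_triangular th1 Z1 Z x : pseudo_hermitian T10 th1 ->
  orthonormal_frame T10 th1 Z1 x -> OF Z x ->
  (forall a b, a != b -> theta10 (th := th1) Z1 a x (Z b x) = 0) ->
  (forall b, th1 x (Z b x) = 0) ->
  frame_mform T10 th1 Z1 x =
    (th1 x (T x) * \prod_a theta10 (th := th1) Z1 a x (Z a x)) *:
      frame_mform T10 th Z x.
Proof.
move=> ph1 o1 oZ H1 H2.
rewrite {1}(LambdaE m_gt0 aCR pint ph oZ (frame_mform_Lambda m_gt0 aCR pint ph1 o1)).
congr (_ *: _).
rewrite (frame_mformE m_gt0 aCR pint ph1 o1); last first.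
  exact: (frame_vec_tangent m_gt0 aCR pint ph oZ).
rewrite det_trig; last first.
  apply/is_trig_mxP => i j; rewrite mxE /coef /frame_vec.
  case: (unliftP ord0 j) => [b ->|->]; last by rewrite ltn0.
  case: (unliftP ord0 i) => [a ->|->] ij; last exact: H2.
  by apply: H1; rewrite neq_ltn -ltnS -[X in _ || X]ltnS; rewrite ij.
rewrite big_ord_recl mxE /coef /frame_vec unlift_none; congr (_ * _).
by apply: eq_bigr => a _; rewrite mxE liftK.
Qed.

(** One frame vector is multiplied by the phase mu; its dual form, and with it the determinant,
    acquires conj(mu). *)
Lemma rotate_frame Z x (mu : M -> C) : OF Z x -> smooth mu x ->
  (\forall y \near x, mu y * conjc (mu y) = 1) ->
  exists2 Z', OF Z' x & \forall y \near x,
    frame_mform T10 th Z' y = conjc (mu y) *: frame_mform T10 th Z y.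
Proof.
move=> oZ smu mu1; pose a0 := Ordinal m_gt0.
pose k (a : 'I_m) y : C := if a == a0 then mu y else 1.
pose Z' a y := k a y *: Z a y.
have ks a : smooth (k a) x by apply: smooth_if => //; exact: smooth_cst.
have k1 y : mu y * conjc (mu y) = 1 -> forall a, k a y * conjc (k a y) = 1.
  by move=> H a; rewrite /k; case: ifP; rewrite ?conjc1 ?mulr1.
have oZ' : OF Z' x.
  split.
    apply: (local_frame_scale m_gt0 aCR ks); last by case: oZ.
    apply: filterS mu1 => y /k1 H a; apply/eqP => k0.
    by have := H a; rewrite k0 mul0r => /esym/eqP; rewrite oner_eq0.
  apply/near_pointP; apply: filterS2 mu1 (OF_near oZ) => y /k1 H oy a b.
  have ta := T10Z m_gt0 aCR (k a y) (OF_T10 a oy).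
  have tb := T10Z m_gt0 aCR (k b y) (OF_T10 b oy).
  have Ta := OF_tangent a oy; have Tb := OF_tangent b oy.
  rewrite (levi_T10 m_gt0 aCR ph ta tb).
  rewrite (lin_onZ _ (levi10_linl ph (T10_tangent aCR tb)) Ta).
  rewrite -(levi10_herm ph (T10_tangent aCR tb) Ta).
  rewrite (lin_onZ _ (levi10_linl ph Ta) Tb) (OF_levi m_gt0 aCR ph b a oy).
  rewrite conjcM conjc_nat; have [/eqP ->|ba] := boolP (b == a).
    by rewrite mulr1 H eqxx.
  by rewrite eq_sym (negPf ba) !mulr0.
exists Z' => //; apply: filterS3 mu1 (OF_near oZ) (OF_near oZ') => y mu1y oy oy'.
have th10'Z a b : theta10 (th := th) Z' a y (Z b y) = conjc (k a y) * (b == a)%:R.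
  rewrite /theta10 /Z' conjvZ.
  rewrite (lin_onZ _ (dth_linr ph (OF_tangent b oy)) (OF_tangentc a oy)).
  rewrite (OF_dth m_gt0 aCR ph b a oy) mulrCA; congr (_ * _).
  by rewrite mulrA mulNr mulii opprK mul1r.
rewrite (frame_mform_triangular ph oy' oy).
- have [_ T1 _] := reeb_is_reeb m_gt0 aCR pint ph oy.
  under eq_bigr => a _ do rewrite th10'Z eqxx mulr1.
  rewrite T1 mul1r (bigD1 a0)//= /k eqxx big1 ?mulr1// => a /negPf ->.
  exact: conjc1.
- by move=> a b ab; rewrite th10'Z eq_sym (negPf ab) mulr0.
- by move=> b; exact: (OF_th m_gt0 aCR ph b oy).
Qed.

(** By [LambdaE], z tau is k times the form of some orthonormal frame. Rotating that frame absorbs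
    the phase of k, and the modulus of k does not affect the ray. *)
Lemma frame_of_section (pos : levi_positive T10 th) x (tau : M -> mform M) (z : C) :
  z != 0 -> (\forall y \near x, Lambda T10 y (tau y) /\ tau y <> 0) ->
  smooth_mform tau x ->
  exists2 Z, OF Z x & \forall y \near x,
    ray (frame_mform T10 th Z y) = ray (z *: tau y).
Proof.
move=> z0 lt st; have [Z0 oZ] := exists_orthonormal_frame m_gt0 aCR ph pos x.
pose Y (i : 'I_m.+1) : vfield R M := if unlift ord0 i is Some a then Z0 a else T.
have fY i : smooth_field PM (Y i) x.
  rewrite /Y; case: unliftP => [a _|_]; first exact: (OF_field a oZ).
  exact: (reeb_field m_gt0 aCR pint ph oZ).
pose k y := z * tau y (fun i => Y i y).
have sk : smooth k x := smoothM (@smooth_cst _ _ _ z x) (st Y fY).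
have YE y : (fun i => Y i y) = frame_vec (th := th) (x := y) (Z := Z0).
  by apply/funext => i; rewrite /Y /frame_vec; case: unliftP.
have kE y : OF Z0 y -> Lambda T10 y (tau y) ->
    z *: tau y = k y *: frame_mform T10 th Z0 y.
  move=> oy ly; rewrite {1}(LambdaE m_gt0 aCR pint ph oy ly) scalerA /k.
  by rewrite YE.
have k0 y : OF Z0 y -> Lambda T10 y (tau y) -> tau y <> 0 -> k y != 0.
  move=> oy ly t0; apply/eqP => ky; apply: t0.
  have := kE y oy ly; rewrite ky scale0r => /eqP; rewrite scaler_eq0 (negPf z0)/=.
  by move=> /eqP.
have k0N : \forall y \near x, k y != 0.
  by apply: filterS2 (OF_near oZ) lt => y oy [ly t0]; exact: k0.
pose n2 y := complex.Re (k y * conjc (k y)).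
have n2E y : (n2 y)%:C = k y * conjc (k y).
  by apply: complex_eqP => //=; rewrite ImM Reconj Imconj; ring.
have n20 y : k y != 0 -> 0 < n2 y.
  move=> ky; rewrite -(ltcR 0) n2E lt_def mulcJ_ge0 andbT.
  by rewrite mulf_neq0// conjc_eq0.
pose nu y := n2 y `^ (- 2^-1).
have snu : smooth (fun y => (nu y)%:C) x.
  apply: smooth_powR; last by apply: n20; exact: nbhs_singleton k0N.
  apply: smooth_ext (smoothM sk (smooth_conj sk)).
  by apply: nearW => y; rewrite n2E.
(* mu = conj(k)/|k|, so the rotated frame has the form k/|k| times the old one, a positive multiple
   of z tau. *)
pose mu y := conjc (k y) * (nu y)%:C.
have smu : smooth mu x := smoothM (smooth_conj sk) snu.
have mu1 : \forall y \near x, mu y * conjc (mu y) = 1.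
  apply: filterS k0N => y /n20 n2y.
  rewrite /mu conjcM conjcK conjc_real mulrACA -(mulrC (k y)) -n2E -!rmorphM/=.
  rewrite /nu -powRD; last by apply/implyP => _; rewrite gt_eqF.
  rewrite (_ : - 2^-1 + - 2^-1 = -1); last by field.
  by rewrite powR_inv1 ?ltW// mulfV// gt_eqF.
have [Z oZ' ZE] := rotate_frame oZ smu mu1; exists Z => //.
apply: (@filterS3 _ (nbhs x) (nbhs_filter x) _ _ _ _ _ ZE lt (filterI (OF_near oZ) k0N)).
move=> y -> [ly _] [oy ky].
rewrite (kE y oy ly) /mu conjcM conjcK conjc_real mulrC -scalerA.
by apply: ray_scale; rewrite powR_gt0// n20.
Qed.

End Rays.

(** * Coordinates (t, u): slices of constant t and the projection to u *)

Section Slices.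
Context {R : realType} {d : nat}.
Local Notation C := R[i].
Local Notation e_ j := (delta_mx 0 j).
Implicit Types (u : 'rV[R]_d) (w : 'rV[R]_d.+1) (t : R).

Definition glue t u : 'rV[R]_d.+1 :=
  \row_i (if unlift ord0 i is Some j then u 0 j else t).

Lemma tail_glue t u : tail (glue t u) = u.
Proof. by apply/rowP => j; rewrite !mxE liftK. Qed.

Lemma glue0 t u : glue t u 0 0 = t.
Proof. by rewrite mxE unlift_none. Qed.

Lemma glue_tail w : glue (w 0 0) (tail w) = w.
Proof.
by apply/rowP => i; rewrite mxE; case: unliftP => [j ->|->//]; rewrite mxE.
Qed.

Lemma Cnear_glue (h : 'rV[R]_d.+1 -> C) t u :
  Cinfty_near h (glue t u) -> Cinfty_near (h \o glue t) u.
Proof.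
apply: (Cnear_comp openT) => // i; rewrite /glue.
case: (unliftP ord0 i) => [j ->|->].
  rewrite [X in Cinfty_on _ X](_ : _ = fun u : 'rV[R]_d => u 0 j).
    exact: Cinfty_on_coord openT.
  by apply/funext => v; rewrite mxE liftK.
rewrite [X in Cinfty_on _ X](_ : _ = fun=> t).
  by move=> k; exact: Ck_on_cst openT.
by apply/funext => v; rewrite mxE unlift_none.
Qed.

Lemma Cnear_tail (h : 'rV[R]_d -> C) w :
  Cinfty_near h (tail w) -> Cinfty_near (h \o @tail R d) w.
Proof.
move=> hw; apply: (@Cnear_comp R d d.+1 setT h (@tail R d) w openT I _ hw) => i.
rewrite [X in Cinfty_on _ X](_ : _ = fun w : 'rV[R]_d.+1 => w 0 (lift ord0 i)).
  exact: Cinfty_on_coord openT.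
by apply/funext => v; rewrite mxE.
Qed.

(** A directional derivative depends only on the restriction to a line, which compares functions on
    spaces of different dimension. *)
Lemma derive_along (h : 'rV[R]_d.+1 -> R) (h' : 'rV[R]_d -> R) v v' w u :
  (forall s : R, h (s *: v + w) = h' (s *: v' + u)) -> 'D_v h w = 'D_v' h' u.
Proof.
move=> E; have E0 : h w = h' u by have := E 0; rewrite !scale0r !add0r.
rewrite /derive; apply: (congr1 (fun k : R -> R => lim (k @ (0 : R)^'))).
by apply/funext => s /=; rewrite E E0.
Qed.

Lemma cpartial_along (h : 'rV[R]_d.+1 -> C) (h' : 'rV[R]_d -> C) i j w u :
  (forall s : R, h (s *: e_ i + w) = h' (s *: e_ j + u)) ->
  cpartial h i w = cpartial h' j u.
Proof.
by move=> E; rewrite /cpartial; congr (_ +i* _); apply: derive_along => s; rewrite E.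
Qed.

Lemma cpartial_glue (h : 'rV[R]_d.+1 -> C) j t u :
  cpartial h (lift ord0 j) (glue t u) = cpartial (h \o glue t) j u.
Proof.
apply: cpartial_along => s /=; congr h; apply/rowP => i; rewrite !mxE.
case: unliftP => [k ->|->]; first by rewrite !mxE (inj_eq lift_inj).
by rewrite (negPf (neq_lift _ _)) andbF mulr0 add0r.
Qed.

Lemma cpartial_tail (h : 'rV[R]_d -> C) j w :
  cpartial (h \o @tail R d) (lift ord0 j) w = cpartial h j (tail w).
Proof.
rewrite -{1}(glue_tail w) cpartial_glue; congr cpartial.
by apply/funext => u; rewrite /= tail_glue.
Qed.

Lemma cpartial_tail0 (h : 'rV[R]_d -> C) w : cpartial (h \o @tail R d) ord0 w = 0.
Proof.
rewrite -(cpartial_cst 0 ord0 w) /cpartial.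
have E (g : 'rV[R]_d -> R) : 'D_(e_ ord0) (g \o @tail R d) w = 0.
  rewrite -(derive_cst (V := 'rV[R]_d.+1) (0 : R) w (e_ ord0)) /derive.
  apply: (congr1 (fun k : R -> R => lim (k @ (0 : R)^'))); apply/funext => s /=.
  rewrite (_ : tail _ = tail w).
    by rewrite subrr subrr.
  by apply/rowP => j; rewrite !mxE eq_sym (negPf (neq_lift _ _)) mulr0 add0r.
rewrite derive_cst; congr (_ +i* _); first exact: (E (fun u => complex.Re (h u))).
exact: (E (fun u => complex.Im (h u))).
Qed.

End Slices.

(** * Tangent vectors of F_c in a local parametrization *)

Section Circle_bundle.
Context {R : realType} {m : nat} {M : manifold R (2 * m).+1}.
Local Notation C := R[i].
Local Notation PM := (mparams M).
Local Notation smooth := (smooth_at PM).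
Local Notation tangentM := (tangent PM).
Context {T10 : M -> set (tvec R M)}.
Local Notation PF := (Fparams T10).
Local Notation Fproj := (@Fproj R m M).
Local Notation dFproj := (@dFproj R m M).
Implicit Types (x y : M) (q : Fpoint M).

Lemma conjv_dFproj q (v : tvec R (Fpoint M)) : conjv v = v ->
  conjv (dFproj q v) = dFproj q v.
Proof.
move=> vr; apply/funext => g; rewrite /conjv /dFproj /Defs.pushforward.
have [gs|gs] := pselect (smooth g (Fproj q)); last first.
  rewrite !asboolF ?conjc0//.
  by move=> /smooth_conjP.
rewrite !asboolT//; last exact: smooth_conj.
by rewrite -[in RHS]vr.
Qed.

Section At_point.
Context {c : chart R (2 * m).+1 M} {U : set M} {tau : M -> mform M}.
Context {w0 : 'rV[R]_(2 * m).+2}.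
Hypotheses (ca : atlas c) (Uo : open U) (HU : forall x, U x ->
  [/\ Lambda T10 x (tau x), tau x <> 0 & smooth_mform tau x]).
Hypotheses (cw : chart_img c (tail w0)) (Uw : U (chart_inv c (tail w0))).
Local Notation psi := (fun w : 'rV[R]_(2 * m).+2 =>
  let x := chart_inv c (tail w) in act (x, ray (tau x)) (cis (w 0 0))).
Local Notation V := [set w : 'rV[R]_(2 * m).+2 |
  chart_img c (tail w) /\ U (chart_inv c (tail w))].
Local Notation x0 := (chart_inv c (tail w0)).
Local Notation q := (psi w0).
Context {s : M -> Fpoint M}.
Hypothesis s_near : \forall y \near x0,
  s y = psi (glue (w0 0 0) (chart_map c y)).

Let PV : PF (V, psi). Proof. by exists c, U, tau. Qed.
Let Vw : V w0. Proof. by []. Qed.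
Let cx0 : chart_dom c x0.
Proof. by have [_ _ /(_ _ cw)[]] := atlas_chart ca. Qed.
Let mx0 : chart_map c x0 = tail w0.
Proof. by have [_ _ /(_ _ cw)[]] := atlas_chart ca. Qed.
Let sx0 : s x0 = q.
Proof. by have := nbhs_singleton s_near; rewrite mx0 glue_tail. Qed.

(** In the parametrization the section s is the slice of constant t through [w0]. *)
Lemma section_near (g : Fpoint M -> C) : \forall u \near tail w0,
  (g \o s \o chart_inv c) u = ((g \o psi) \o glue (w0 0 0)) u.
Proof.
rewrite -mx0; have [[_ Io] _ ci _ _] := atlas_chart ca.
have I : \forall u \near chart_map c x0, chart_img c u.
  by rewrite mx0; exact: open_nbhs_nbhs.
apply: filterS2 I (near_inv ca cx0 s_near) => u cu E.
by rewrite [LHS]/= E; have [_ ->] := ci _ cu.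
Qed.

Lemma smooth_section (g : Fpoint M -> C) :
  smooth_at PF g q -> smooth (g \o s) x0.
Proof.
move=> gs; apply/(smooth_atP _ ca cx0).
have H : Cinfty_near (g \o psi) (glue (w0 0 0) (tail w0)).
  by rewrite glue_tail; exact: gs _ _ _ PV Vw erefl.
rewrite mx0; apply: Cnear_ext (Cnear_glue H).
by apply: filterS (section_near g) => u ->.
Qed.

Lemma smooth_Fproj (g : M -> C) : smooth g x0 -> smooth_at PF (g \o Fproj) q.
Proof.
move=> gs V' psi' w' [c' [U' [tau' [ca' _ _ [-> ->]]]]] [/= cw' _] E.
have xE : chart_inv c' (tail w') = x0 by have := congr1 fst E.
have [_ _ /(_ _ cw')[cd' cm'] _ _] := atlas_chart ca'.
apply: (@Cnear_tail _ _ (g \o chart_inv c')).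
by rewrite -cm'; apply/(smooth_atP _ ca' cd'); rewrite xE.
Qed.

Context {v : tvec R (Fpoint M)} {a : 'I_(2 * m).+2 -> C}.
Hypothesis vE : forall g, v g = if `[< smooth_at PF g q >]
  then \sum_j a j * cpartial (g \o psi) j w0 else 0.

(** Functions pulled back from M do not depend on t, so the t-component drops out. *)
Lemma dFprojE : dFproj q v = \sum_j a (lift ord0 j) *: dvec c j x0.
Proof.
apply/funext => g; rewrite tv_sum /dFproj /Defs.pushforward -[Fproj q]/x0.
case: asboolP => gs; last first.
  by rewrite big1// => j _; rewrite tvZ dvec_nsmooth// mulr0.
rewrite vE asboolT; last exact: smooth_Fproj.
rewrite big_ord_recl -[_ \o psi]/((g \o chart_inv c) \o @tail R _).
rewrite cpartial_tail0 mulr0 add0r; apply: eq_bigr => j _.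
by rewrite tvZ dvecE// cpartial_tail mx0.
Qed.

Lemma tangent_dFproj : tangentM x0 (dFproj q v).
Proof. by apply/(tangentP _ ca cx0); rewrite dFprojE; exists (fun j => a (lift ord0 j)). Qed.

Lemma pushforward_sectionE : Defs.pushforward PF s x0 (dFproj q v) = fun g =>
  if `[< smooth_at PF g q >]
  then \sum_j (if unlift ord0 j is Some k then a (lift ord0 k) else 0) *
    cpartial (g \o psi) j w0 else 0.
Proof.
apply/funext => g; rewrite /Defs.pushforward sx0; case: asboolP => // gs.
rewrite dFprojE tv_sum [RHS]big_ord_recl unlift_none mul0r add0r.
apply: eq_bigr => j _; rewrite tvZ liftK dvecE; last exact: smooth_section.
rewrite mx0 (cpartial_ext _ (section_near g)) -cpartial_glue.
by rewrite glue_tail.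
Qed.

(** In the parametrization the circle acts by translation of t. *)
Lemma fundamentalE : fundamental T10 q = fun g =>
  if `[< smooth_at PF g q >]
  then \sum_j (j == ord0)%:R * cpartial (g \o psi) j w0 else 0.
Proof.
apply/funext => g; rewrite /fundamental; case: asboolP => // gs.
rewrite (bigD1 ord0)//= mulr1n mul1r big1 ?addr0 => [|j /negPf ->]; last first.
  by rewrite mul0r.
have E t : act q (cis t) = psi (t *: delta_mx 0 ord0 + w0).
  rewrite act_act -cisD /= (_ : tail _ = tail w0).
    by rewrite !mxE !eqxx mulr1.
  by apply/rowP => j; rewrite !mxE eq_sym (negPf (neq_lift _ _)) mulr0 add0r.
rewrite /cpartial; congr (_ +i* _); rewrite /derive1 /derive.
  apply: (congr1 (fun k : R -> R => lim (k @ (0 : R)^'))); apply/funext => t /=; rewrite addr0.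
  by rewrite E [act q _]E scale0r add0r.
apply: (congr1 (fun k : R -> R => lim (k @ (0 : R)^'))); apply/funext => t /=; rewrite addr0.
by rewrite E [act q _]E scale0r add0r.
Qed.

Lemma tangent_pushforward : tangent PF q (Defs.pushforward PF s x0 (dFproj q v)).
Proof. by rewrite pushforward_sectionE; exists V, psi, w0; eexists; split. Qed.

Lemma tangent_fundamental : tangent PF q (fundamental T10 q).
Proof. by rewrite fundamentalE; exists V, psi, w0; eexists; split. Qed.

(** The t-component is vertical, and the remaining components are tangent to the slice, which is the
    image of s. *)
Lemma Fc_tangentE :
  v = a ord0 *: fundamental T10 q + Defs.pushforward PF s x0 (dFproj q v).
Proof.
apply/funext => g.
rewrite -[RHS]/(a ord0 * fundamental T10 q g + Defs.pushforward PF s x0 (dFproj q v) g).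
rewrite fundamentalE pushforward_sectionE vE.
case: asboolP => gs; last by rewrite mulr0 addr0.
rewrite mulr_sumr -big_split/=; apply: eq_bigr => j _.
case: (unliftP ord0 j) => [k ->|->].
  by rewrite eq_sym (negPf (neq_lift _ _)) mulr0n mul0r mulr0 add0r.
by rewrite eqxx mulr1n mul1r mul0r addr0.
Qed.

End At_point.
End Circle_bundle.

(** * Splitting of tangent vectors of F_c along a frame section *)

Section Fc_tangent_space.
Context {R : realType} {m : nat} {M : manifold R (2 * m).+1}.
Local Notation PM := (mparams M).
Local Notation tangentM := (tangent PM).
Context {T10 : M -> set (tvec R M)}.
Hypotheses (m_gt0 : (0 < m)%N) (aCR : almost_CR T10)
  (pint : partially_integrable T10).
Context {th : form1 R M}.
Hypotheses (ph : pseudo_hermitian T10 th) (pos : levi_positive T10 th).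
Implicit Types (x y : M) (u v w : tvec R M) (Z : 'I_m -> vfield R M).
Implicit Types (q : Fpoint M) (V W : tvec R (Fpoint M)).
Local Notation PF := (Fparams T10).
Local Notation Fproj := (@Fproj R m M).
Local Notation dFproj := (@dFproj R m M).
Local Notation OF := (orthonormal_frame T10 th).
Local Notation fsec th Z := (fun y => (y, ray (frame_mform T10 th Z y)) : Fpoint M).

Lemma Fc_tangent_decomp q V : tangent PF q V -> exists Z k,
  [/\ OF Z (Fproj q) /\ fsec th Z (Fproj q) = q, tangentM (Fproj q) (dFproj q V),
      tangent PF q (Defs.pushforward PF (fsec th Z) (Fproj q) (dFproj q V)),
      tangent PF q (fundamental T10 q) &
      V = k *: fundamental T10 q +
          Defs.pushforward PF (fsec th Z) (Fproj q) (dFproj q V)].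
Proof.
move=> [D [psi [w0 [a [[c [U [tau [ca Uo HU [-> ->]]]]] [/= cw Uw] <- VE]]]]].
set x0 := chart_inv c (tail w0) in cw Uw VE *.
have N : \forall y \near x0, Lambda T10 y (tau y) /\ tau y <> 0.
  apply: filterS (open_nbhs_nbhs (conj Uo Uw)) => y /HU[l n _]; exact: conj l n.
have st : smooth_mform tau x0 by have [] := HU _ Uw.
(* The point q is [e^{it} tau], so the frame must represent the multiple z = e^{it}, t =
   [w0 0 0]. *)
have [Z oZ ZN] := frame_of_section m_gt0 aCR pint ph pos (cis_neq0 (w0 0 0)) N st.
have [_ _ /(_ _ cw)[cx mx] _ _] := atlas_chart ca.
have sN : \forall y \near x0, fsec th Z y =
    let y' := chart_inv c (tail (glue (w0 0 0) (chart_map c y))) in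
    act (y', ray (tau y')) (cis (glue (w0 0 0) (chart_map c y) 0 0)).
  apply: filterS2 ZN (near_dom ca cx) => y E cy.
  have [_ _ ey] := mparams_chart ca cy.
  by rewrite /= tail_glue glue0 ey act_ray E.
exists Z, (a ord0); split.
- split=> //; rewrite /Fproj /= (nbhs_singleton ZN) act_ray//.
- exact: (tangent_dFproj ca cw VE).
- exact: (tangent_pushforward ca Uo HU cw Uw sN VE).
- exact: (tangent_fundamental ca Uo HU cw Uw).
- exact: (Fc_tangentE ca Uo HU cw Uw sN VE).
Qed.

(** A point carrying a tangent vector lies in the image of a parametrization, which gives the
    condition [near_point] its content at q. *)
Lemma connection_lin q V A : tangent PF q V -> smooth_form1 PF A q ->
  linear_on (tangent PF q) (A q).
Proof.
move=> [D [psi [u [a [PV Vu qE _]]]]] [/(_ _ _ _ PV Vu qE)/nbhs_singleton].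
by rewrite qE.
Qed.

End Fc_tangent_space.

(** * Conformal change of the pseudo-Hermitian form *)

Section Conformal_change.
Context {R : realType} {m : nat} {M : manifold R (2 * m).+1}.
Local Notation C := R[i].
Local Notation iC := (0 +i* 1 : C).
Local Notation PM := (mparams M).
Local Notation smooth := (smooth_at PM).
Local Notation tangentM := (tangent PM).
Local Notation field := (smooth_field PM).
Local Notation lieM := (lie PM).
Context {T10 : M -> set (tvec R M)}.
Hypotheses (m_gt0 : (0 < m)%N) (aCR : almost_CR T10)
  (pint : partially_integrable T10).
Context {th : form1 R M}.
Hypothesis ph : pseudo_hermitian T10 th.
Context {f : M -> R}.
Hypothesis f_smooth : forall x, smooth (fun y => (f y)%:C) x.
Implicit Types (x y : M) (u v w : tvec R M) (Z : 'I_m -> vfield R M).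

Local Notation F := (fun y => (f y)%:C).
Local Notation th' := (fun x v => (expR (2 * f x))%:C * th x v).

(** The exponent is a parameter because e^{2f}, e^{-f} and e^f all occur: for theta', its
    orthonormal frame and its coframe. *)
Definition expf (k : R) : M -> C := fun y => (expR (k * f y))%:C.

Local Notation lam := (expf 2).
Local Notation el := (expf (-1)).
Local Notation eu := (expf 1).
Local Notation dth := (dform PM th).
Local Notation dth' := (dform PM th').
Local Notation OF := (orthonormal_frame T10 th).
Local Notation OF' := (orthonormal_frame T10 th').
Local Notation T := (reeb th).
Local Notation T' := (reeb th').
Local Notation th10 := (@theta10 R m M th).
Local Notation th01 := (@theta01 R m M th).
Local Notation th10' := (@theta10 R m M th').
Local Notation th01' := (@theta01 R m M th').

Lemma expfD (k l : R) y : expf (k + l) y = expf k y * expf l y.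
Proof. by rewrite /expf mulrDl expRD rmorphM. Qed.

Lemma expf0 y : expf 0 y = 1.
Proof. by rewrite /expf mul0r expR0. Qed.

Lemma el_eu y : el y * eu y = 1.
Proof. by rewrite -expfD addNr expf0. Qed.

Lemma lam_el y : lam y * el y = eu y.
Proof.
have E : 2 + -1 = 1 :> R by lra.
by rewrite -expfD E.
Qed.

Lemma eu_eu y : eu y * eu y = lam y.
Proof. by rewrite -expfD. Qed.

Lemma expf_neq0 k y : expf k y != 0.
Proof. by rewrite /expf (inj_eq (@complexI R)) gt_eqF// expR_gt0. Qed.

Lemma expf_conj k y : conjc (expf k y) = expf k y.
Proof. exact: conjc_real. Qed.

Lemma smooth_expf k x : smooth (expf k) x.
Proof.
apply: smooth_expR; have := smoothM (@smooth_cst _ _ _ k%:C x) (f_smooth (x := x)).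
by apply: smooth_ext; apply: nearW => y; rewrite rmorphM.
Qed.

Lemma tangent_expf k x v : tangentM x v -> v (expf k) = k%:C * expf k x * v F.
Proof.
move=> tv; have ks : smooth (fun y => (k * f y)%:C) x.
  have := smoothM (@smooth_cst _ _ _ k%:C x) (f_smooth (x := x)).
  by apply: smooth_ext; apply: nearW => y; rewrite rmorphM.
rewrite (tangent_expR tv ks).
rewrite (_ : v (fun y => (k * f y)%:C) = k%:C * v F); first by rewrite /expf; ring.
rewrite -(tangent_fZ _ tv (f_smooth (x := x))); apply: (tangent_ext tv).
by apply: nearW => y; rewrite rmorphM.
Qed.

Lemma th'_lam : th' = (fun y u => lam y * th y u). Proof. by []. Qed.

Lemma ph' : pseudo_hermitian T10 th'.
Proof.
move=> x; have [s r [v tv v0] h] := ph x; split.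
- by rewrite th'_lam; apply: formZ => //; exact: smooth_expf.
- by move=> w tw; rewrite r// conjcM conjc_real.
- by exists v => //; rewrite mulf_neq0// expf_neq0.
- by move=> w hw; rewrite h// mulr0.
Qed.

(** Leibniz rule with d(e^{2f}) = 2 e^{2f} df. *)
Lemma dth'E x v w : tangentM x v -> tangentM x w ->
  dth' x v w = lam x * (dth x v w + 2 * v F * th x w - 2 * w F * th x v).
Proof.
move=> tv tw; rewrite th'_lam (dformZ (smooth_expf (x := x) 2) (ph_form ph x) tv tw).
rewrite (tangent_expf 2 tv) (tangent_expf 2 tw) (rmorph_nat (real_complex R) 2); ring.
Qed.

Lemma levi10' x u v : T10 x u -> T10 x v ->
  levi10 th' x u v = lam x * levi10 th x u v.
Proof.
move=> tu tv; have tv' := T01_conj tv.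
have Tu := T10_tangent aCR tu; have Tv := tangent_conj (T10_tangent aCR tv).
rewrite /levi10 dth'E// (th_T10 m_gt0 aCR ph tu) (th_T01 m_gt0 aCR ph tv').
ring.
Qed.

Definition scale_frame Z : 'I_m -> vfield R M := fun a y => el y *: Z a y.
Local Notation "Z ^~" := (scale_frame Z) (at level 8, format "Z ^~").

Lemma OF_scale Z x : OF Z x -> OF' Z^~ x.
Proof.
move=> oZ; have N := OF_near oZ; split.
  apply: (local_frame_scale m_gt0 aCR (fun=> smooth_expf (x := x) (-1))).
    by apply: nearW => y a; exact: expf_neq0.
  by case: oZ.
apply/near_pointP; apply: filterS N => y oy a b.
have ta := T10Z m_gt0 aCR (el y) (OF_T10 a oy).
have tb := T10Z m_gt0 aCR (el y) (OF_T10 b oy).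
rewrite (levi_T10 m_gt0 aCR ph' ta tb) (levi10' ta tb).
have Ta := OF_tangent a oy; have Tb := OF_tangent b oy.
rewrite (lin_onZ _ (levi10_linl ph (T10_tangent aCR tb)) Ta).
rewrite -(levi10_herm ph (T10_tangent aCR tb) Ta).
rewrite (lin_onZ _ (levi10_linl ph Ta) Tb) (OF_levi m_gt0 aCR ph b a oy).
rewrite conjcM expf_conj !mulrA lam_el [eu y * _]mulrC el_eu mul1r.
by rewrite conjc_nat eq_sym.
Qed.

Lemma conjv_F v : conjv v F = conjc (v F).
Proof.
by rewrite /conjv; congr (conjc (v _)); apply/funext => y; rewrite conjc_real.
Qed.

(* [dZ Z a] is f_a = Z_a f and [dZbar Z a] its conjugate. *)
Definition dZ Z a : M -> C := fun y => Z a y F.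
Definition dZbar Z a : M -> C := fun y => conjv (Z a y) F.

Lemma dZ_smooth Z x a : OF Z x -> smooth (dZ Z a) x.
Proof. by move=> oZ; apply: (field_smooth (OF_field a oZ)). Qed.

Lemma dZbar_smooth Z x a : OF Z x -> smooth (dZbar Z a) x.
Proof. by move=> oZ; apply: (field_smooth (OF_fieldc a oZ)). Qed.

(* e^{2f} times the Reeb field of e^{2f} theta. *)
Definition reeb_shift Z : vfield R M := fun y => T y +
  (\sum_a (- (2 * iC) * dZbar Z a y) *: Z a y +
   \sum_a (2 * iC * dZ Z a y) *: conjv (Z a y)).

Lemma reeb_shift_field Z x : OF Z x -> field (reeb_shift Z) x.
Proof.
move=> oZ; apply: fieldD; first exact: (reeb_field m_gt0 aCR pint ph oZ).
apply: fieldD; apply: field_sum => a; apply: fieldZ.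
- exact: smoothM (@smooth_cst _ _ _ _ x) (dZbar_smooth a oZ).
- exact: OF_field a oZ.
- exact: smoothM (@smooth_cst _ _ _ _ x) (dZ_smooth a oZ).
- exact: OF_fieldc a oZ.
Qed.

Section At_point.
Context {x : M} {Z : 'I_m -> vfield R M}.
Hypothesis oZ : OF Z x.

Let L := ph_lin ph (x := x).
Let rT : is_reeb (th := th) x (T x) := reeb_is_reeb m_gt0 aCR pint ph oZ.
Let tT : tangentM x (T x). Proof. by case: rT. Qed.
Let T1 : th x (T x) = 1. Proof. by case: rT. Qed.
Let dT w : tangentM x w -> dth x (T x) w = 0. Proof. by case: rT => _ _; apply. Qed.
Let tZ a : tangentM x (Z a x). Proof. exact: OF_tangent oZ. Qed.
Let tZc a : tangentM x (conjv (Z a x)). Proof. exact: OF_tangentc oZ. Qed.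
Let tV : tangentM x (reeb_shift Z x).
Proof. exact: field_tangent (reeb_shift_field oZ). Qed.
Let tcomb1 := (tangent_comb (fun a => - (2 * iC) * dZbar Z a x)
  (fun a => 2 * iC * dZ Z a x) oZ).1.
Let tcomb2 := (tangent_comb (fun a => - (2 * iC) * dZbar Z a x)
  (fun a => 2 * iC * dZ Z a x) oZ).2.
Let tcomb := tangentD tcomb1 tcomb2.

Lemma th_shift : th x (reeb_shift Z x) = 1.
Proof.
rewrite /reeb_shift (lin_onD L tT tcomb) (lin_onD L tcomb1 tcomb2).
have [-> ->] := th_comb m_gt0 aCR ph (fun a => - (2 * iC) * dZbar Z a x)
  (fun a => 2 * iC * dZ Z a x) oZ.
by rewrite T1 !addr0.
Qed.

(** This fixes the constants in [reeb_shift]: a vector V with theta(V) = 1 is annihilated on H by d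
    theta' exactly when d theta(V, w) = 2 w(f) for w in H. *)
Lemma dth_shiftZ a : dth x (reeb_shift Z x) (Z a x) = 2 * dZ Z a x.
Proof.
rewrite /reeb_shift (lin_onD (dth_linl ph (tZ a)) tT tcomb) dT// add0r.
have [_ ->] := dth_comb m_gt0 aCR pint ph (fun a => - (2 * iC) * dZbar Z a x)
  (fun a => 2 * iC * dZ Z a x) a oZ.
transitivity (- (iC * iC) * (2 * dZ Z a x)); first by ring.
by rewrite mulii opprK mul1r.
Qed.

Lemma dth_shiftZc a : dth x (reeb_shift Z x) (conjv (Z a x)) = 2 * dZbar Z a x.
Proof.
rewrite /reeb_shift (lin_onD (dth_linl ph (tZc a)) tT tcomb) dT// add0r.
have [-> _] := dth_comb m_gt0 aCR pint ph (fun a => - (2 * iC) * dZbar Z a x)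
  (fun a => 2 * iC * dZ Z a x) a oZ.
transitivity (- (iC * iC) * (2 * dZbar Z a x)); first by ring.
by rewrite mulii opprK mul1r.
Qed.

(** The correction to T kills f, as -2i conj(f_a) f_a and 2i f_a conj(f_a) cancel: it is a multiple
    of J applied to the gradient of f in H. *)
Lemma shift_F : reeb_shift Z x F = T x F.
Proof.
rewrite /reeb_shift !tvD !tv_sum -big_split/= big1 ?addr0// => a _.
by rewrite !tvZ /dZ /dZbar; ring.
Qed.

Lemma tangent_F v : tangentM x v ->
  v F = \sum_a (th10 Z a x v * dZ Z a x + th01 Z a x v * dZbar Z a x) + th x v * T x F.
Proof.
move=> tv; rewrite {1}(OF_decomp m_gt0 aCR pint ph oZ tv) !tvD tvZ !tv_sum.
by rewrite -big_split.
Qed.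

Lemma lin_decomp (l : tvec R M -> C) v : linear_on (tangentM x) l -> tangentM x v ->
  l v = \sum_a (th10 Z a x v * l (Z a x) + th01 Z a x v * l (conjv (Z a x)))
    + th x v * l (T x).
Proof.
move=> Ll tv; rewrite {1}(OF_decomp m_gt0 aCR pint ph oZ tv).
have [t1 t2] := tangent_comb (fun a => th10 Z a x v) (fun a => th01 Z a x v) oZ.
rewrite (lin_onD Ll (tangentD t1 t2) (tangentZ _ tT)) (lin_onD Ll t1 t2).
rewrite (lin_onZ _ Ll tT) !(lin_on_sum _ _ Ll);
  [|by move=> a; exact: tangentZ..].
rewrite -big_split/=; congr (_ + _); apply: eq_bigr => a _.
by rewrite !(lin_onZ _ Ll).
Qed.

(** By uniqueness it suffices to check the Reeb equations. They reduce to d theta(V, w) = 2 (w(f) -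
    T(f) theta(w)) for V the shifted field. *)
Lemma reeb'E : T' x = (lam x)^-1 *: reeb_shift Z x.
Proof.
have oZ' := OF_scale oZ.
have r' := reeb_is_reeb m_gt0 aCR pint ph' oZ'.
apply: (is_reeb_uniq m_gt0 aCR pint ph' oZ' r'); split.
- exact: tangentZ.
- by rewrite (lin_onZ _ L tV) th_shift mulr1 mulfV// expf_neq0.
move=> w tw; rewrite (lin_onZ _ (dth_linl ph' tw) tV) dth'E//.
rewrite mulKf ?expf_neq0// th_shift mulr1 shift_F.
rewrite (lin_decomp (dth_linr ph tV) tw) (tangent_F tw).
rewrite (_ : dth x _ (T x) = 0); last first.
  by rewrite (dformC (ph_form ph x) tV tT) dT// oppr0.
rewrite mulr0 addr0 mulrDr opprD addrA mulr_sumr.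
rewrite (_ : \sum_a _ = \sum_i 2 *
   (th10 Z i x w * dZ Z i x + th01 Z i x w * dZbar Z i x)); first by ring.
by apply: eq_bigr => a _; rewrite dth_shiftZ dth_shiftZc; ring.
Qed.

(** The term in theta(v) comes from df /\ theta in d theta', evaluated at conj(Z_a); the factor is
    e^{2f} e^{-f}. *)
Lemma theta10'E a v : tangentM x v ->
  th10' Z^~ a x v = eu x * (th10 Z a x v + 2 * iC * dZbar Z a x * th x v).
Proof.
move=> tv; rewrite /theta10 /scale_frame conjvZ expf_conj.
rewrite (lin_onZ _ (dth_linr ph' tv) (tZc a)) dth'E//.
rewrite (OF_thc m_gt0 aCR ph a oZ) -lam_el -/(dZbar Z a x); ring.
Qed.

Lemma theta01'E a v : tangentM x v ->
  th01' Z^~ a x v = eu x * (th01 Z a x v - 2 * iC * dZ Z a x * th x v).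
Proof.
move=> tv; rewrite /theta01 /scale_frame.
rewrite (lin_onZ _ (dth_linr ph' tv) (tZ a)) dth'E//.
rewrite (OF_th m_gt0 aCR ph a oZ) -lam_el -/(dZ Z a x); ring.
Qed.

End At_point.

(** * Change of the connection trace and of the scalar curvature *)

Context {nabla nabla' : covd M}.
Hypotheses (tw : tanaka_webster T10 th nabla) (tw' : tanaka_webster T10 th' nabla').
Local Notation sig := (sigma (T10 := T10) (th := th) (nabla := nabla)).
Local Notation sig' := (sigma (T10 := T10) (th := th') (nabla := nabla')).
Local Notation m2 := (m%:R + 2 : C).

(** Both derivative terms of d theta differentiate constants. *)
Lemma th_lie_const (Y W : vfield R M) k x : field Y x -> field W x ->
  (\forall y \near x, th y (Y y) = k) -> (\forall y \near x, th y (W y) = 0) ->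
  th x (lieM Y W x) = - dth x (Y x) (W x).
Proof.
move=> fY fW hY hW; rewrite (form_lie (ph_form ph x) fY fW).
have tY := field_tangent fY; have tW := field_tangent fW.
rewrite (tangent_ext tY hW) (tangent_ext tW hY).
by rewrite (tangent_f0 tY) (tangent_cst k tW) subrr sub0r.
Qed.

Lemma OF_th10Zc Z x a b : OF Z x -> th10 Z a x (conjv (Z b x)) = 0.
Proof. by move=> oZ; rewrite /theta10 (OF_dth01 m_gt0 aCR pint ph b a oZ) mulr0. Qed.

(** One formula for two brackets: W = conj(Z_b) with h = e^{-f}, and W = e^{2f} T' with h = e^{-2f}.
    As theta'^a kills W, the derivative of h does not contribute. *)
Lemma theta10'_bracket Z x a h (W : vfield R M) : OF Z x -> smooth h x ->
  field W x -> th10' Z^~ a x (W x) = 0 ->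
  th10' Z^~ a x (lieM (fun y => h y *: W y) (Z^~ a) x) =
  h x * (- W x F + th10 Z a x (lieM W (Z a) x) +
         2 * iC * dZbar Z a x * th x (lieM W (Z a) x)).
Proof.
move=> oZ hs fW W0; have oZ' := OF_scale oZ.
have fZ := OF_field a oZ; have fZ' := OF_field a oZ'.
have els := smooth_expf (x := x) (-1).
have tK := lie_tangent fW fZ.
have L' := th10_lin ph' a oZ'; have L := ph_lin ph (x := x).
rewrite (lieZl hs fW fZ') (lin_onB L'); last 2 first.
- exact: tangentZ (lie_tangent fW fZ').
- exact: tangentZ (field_tangent fW).
rewrite (lin_onZ _ L' (field_tangent fW)) W0 mulr0 subr0.
rewrite (lin_onZ _ L' (lie_tangent fW fZ')); congr (_ * _).
rewrite (lieZr els fW fZ).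
have tZ := field_tangent fZ; have tW := field_tangent fW.
have t1 := tangentZ (W x el) tZ; have t2 := tangentZ (el x) tK.
rewrite (lin_onD L' t1 t2) (lin_onZ _ L' tZ) (lin_onZ _ L' tK).
rewrite !(theta10'E oZ)//.
rewrite (OF_th10Z m_gt0 aCR ph a a oZ) eqxx mulr1n (OF_th m_gt0 aCR ph a oZ).
rewrite (tangent_expf (-1) tW).
have cN1 : (-1)%:C = -1 :> C by exact: rmorphN1.
rewrite cN1; set A := th10 _ _ _ _; set B := th _ _; set wf := W x _.
transitivity (el x * eu x * (- wf + A + 2 * iC * dZbar Z a x * B)); first by ring.
by rewrite el_eu mul1r.
Qed.

(** Origin of m + 2: each of the m frame vectors contributes -conj(Z_b) f through its factor e^{-f},
    and the theta-component of the brackets contributes twice more. *)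
Lemma sigma_bar_change Z x b : OF Z x ->
  sig' Z^~ x (conjv (Z b x)) = sig Z x (conjv (Z b x)) - m2 * dZbar Z b x.
Proof.
move=> oZ; have oZ' := OF_scale oZ.
have fB := OF_fieldc b oZ; have tB := field_tangent fB.
have els := smooth_expf (x := x) (-1).
have L' := form_lin (sigma_form m_gt0 aCR pint ph' tw' oZ').
apply: (mulfI (expf_neq0 (-1) x)).
rewrite -(lin_onZ _ L' tB).
have E y : el y *: conjv (Z b y) = conjv (Z^~ b y).
  by rewrite /scale_frame conjvZ expf_conj.
rewrite E (sigma_bar m_gt0 aCR pint ph' tw' b oZ').
have E' : (fun y => conjv (Z^~ b y)) = (fun y => el y *: conjv (Z b y)).
  by apply/funext => y; rewrite E.
rewrite E' (sigma_bar m_gt0 aCR pint ph tw b oZ).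
have W0 a : th10' Z^~ a x (conjv (Z b x)) = 0.
  rewrite (theta10'E oZ)// OF_th10Zc//.
  by rewrite (OF_thc m_gt0 aCR ph b oZ) mulr0 addr0 mulr0.
have thB a : th x (lieM (fun y => conjv (Z b y)) (Z a) x) = iC * (a == b)%:R.
  rewrite (th_lie_const (k := 0) fB (OF_field a oZ)).
  - by rewrite (OF_dthC m_gt0 aCR ph a b oZ) mulNr opprK.
  - by apply: filterS (OF_near oZ) => y oy; exact: (OF_thc m_gt0 aCR ph b oy).
  - by apply: filterS (OF_near oZ) => y oy; exact: (OF_th m_gt0 aCR ph a oy).
under eq_bigr => a _ do rewrite (theta10'_bracket oZ els fB (W0 a)) thB -/(dZbar Z b x).
rewrite -mulr_sumr; congr (_ * _).
(* Here theta([conj(Z_b), Z_a]) = i delta_ab meets the coefficient 2i conj(f_a), and 2i i = -2. *)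
have S : \sum_a 2 * iC * dZbar Z a x * (iC * (a == b)%:R) = - 2 * dZbar Z b x.
  rewrite (bigD1 b)//= eqxx mulr1n big1; last first.
    by move=> a /negPf ->; rewrite !mulr0.
  transitivity ((iC * iC) * (2 * dZbar Z b x)); first by ring.
  by rewrite mulii; ring.
rewrite !big_split/= S sumr_const card_ord -[(- _) *+ m]mulr_natl.
by rewrite /sigma; ring.
Qed.

Lemma sigma_Z_change Z x b : OF Z x ->
  sig' Z^~ x (Z b x) = sig Z x (Z b x) + m2 * dZ Z b x.
Proof.
move=> oZ; have oZ' := OF_scale oZ.
have tb := OF_tangent b oZ.
rewrite (sigma_conj m_gt0 aCR ph' tw' oZ' tb) (sigma_bar_change b oZ).
rewrite (sigma_conj m_gt0 aCR ph tw oZ tb) conjcB conjcM conjcD !conjc_nat.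
have -> : conjc (dZbar Z b x) = dZ Z b x by rewrite /dZbar conjv_F conjcK.
ring.
Qed.

(** The function S of the overview; it is kept opaque until the curvature computation. *)
Definition sigma_T Z x : C := sig' Z^~ x (T x) - sig Z x (T x).

Lemma sigma_change Z x v : OF Z x -> tangentM x v ->
  sig' Z^~ x v = sig Z x v +
    m2 * (\sum_a (th10 Z a x v * dZ Z a x - th01 Z a x v * dZbar Z a x)) +
    sigma_T Z x * th x v.
Proof.
move=> oZ tv; have oZ' := OF_scale oZ.
have L' := form_lin (sigma_form m_gt0 aCR pint ph' tw' oZ').
have L := form_lin (sigma_form m_gt0 aCR pint ph tw oZ).
rewrite (lin_decomp oZ L' tv).
rewrite (lin_decomp oZ L tv).
have S : \sum_a (th10 Z a x v * sig' Z^~ x (Z a x) +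
    th01 Z a x v * sig' Z^~ x (conjv (Z a x))) =
    \sum_a (th10 Z a x v * sig Z x (Z a x) +
    th01 Z a x v * sig Z x (conjv (Z a x))) +
    m2 * (\sum_a (th10 Z a x v * dZ Z a x - th01 Z a x v * dZbar Z a x)).
  rewrite mulr_sumr -big_split/=; apply: eq_bigr => a _.
  rewrite (sigma_Z_change a oZ) (sigma_bar_change a oZ).
  move: (sig Z x _) (sig Z x _) => p q; ring.
rewrite S /sigma_T; move: (sig' _ _ _) (sig Z x (T x)) => p q.
ring.
Qed.

(** The function N of the overview. *)
Definition df_norm Z x : C := \sum_a dZ Z a x * dZbar Z a x.

(** The last term is 2i conj(f_a) times theta([V, Z_a]) = -2 f_a, summed over a, where V = e^{2f}
    T'. *)
Lemma lam_sigma'_reeb Z x : OF Z x ->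
  lam x * sig' Z^~ x (T' x) = - m%:R * T x F +
   \sum_a th10 Z a x (lieM (reeb_shift Z) (Z a) x)
   - 4 * iC * df_norm Z x.
Proof.
move=> oZ; have oZ' := OF_scale oZ.
pose V := reeb_shift Z.
have fV : field V x := reeb_shift_field oZ.
have tV := field_tangent fV.
rewrite (sigma_reeb m_gt0 aCR pint ph' tw' oZ').
have lams := smooth_expf (x := x) 2.
have ils : smooth (fun y => (lam y)^-1) x by apply: smoothV => //; exact: expf_neq0.
have EV : \forall y \near x, T' y = (lam y)^-1 *: V y.
  by apply: filterS (OF_near oZ) => y oy; exact: (reeb'E oy).
have rT' := reeb_is_reeb m_gt0 aCR pint ph' oZ'.
have W0 a : th10' Z^~ a x (V x) = 0.
  have := nbhs_singleton EV => /(congr1 (fun u => lam x *: u)).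
  rewrite scalerA mulfV ?expf_neq0// scale1r => <-.
  have [tT' _ dT'] := rT'.
  rewrite (lin_onZ _ (th10_lin ph' a oZ') tT') /theta10 dT' ?mulr0//.
  exact: OF_tangentc a oZ'.
have thV a : th x (lieM V (Z a) x) = - (2 * dZ Z a x).
  rewrite (th_lie_const (k := 1) fV (OF_field a oZ)).
  - by rewrite (dth_shiftZ oZ).
  - by apply: filterS (OF_near oZ) => y oy; exact: (th_shift oy).
  - by apply: filterS (OF_near oZ) => y oy; exact: (OF_th m_gt0 aCR ph a oy).
have fT' := reeb_field m_gt0 aCR pint ph' oZ'.
have step a : th10' Z^~ a x (lieM T' (Z^~ a) x) = (lam x)^-1 *
    (- T x F + th10 Z a x (lieM V (Z a) x) + - 4 * iC * (dZ Z a x * dZbar Z a x)).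
  rewrite (lie_ext fT' (OF_field a oZ') EV (nearW _ (fun y => erefl (Z^~ a y)))).
  rewrite (theta10'_bracket oZ ils fV (W0 a)) thV.
  have VF : V x F = T x F by exact: shift_F.
  by rewrite VF; congr (_ * _); ring.
under eq_bigr => a _ do rewrite step.
rewrite -mulr_sumr mulrA mulfV ?expf_neq0// mul1r !big_split/= sumr_const card_ord.
have S : \sum_i - 4 * iC * (dZ Z i x * dZbar Z i x) = - 4 * iC * df_norm Z x.
  by rewrite -mulr_sumr.
by rewrite S -[(- T x F) *+ m]mulr_natl; ring.
Qed.

(** Leibniz rule for the coefficients of the shift. Their derivatives survive only along Z_a, since
    theta^a is delta_ac on Z_c and 0 on conj(Z_c). *)
Lemma trace_bracket_shift Z x : OF Z x ->
  \sum_a th10 Z a x (lieM (reeb_shift Z) (Z a) x) =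
  sig Z x (T x) + 2 * iC * (\sum_a Z a x (dZbar Z a))
  - 2 * iC * (\sum_c dZbar Z c x * \sum_a th10 Z a x (lieM (Z c) (Z a) x))
  + 2 * iC * (\sum_c dZ Z c x * sig Z x (conjv (Z c x))).
Proof.
move=> oZ; rewrite (sigma_reeb m_gt0 aCR pint ph tw oZ).
have fT := reeb_field m_gt0 aCR pint ph oZ.
have s2 c : smooth (fun y => - (2 * iC) * dZbar Z c y) x.
  exact: smoothM (@smooth_cst _ _ _ _ x) (dZbar_smooth c oZ).
have s1 c : smooth (fun y => 2 * iC * dZ Z c y) x.
  exact: smoothM (@smooth_cst _ _ _ _ x) (dZ_smooth c oZ).
have fc c := OF_field c oZ; have fC c := OF_fieldc c oZ.
have f2 c : field (fun y => (- (2 * iC) * dZbar Z c y) *: Z c y) x.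
  exact: fieldZ (s2 c) (fc c).
have f1 c : field (fun y => (2 * iC * dZ Z c y) *: conjv (Z c y)) x.
  exact: fieldZ (s1 c) (fC c).
have g2 := field_sum (index_enum 'I_m) f2; have g1 := field_sum (index_enum 'I_m) f1.
have tfc c := field_tangent (fc c); have tfC c := field_tangent (fC c).
have expand a : th10 Z a x (lieM (reeb_shift Z) (Z a) x) =
    th10 Z a x (lieM T (Z a) x) + 2 * iC * Z a x (dZbar Z a)
    - 2 * iC * (\sum_c dZbar Z c x * th10 Z a x (lieM (Z c) (Z a) x))
    + 2 * iC * (\sum_c dZ Z c x * th10 Z a x (lieM (fun y => conjv (Z c y)) (Z a) x)).
  have La := th10_lin ph a oZ.
  rewrite (lieDl fT (fieldD g2 g1) (fc a)) (lieDl g2 g1 (fc a)).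
  rewrite (lin_onD La (lie_tangent fT (fc a))
    (tangentD (lie_tangent g2 (fc a)) (lie_tangent g1 (fc a)))).
  rewrite (lin_onD La (lie_tangent g2 (fc a)) (lie_tangent g1 (fc a))).
  rewrite -!addrA; congr (_ + _).
  rewrite (lieC _ (Z a)) (lie_sumr _ (fc a) f2) (lin_onN La); last first.
    by apply: tangent_sum => c; exact: lie_tangent.
  rewrite (lieC _ (Z a)) (lie_sumr _ (fc a) f1) (lin_onN La); last first.
    by apply: tangent_sum => c; exact: lie_tangent.
  rewrite (lin_on_sum _ _ La); last by move=> c; exact: lie_tangent.
  rewrite (lin_on_sum _ _ La); last by move=> c; exact: lie_tangent.
  have e2 c : th10 Z a x (lieM (Z a) (fun y => (- (2 * iC) * dZbar Z c y) *: Z c y) x) =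
      - (2 * iC) * (Z a x (dZbar Z c) * (c == a)%:R) +
      2 * iC * (dZbar Z c x * th10 Z a x (lieM (Z c) (Z a) x)).
    rewrite (lieZr (s2 c) (fc a) (fc c)) (lin_onD La (tangentZ _ (tfc c))
      (tangentZ _ (lie_tangent (fc a) (fc c)))).
    rewrite (lin_onZ _ La (tfc c)) (lin_onZ _ La (lie_tangent (fc a) (fc c))).
    rewrite (OF_th10Z m_gt0 aCR ph a c oZ) (lieC (Z a)).
    rewrite (lin_onN La (lie_tangent (fc c) (fc a))).
    rewrite (tangent_fZ _ (tfc a) (dZbar_smooth c oZ)); ring.
  have e1 c : th10 Z a x (lieM (Z a) (fun y => (2 * iC * dZ Z c y) *: conjv (Z c y)) x) =
      - (2 * iC) * (dZ Z c x * th10 Z a x (lieM (fun y => conjv (Z c y)) (Z a) x)).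
    rewrite (lieZr (s1 c) (fc a) (fC c)) (lin_onD La (tangentZ _ (tfC c))
      (tangentZ _ (lie_tangent (fc a) (fC c)))).
    rewrite (lin_onZ _ La (tfC c)) (lin_onZ _ La (lie_tangent (fc a) (fC c))).
    rewrite (OF_th10Zc a c oZ) (lieC (Z a)).
    rewrite (lin_onN La (lie_tangent (fC c) (fc a))); ring.
  rewrite (eq_bigr _ (fun c _ => e2 c)) (eq_bigr _ (fun c _ => e1 c)).
  rewrite big_split/= -!mulr_sumr (bigD1 a)//= eqxx mulr1 big1; last first.
    by move=> c /negPf ->; rewrite mulr0.
  ring.
under eq_bigr => a _ do rewrite expand.
rewrite !big_split/= sumrN -!mulr_sumr.
congr (_ + _ - _ * _ + _ * _).
  by rewrite exchange_big/=; apply: eq_bigr => c _; rewrite mulr_sumr.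
rewrite exchange_big/=; apply: eq_bigr => c _.
by rewrite (sigma_bar m_gt0 aCR pint ph tw c oZ) mulr_sumr.
Qed.

(** Two evaluations of e^{2f} sigma'(T') are compared: by the bracket formula for T', and by
    linearity over T, Z_a and conj(Z_a). The factor i and the shape of the sum are those of
    [ricci_change], where the same sum appears. *)
Lemma sigma_TE Z x : OF Z x -> iC * sigma_T Z x =
  \sum_b (- 2 * Z b x (dZbar Z b) - iC * T x F + 2 * \sum_c
    th01 Z c x (lieM (Z b) (fun y => conjv (Z b y)) x) * dZbar Z c x)
  - 4 * (m%:R + 1) * df_norm Z x.
Proof.
move=> oZ; have oZ' := OF_scale oZ.
have L' := form_lin (sigma_form m_gt0 aCR pint ph' tw' oZ').
have rT := reeb_is_reeb m_gt0 aCR pint ph oZ; have [tT T1 dT] := rT.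
have [tT' _ _] := reeb_is_reeb m_gt0 aCR pint ph' oZ'.
have tV := field_tangent (reeb_shift_field oZ).
have [t1 t2] := tangent_comb (fun a => - (2 * iC) * dZbar Z a x)
  (fun a => 2 * iC * dZ Z a x) oZ.
have tZ a := OF_tangent a oZ; have tZc a := OF_tangentc a oZ.
have E1 : lam x * sig' Z^~ x (T' x) = sig' Z^~ x (T x) +
   (\sum_a - (2 * iC) * dZbar Z a x * sig' Z^~ x (Z a x) +
    \sum_a 2 * iC * dZ Z a x * sig' Z^~ x (conjv (Z a x))).
  rewrite -(lin_onZ _ L' tT') (reeb'E oZ).
  rewrite scalerA mulfV ?expf_neq0// scale1r /reeb_shift.
  rewrite (lin_onD L' tT (tangentD t1 t2)) (lin_onD L' t1 t2).
  rewrite !(lin_on_sum _ _ L'); [|by move=> a; exact: tangentZ..].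
  congr (_ + (_ + _)); apply: eq_bigr => a _.
    by rewrite (lin_onZ _ L' (tZ a)).
  by rewrite (lin_onZ _ L' (tZc a)).
move: E1; rewrite (lam_sigma'_reeb oZ) (trace_bracket_shift oZ).
under [X in _ = _ + (X + _)]eq_bigr => a _ do rewrite (sigma_Z_change a oZ).
under [X in _ = _ + (_ + X)]eq_bigr => a _ do rewrite (sigma_bar_change a oZ).
have S1 : \sum_a - (2 * iC) * dZbar Z a x * (sig Z x (Z a x) + m2 * dZ Z a x) =
    - (2 * iC) * (\sum_a dZbar Z a x * sig Z x (Z a x)) - 2 * iC * m2 * df_norm Z x.
  by rewrite /df_norm !mulr_sumr -sumrB; apply: eq_bigr => a _; ring.
have S2 : \sum_a 2 * iC * dZ Z a x * (sig Z x (conjv (Z a x)) - m2 * dZbar Z a x) =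
    2 * iC * (\sum_a dZ Z a x * sig Z x (conjv (Z a x))) - 2 * iC * m2 * df_norm Z x.
  by rewrite /df_norm !mulr_sumr -sumrB; apply: eq_bigr => a _; ring.
rewrite S1 S2.
(* By [bracket_trace] the traces of [Z_c, Z_a], together with sigma on Z_c, become components of
   [Z_b, conj(Z_b)]. *)
have Q : \sum_b \sum_c th01 Z c x (lieM (Z b) (fun y => conjv (Z b y)) x) * dZbar Z c x =
    \sum_c dZbar Z c x * (\sum_a th10 Z a x (lieM (Z c) (Z a) x)) -
    \sum_c dZbar Z c x * sig Z x (Z c x).
  rewrite exchange_big/= -sumrB; apply: eq_bigr => c _.
  rewrite (sigma_Z m_gt0 aCR pint ph tw c oZ) mulrN opprK -mulrDr -big_split/=.
  rewrite mulr_sumr; apply: eq_bigr => b _.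
  by rewrite (bracket_trace m_gt0 aCR pint ph b c oZ) mulrC.
rewrite !big_split/= sumrN -!mulr_sumr Q sumr_const card_ord -mulr_natl /sigma_T.
set X1 := \sum_c dZbar Z c x * (\sum_a _); set X2 := \sum_a dZbar Z a x * _.
set X3 := \sum_a Z a x _; set X4 := \sum_c dZ Z c x * _.
set t' := sig' _ _ _; set t := sig _ _ _; set N := df_norm _ _; set tf := T x F.
move=> E.
have {}E : t' - t = - m%:R * tf + 4 * iC * (m%:R + 1) * N + 2 * iC * X3 - 2 * iC * (X1 - X2).
  apply/eqP; rewrite -subr_eq0; move/eqP: E; rewrite -subr_eq0 => /eqP E.
  by rewrite -oppr_eq0 -[X in _ == X]E; apply/eqP; ring.
rewrite E; apply/eqP; rewrite -subr_eq0; apply/eqP.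
(* [ring] treats i as an indeterminate; the two sides differ by a multiple of i^2 + 1. *)
transitivity ((iC * iC + 1) * (4 * (m%:R + 1) * N + 2 * X3 - 2 * (X1 - X2))).
  ring.
by rewrite mulii addNr mul0r.
Qed.

(** The formula for d sigma' on (Z_b, conj(Z_b)), whose e^{-f} factors cancel e^{2f}. The term with
    S arises from theta([Z_b, conj(Z_b)]) = -i. *)
Lemma ricci_change Z x b : OF Z x ->
  lam x * ricci T10 th' nabla' Z^~ x (Z^~ b x) (conjv (Z^~ b x)) =
  ricci T10 th nabla Z x (Z b x) (conjv (Z b x)) +
  m2 * (- 2 * Z b x (dZbar Z b) - iC * T x F + 2 * \sum_c
    th01 Z c x (lieM (Z b) (fun y => conjv (Z b y)) x) * dZbar Z c x)
  + iC * sigma_T Z x.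
Proof.
move=> oZ; have oZ' := OF_scale oZ.
have fb := OF_field b oZ; have fB := OF_fieldc b oZ.
have tb := field_tangent fb; have tB := field_tangent fB.
have fs := sigma_form m_gt0 aCR pint ph tw oZ.
have fs' := sigma_form m_gt0 aCR pint ph' tw' oZ'.
have -> : conjv (Z^~ b x) = el x *: conjv (Z b x).
  by rewrite /scale_frame conjvZ expf_conj.
rewrite /scale_frame.
rewrite (sigma_dform m_gt0 aCR pint ph' tw' oZ' (tangentZ _ tb) (tangentZ _ tB)).
rewrite (lin_onZ _ (dform_linl fs' (tangentZ _ tB)) tb).
rewrite (lin_onZ _ (dform_linr fs' tb) tB).
rewrite !mulrA lam_el [eu x * _]mulrC el_eu mul1r.
rewrite (sigma_dform m_gt0 aCR pint ph tw oZ tb tB).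
rewrite (dformE fs' fb fB) (dformE fs fb fB).
have H1 : Z b x (fun y => sig' Z^~ y (conjv (Z b y))) =
   Z b x (fun y => sig Z y (conjv (Z b y))) - m2 * Z b x (dZbar Z b).
  have s2 := dZbar_smooth b oZ.
  have ss := form_field fs fB.
  have s3 := smoothM (@smooth_cst _ _ _ m2 x) s2.
  rewrite -(tangent_fZ _ tb s2) -(tangent_fN tb s3) -(tangent_fD tb ss (smoothN s3)).
  apply: (tangent_ext tb); apply: filterS (OF_near oZ) => y oy.
  exact: sigma_bar_change.
have H2 : conjv (Z b x) (fun y => sig' Z^~ y (Z b y)) =
   conjv (Z b x) (fun y => sig Z y (Z b y)) + m2 * conjv (Z b x) (dZ Z b).
  have s1 := dZ_smooth b oZ.
  have ss := form_field fs fb.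
  have s3 := smoothM (@smooth_cst _ _ _ m2 x) s1.
  rewrite -(tangent_fZ _ tB s1) -(tangent_fD tB ss s3).
  apply: (tangent_ext tB); apply: filterS (OF_near oZ) => y oy.
  exact: sigma_Z_change.
rewrite H1 H2.
have tK := lie_tangent fb fB.
rewrite (sigma_change oZ tK).
have thK : th x (lieM (Z b) (fun y => conjv (Z b y)) x) = - iC.
  rewrite (th_lie_const (k := 0) fb fB).
  - by rewrite (OF_dth m_gt0 aCR ph b b oZ) eqxx mulr1.
  - by apply: filterS (OF_near oZ) => y oy; exact: (OF_th m_gt0 aCR ph b oy).
  - by apply: filterS (OF_near oZ) => y oy; exact: (OF_thc m_gt0 aCR ph b oy).
(* Expanding [Z_b, conj(Z_b)] f in the frame expresses conj(Z_b)(f_b) by Z_b(conj(f_b)) and first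
   derivatives. *)
have := tangent_F oZ tK.
rewrite (lieE _ _ (f_smooth (x := x))) -/(dZbar Z b) -/(dZ Z b) thK big_split/=.
rewrite sumrB.
set p := \sum_i th10 _ _ _ _ * _; set q := \sum_i th01 _ _ _ _ * _.
move=> /eqP; rewrite subr_eq => /eqP EA.
have EB : conjv (Z b x) (dZ Z b) = Z b x (dZbar Z b) - (p + q - iC * T x F).
  by rewrite EA; ring.
rewrite EB; ring.
Qed.

(** By [sigma_TE] the sum over b is iS + 4(m+1)N, which removes second derivatives and brackets. It
    enters with factor m + 2, and m further copies of iS make up 2(m+1) iS. *)
Lemma scalar_change Z x : OF Z x ->
  lam x * \sum_b ricci T10 th' nabla' Z^~ x (Z^~ b x) (conjv (Z^~ b x)) =
  \sum_b ricci T10 th nabla Z x (Z b x) (conjv (Z b x)) +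
  2 * (m%:R + 1) * (2 * m2 * df_norm Z x + iC * sigma_T Z x).
Proof.
move=> oZ; rewrite mulr_sumr (eq_bigr _ (fun b _ => ricci_change b oZ)).
rewrite big_split big_split/= sumr_const card_ord -[iC * _ *+ m]mulr_natl.
rewrite -[\sum_i m2 * _]mulr_sumr.
set S := \sum_i (_ + 2 * _).
have ES : S = iC * sigma_T Z x + 4 * (m%:R + 1) * df_norm Z x.
  by rewrite (sigma_TE oZ) subrK.
rewrite ES; move: (sigma_T Z x) (df_norm Z x) => p q; ring.
Qed.

(** The forms differ by the positive factor e^{2f} e^{mf}: one e^{2f} from theta and one e^f from
    each theta^a. *)
Lemma ray_conformal Z x : OF Z x ->
  ray (frame_mform T10 th' Z^~ x) = ray (frame_mform T10 th Z x).
Proof.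
move=> oZ; have o' := OF_scale oZ.
have th10'Z a b : th10' Z^~ a x (Z b x) =
    (expR (1 * f x))%:C * (b == a)%:R.
  rewrite (theta10'E oZ a (OF_tangent b oZ)).
  rewrite (OF_th10Z m_gt0 aCR ph a b oZ) (OF_th m_gt0 aCR ph b oZ).
  by rewrite mulr0 addr0.
rewrite (frame_mform_triangular m_gt0 aCR pint ph ph' o' oZ).
- have [_ T1 _] := reeb_is_reeb m_gt0 aCR pint ph oZ.
  under eq_bigr => a _ do rewrite th10'Z eqxx mulr1.
  rewrite prodr_const T1 mulr1 -rmorphXn -rmorphM/=.
  by apply: ray_scale; rewrite mulr_gt0// ?exprn_gt0// expR_gt0.
- by move=> a b ab; rewrite th10'Z eq_sym (negPf ab) mulr0.
- by move=> b; rewrite (OF_th m_gt0 aCR ph b oZ) mulr0.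
Qed.

(** * Change of the Levi form and of A_theta *)

Hypothesis (pos : levi_positive T10 th).
Implicit Types (q : Fpoint M) (V W : tvec R (Fpoint M)).
Local Notation PF := (Fparams T10).
Local Notation Fproj := (@Fproj R m M).
Local Notation dFproj := (@dFproj R m M).
Local Notation fsec th Z := (fun y => (y, ray (frame_mform T10 th Z y)) : Fpoint M).

(* [- i df(J v)], where J v = i (pr10 v - pr01 v). *)
Definition beta x v : C := pr10 T10 th x v F - pr01 T10 th x v F.
(** A frame-free form of N, equal to -2i N: frames are chosen point by point, and the final
    computation combines lemmas that use different ones. *)
Definition kappa x : C := pr10 T10 th x (lam x *: reeb th' x) F.

Lemma betaE Z x v : OF Z x -> tangentM x v -> beta x v =
  \sum_a (th10 Z a x v * dZ Z a x - th01 Z a x v * dZbar Z a x).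
Proof.
move=> oZ tv; rewrite /beta (OF_pr10 m_gt0 aCR pint ph oZ tv).
rewrite (OF_pr01 m_gt0 aCR pint ph oZ tv) !tv_sum -sumrB.
by apply: eq_bigr => a _; rewrite !tvZ.
Qed.

Lemma th10_shift Z x a : OF Z x ->
  th10 Z a x (reeb_shift Z x) = - (2 * iC) * dZbar Z a x.
Proof.
move=> oZ; rewrite /theta10 (dth_shiftZc oZ).
by ring.
Qed.

Lemma kappaE Z x : OF Z x -> kappa x = - (2 * iC) * df_norm Z x.
Proof.
move=> oZ; rewrite /kappa (reeb'E oZ) scalerA.
rewrite mulfV ?expf_neq0// scale1r.
have tV := field_tangent (reeb_shift_field oZ).
rewrite (OF_pr10 m_gt0 aCR pint ph oZ tV) tv_sum /df_norm mulr_sumr.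
apply: eq_bigr => a _; rewrite tvZ (th10_shift a oZ) -mulrA; congr (_ * _).
exact: mulrC.
Qed.

(* Each Levi form annihilates its own Reeb field; the correction terms come from
   e^{2f} T' - T, a field tangent to H. *)
Lemma levi_change x v w : tangentM x v -> tangentM x w ->
  conjv v = v -> conjv w = w ->
  levi T10 th' x v w = lam x * (levi T10 th x v w
    - 2 * iC * (th x w * beta x v + th x v * beta x w)
    + 4 * iC * kappa x * th x v * th x w).
Proof.
move=> Tv Tw rv rw.
have [Z oZ] := exists_orthonormal_frame m_gt0 aCR ph pos x.
have o' := OF_scale oZ.
have real01 u a : tangentM x u -> conjv u = u ->
    conjc (th10 Z a x u) = th01 Z a x u.
  by move=> tu ru; rewrite -(conj_th01 ph a oZ tu) ru.
have real10 u a : tangentM x u -> conjv u = u ->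
    conjc (th01 Z a x u) = th10 Z a x u.
  by move=> tu ru; rewrite -(real01 _ _ tu ru) conjcK.
have thr u : tangentM x u -> conjv u = u -> conjc (th x u) = th x u.
  by move=> tu ru; rewrite -(ph_real ph tu) ru.
rewrite (OF_levi_th m_gt0 aCR pint ph' o' Tv Tw).
rewrite (OF_levi_th m_gt0 aCR pint ph oZ Tv Tw).
rewrite (betaE oZ Tv) (betaE oZ Tw) (kappaE oZ) /df_norm.
have dc a : conjc (dZ Z a x) = dZbar Z a x by rewrite /dZbar conjv_F.
have dcc a : conjc (dZbar Z a x) = dZ Z a x by rewrite -dc conjcK.
have i2 : conjc (2 * iC) = - (2 * iC) by rewrite conjcM conj_iC conjc_nat mulrN.
have c10 a : conjc (th10' Z^~ a x w) = expf 1 x *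
    (th01 Z a x w - 2 * iC * dZ Z a x * th x w).
  rewrite (theta10'E oZ a Tw) conjcM expf_conj conjcD.
  by rewrite real01// 2!conjcM i2 dcc thr// !mulNr.
have c01 a : conjc (th01' Z^~ a x w) = expf 1 x *
    (th10 Z a x w + 2 * iC * dZbar Z a x * th x w).
  rewrite (theta01'E oZ a Tw) conjcM expf_conj conjcB.
  by rewrite real10// 2!conjcM i2 dc thr// !mulNr opprK.
(* The identity holds for each a separately; e^{2f} is the product of the factors e^f of the two
   coframe values. *)
transitivity (lam x * \sum_a (
    (th10 Z a x v * conjc (th10 Z a x w) + th01 Z a x v * conjc (th01 Z a x w))
  - 2 * iC * (th x w * (th10 Z a x v * dZ Z a x - th01 Z a x v * dZbar Z a x)
     + th x v * (th10 Z a x w * dZ Z a x - th01 Z a x w * dZbar Z a x))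
  + 4 * iC * (- (2 * iC) * (dZ Z a x * dZbar Z a x)) * th x v * th x w)).
  rewrite mulr_sumr; apply: eq_bigr => a _.
  rewrite c10 c01 (theta10'E oZ a Tv).
  rewrite (theta01'E oZ a Tv) real01// real10// -eu_eu.
  move: iC (expf 1 x) (th10 Z a x v) (th10 Z a x w) (th01 Z a x v) (th01 Z a x w)
    (dZ Z a x) (dZbar Z a x) (th x v) (th x w) => *.
  by ring.
congr (_ * _); rewrite big_split/= sumrB; congr (_ - _ + _).
  by rewrite -mulr_sumr big_split/= -!mulr_sumr.
by rewrite -!mulr_suml -!mulr_sumr.
Qed.

Context {s s' : M -> C} {A A' : form1 R (Fpoint M)}.
Hypotheses (ws : webster_scalar T10 th nabla s) (ws' : webster_scalar T10 th' nabla' s').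
Hypotheses (wA : webster_connection_form T10 th nabla A)
  (wA' : webster_connection_form T10 th' nabla' A').

(** The two sections coincide near x, and tangent vectors see only germs. *)
Lemma fsec_conformal Z x v : OF Z x -> tangentM x v ->
  Defs.pushforward PF (fsec th' Z^~) x v = Defs.pushforward PF (fsec th Z) x v.
Proof.
move=> oZ tv; apply/funext => g; rewrite /Defs.pushforward.
rewrite (ray_conformal oZ); case: ifP => // _.
apply: (tangent_ext tv); apply: filterS (OF_near oZ) => y oy /=.
by rewrite (ray_conformal oy).
Qed.

(** Both frames give the same section through q, so the splitting of V is common to both connection
    forms and its vertical part drops from the difference. In the rest, -S theta from the trace
    meets -i/(2(m+1)) 2(m+1) iS theta = S theta from the curvature. *)
Lemma A_theta_change q V : Fc T10 q -> tangent PF q V ->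
  A_theta th' A' s' q V = A_theta th A s q V - m2 * (beta (Fproj q) (dFproj q V) -
    kappa (Fproj q) * th (Fproj q) (dFproj q V)).
Proof.
move=> Fq tV; have [Z [k [[oZ sq] tv tP tF VE]]] :=
  Fc_tangent_decomp m_gt0 aCR pint ph pos tV.
have [[cA hA] [cA' hA']] := (wA, wA').
have [sA _ fA _] := cA _ Fq; have [sA' _ fA' _] := cA' _ Fq.
have o' := OF_scale oZ.
set x := Fproj q in oZ sq tv tP VE *; set v := dFproj q V in tv tP VE *.
have AE : A q V = k * iC - \sum_a omega T10 th nabla Z a a x v.
  rewrite {1}VE (connection_lin tV sA)// fA; congr (_ + _).
  by rewrite -{1}sq; exact: (hA _ _ _ oZ tv).
have AE' : A' q V = k * iC - \sum_a omega T10 th' nabla' Z^~ a a x v.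
  rewrite {1}VE (connection_lin tV sA')// fA'; congr (_ + _).
  have sq' : fsec th' Z^~ x = q.
    by rewrite -[RHS]sq (ray_conformal oZ).
  rewrite -fsec_conformal// -{1}sq'; exact: (hA' _ _ _ o' tv).
rewrite /A_theta AE AE' -/x -/v.
have S := sigma_change oZ tv.
rewrite -[\sum_a omega T10 th' nabla' _ _ _ _ _]/(sigma (T10 := T10) (th := th')
  (nabla := nabla') _ x v) S.
have SC := scalar_change oZ.
rewrite -(ws oZ) -(ws' o') in SC.
rewrite -(betaE oZ tv) (kappaE oZ).
rewrite (_ : iC / (2 * (m%:R + 1)) * s' x * (lam x * th x v) =
  iC / (2 * (m%:R + 1)) * (lam x * s' x) * th x v); last by ring.
rewrite SC -[\sum_a omega _ _ _ _ _ _ _ _]/(sigma (T10 := T10) (th := th)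
  (nabla := nabla) Z x v).
have m0 : m%:R + 1 != 0 :> C by rewrite natr1 pnatr_eq0.
move: (sigma Z x v) (beta x v) (sigma_T Z x) (th x v) (s x) (df_norm Z x) => a1 a2 a3 a4 a5 a6.
rewrite (_ : iC / (2 * (m%:R + 1)) *
   (a5 + 2 * (m%:R + 1) * (2 * (m%:R + 2) * a6 + iC * a3)) * a4 =
   iC / (2 * (m%:R + 1)) * a5 * a4 + 2 * iC * m2 * a6 * a4 + iC * iC * a3 * a4).
  by rewrite mulii; ring.
by field; rewrite m0.
Qed.

End Conformal_change.

Theorem theorem1 (R : realType) (m : nat) (M : manifold R (2 * m).+1)
    (T10 : M -> set (tvec R M)) (theta : form1 R M) (f : M -> R)
    (F F' : Fpoint M -> tvec R (Fpoint M) -> tvec R (Fpoint M) -> R[i])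
    (m_gt0 : (0 < m)%N)
    (M_connected : connected [set: M])
    (CR_struct : almost_CR T10)
    (CR_nondeg : CR_nondegenerate T10)
    (CR_pint : partially_integrable T10)
    (theta_herm : pseudo_hermitian T10 theta)
    (theta_pos : levi_positive T10 theta)
    (f_smooth : forall x, smooth_at (mparams M) (fun y => (f y)%:C) x)
    (F_metric : is_fefferman_metric T10 theta F)
    (F'_metric : is_fefferman_metric T10
       (fun x v => (expR (2 * f x))%:C * theta x v) F') :
  forall q v w, Fc T10 q ->
    real_tangent (Fparams T10) q v -> real_tangent (Fparams T10) q w ->
    F' q v w = (expR (2 * f (Fproj q)))%:C * F q v w.
Proof.
have [nabla [s [A [tw ws wA FE]]]] := F_metric.
have [nabla' [s' [A' [tw' ws' wA' FE']]]] := F'_metric.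
move=> q v w Fq rv rw; rewrite (FE _ _ _ Fq rv rw) (FE' _ _ _ Fq rv rw).
have [[tv cv] [tw0 cw]] := (rv, rw).
have D V := A_theta_change m_gt0 CR_struct CR_pint theta_herm f_smooth
  tw tw' theta_pos ws ws' wA wA' (V := V) Fq.
have tM V : tangent (Fparams T10) q V -> tangent (mparams M) (Fproj q) (dFproj q V).
  move=> /(Fc_tangent_decomp m_gt0 CR_struct CR_pint theta_herm theta_pos).
  by move=> [Z [k []]].
rewrite (levi_change m_gt0 CR_struct CR_pint theta_herm f_smooth theta_pos (tM _ tv)
  (tM _ tw0) (conjv_dFproj q cv) (conjv_dFproj q cw)) (D _ tv) (D _ tw0) /expf.
have m0 : m%:R + 2 != 0 :> R[i] by rewrite -(natrD _ m 2) pnatr_eq0 addn2.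
(* What remains is an identity of scalars: m + 2 in the change of A_theta cancels the denominator of
   4/(m+2), and the terms in [beta] and [kappa] cancel those of the Levi form. *)
move: (levi _ _ _ _ _) (A_theta _ _ _ _ v) (A_theta _ _ _ _ w) (theta _ (dFproj q v))
  (theta _ (dFproj q w)) (beta _ (dFproj q v)) (beta _ (dFproj q w)) (kappa _) _%:C.
move=> a1 a2 a3 a4 a5 a6 a7 a8 a9.
by field; rewrite m0.
Qed.
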